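(* For $1\le p,q<\infty$, $\mathcal{M}^{p,q}\subset\Pi^q(M^{p'};M^q)$, where $\Pi^q(M^{p'};M^q)$ is the Banach space of $q$-summing operators from $M^{p'}(\mathbb{R}^d)$ to $M^q(\mathbb{R}^d)$ and $\frac1p+\frac1{p'}=1$.
   Context: For $z=(z_1,z_2)\in\mathbb{R}^{2d}$, $(\pi(z)f)(t)=e^{2\pi i z_2\cdot t}f(t-z_1)$; $V_gf(z)=\langle f,\pi(z)g\rangle$; $\varphi_0(t)=2^{d/4}e^{-\pi|t|^2}$. $M^r(\mathbb{R}^d)=\{f\in\mathscr{S}'(\mathbb{R}^d):V_{\varphi_0}f\in L^r(\mathbb{R}^{2d})\}$ with norm $\|V_{\varphi_0}f\|_{L^r}$. $\mathfrak{S}'$ is the space of continuous linear operators $\mathscr{S}(\mathbb{R}^d)\to\mathscr{S}'(\mathbb{R}^d)$. $\mathcal{M}^{p,q}$ is the space of $T\in\mathfrak{S}'$ such that $Q_{S_0}T(w,z):=\langle T\pi(w)\varphi_0,\pi(z)\varphi_0\rangle_{\mathscr{S}',\mathscr{S}}$ satisfies $$\|T\|_{\mathcal{M}^{p,q}}=\Big(\int_{\mathbb{R}^{2d}}\Big(\int_{\mathbb{R}^{2d}}|Q_{S_0}T(w,z)|^p\,dw\Big)^{q/p}dz\Big)^{1/q}<\infty .$$ Such a $T$ is regarded as an operator on $M^{p'}(\mathbb{R}^d)$ through the canonical extension $\langle Tf,h\rangle:=\langle f,T^*h\rangle_{M^{p'},M^p}$, $f\in M^{p'}(\mathbb{R}^d)$,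 $h\in\mathscr{S}(\mathbb{R}^d)$ (for which $T^*h\in M^p(\mathbb{R}^d)$). A bounded operator $A:X\to Y$ between Banach spaces is $q$-summing if there is $C>0$ such that for all finite families $x_1,\dots,x_N\in X$, $\sum_{n}\|Ax_n\|_Y^q\le C^q\sup_{\xi\in X',\|\xi\|\le1}\sum_n|\xi(x_n)|^q$. *)

(* Defs.v *)
From HB Require Import structures.
From mathcomp Require Import all_boot all_order all_algebra.
From mathcomp Require Import all_classical all_reals all_analysis.
From mathcomp Require Import complex ring lra.

Set Implicit Arguments.
Unset Strict Implicit.
Unset Printing Implicit Defensive.

Import Order.TTheory GRing.Theory Num.Theory.
Import numFieldNormedType.Exports.

Local Open Scope classical_set_scope.
Local Open Scope ring_scope.

(* R[i] typed as a [numClosedFieldType], so that the topology and the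
   normed-module structure of a numeric field over itself are inferred. *)
Definition Cplx (R : realType) : numClosedFieldType := R[i].

Definition cabs (R : realType) (z : Cplx R) : R := Normc.normc z.
Definition cconj (R : realType) (z : Cplx R) : Cplx R := conjc z.

Section measurable_rV.
Context (R : realType) (n : nat).

Let coors : 'I_n -> 'rV[R]_n -> measurableTypeR R := fun i x => x ord0 i.

Let rV_set0 : g_sigma_preimage coors set0.
Proof. exact: sigma_algebra0. Qed.

Let rV_setC A : g_sigma_preimage coors A -> g_sigma_preimage coors (~` A).
Proof. exact: sigma_algebraC. Qed.

Let rV_bigcup (F : (set 'rV[R]_n)^nat) :
  (forall i, g_sigma_preimage coors (F i)) ->
  g_sigma_preimage coors (\bigcup_i (F i)).
Proof. exact: sigma_algebra_bigcup. Qed.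

HB.instance Definition _ := @isMeasurable.Build default_measure_display
  'rV[R]_n (g_sigma_preimage coors) rV_set0 rV_setC rV_bigcup.

Lemma measurable_coord (i : 'I_n) :
  measurable_fun [set: 'rV[R]_n] (fun x : 'rV[R]_n => x ord0 i : measurableTypeR R).
Proof.
move=> _ Y mY; apply: sub_sigma_algebra.
by rewrite (bigD1 i)//=; left; exists Y.
Qed.

End measurable_rV.

Section measurable_fun_rV.
Context d (T : measurableType d) (R : realType).

Lemma measurable_fun_rV n (f : T -> 'rV[R]_n) :
  (forall i, measurable_fun [set: T] (fun t => f t ord0 i : measurableTypeR R)) ->
  measurable_fun [set: T] f.
Proof.
move=> mf; pose C := \big[setU/set0]_(i < n) preimage_set_system setT
  (fun x : 'rV[R]_n => x ord0 i : measurableTypeR R) measurable.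
apply: (@measurability _ _ _ _ _ _ C) => //.
move=> _ [A CA <-].
suff [i [B mB <-]] : exists i : 'I_n, preimage_set_system setT
    (fun x : 'rV[R]_n => x ord0 i : measurableTypeR R) measurable A.
  rewrite !setTI -[X in measurable X]setTI; exact: (mf i).
move: CA; rewrite /C; elim/big_ind : _ => //.
- by move=> P Q IP IQ [/IP|/IQ].
- by move=> i _ ?; exists i.
Qed.

End measurable_fun_rV.

Section lebesgue_rV.
Context (R : realType).

Definition cons_rV n (xv : measurableTypeR R * 'rV[R]_n) : 'rV[R]_n.+1 :=
  \row_j oapp (xv.2 ord0) xv.1 (unlift ord0 j).

Let measurable_cons_rV n : measurable_fun [set: _] (@cons_rV n).
Proof.
apply: measurable_fun_rV => i; case: (unliftP ord0 i) => [j ->|->].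
  under eq_fun do rewrite mxE liftK.
  exact: (measurableT_comp (@measurable_coord R n j) measurable_snd).
under eq_fun do rewrite mxE unlift_none.
  exact: measurable_fst.
Qed.

HB.instance Definition _ n :=
  isMeasurableFun.Build _ _ _ _ (@cons_rV n) (@measurable_cons_rV n).

Section step.
Context n (m : {sigma_finite_measure set 'rV[R]_n -> \bar R}).

Definition lebesgue_step : set 'rV[R]_n.+1 -> \bar R :=
  pushforward (lebesgue_measure \x m)%E (@cons_rV n).

Let step0 : lebesgue_step set0 = 0%E.
Proof. exact: measure0. Qed.

Let step_ge0 A : (0 <= lebesgue_step A)%E.
Proof. exact: measure_ge0. Qed.

Let step_sigma_additive : semi_sigma_additive lebesgue_step.
Proof. exact: measure_semi_sigma_additive. Qed.

HB.instance Definition _ := isMeasure.Build _ _ _ lebesgue_step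
  step0 step_ge0 step_sigma_additive.

Let step_sigma_finite : sigma_finite [set: 'rV[R]_n.+1] lebesgue_step.
Proof.
have [H TH Hoo] : sigma_finite setT (lebesgue_measure \x m)%E.
  have /sigma_finiteP[F [TF ndF Foo]] := sigma_finiteT (@lebesgue_measure R).
  have /sigma_finiteP[G [TG ndG Goo]] := sigma_finiteT m.
  exists (fun k => F k `*` G k).
    rewrite -setXTT TF TG predeqE => -[x y]; split.
      move=> [/= [i _ Fix] [k _ Gky]]; exists (maxn i k) => //; split.
      - by move: x Fix; exact/subsetPset/ndF/leq_maxl.
      - by move: y Gky; exact/subsetPset/ndG/leq_maxr.
    by move=> [i _ []/= ? ?]; split; exists i.
  move=> k; have [? ?] := Foo k; have [? ?] := Goo k.
  split; first exact: measurableX.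
  by rewrite product_measure1E// lte_mul_pinfty// ge0_fin_numE.
pose uncons (x : 'rV[R]_n.+1) : measurableTypeR R * 'rV[R]_n :=
  (x ord0 ord0, \row_j x ord0 (lift ord0 j)).
have muncons : measurable_fun [set: _] uncons.
  apply/measurable_fun_pairP; split; first exact: measurable_coord.
  apply: measurable_fun_rV => i; under eq_fun do rewrite mxE.
  exact: measurable_coord.
have consK : cancel (@cons_rV n) uncons.
  move=> [x v]; rewrite /uncons /cons_rV; congr pair.
    by rewrite mxE unlift_none.
  by apply/rowP => j; rewrite !mxE liftK.
exists (fun k => uncons @^-1` H k).
  by rewrite -preimage_bigcup -TH preimage_setT.
move=> k; have [mH Hk] := Hoo k; split.
  by rewrite -[X in measurable X]setTI; exact: muncons.
rewrite /lebesgue_step /pushforward -comp_preimage.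
by rewrite (_ : uncons \o _ = id)//; apply/funext => x; exact: consK.
Qed.

HB.instance Definition _ :=
  Measure_isSigmaFinite.Build _ _ _ lebesgue_step step_sigma_finite.

End step.

(* Lebesgue measure on R^n: the n-fold product of Lebesgue measure on R. *)
Fixpoint lebesgue_rV n : {sigma_finite_measure set 'rV[R]_n -> \bar R} :=
  match n with
  | 0 => \d_(0 : 'rV[R]_0)
  | k.+1 => lebesgue_step (lebesgue_rV k)
  end.

End lebesgue_rV.

Section partials.
Context (R : realType) (d : nat).
Implicit Types (f : 'rV[R]_d -> Cplx R) (g h : 'rV[R]_d -> R) (a b : seq 'I_d).

(* A multi-index is encoded as a word in the coordinates: x^a is the product of
   the x_i, i in a, and partials b g differentiates once along each i in b; the
   order of the letters does not matter for C^oo functions. *)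
Definition monomial a (x : 'rV[R]_d) : R := \prod_(i <- a) x ord0 i.

Definition partials b g : 'rV[R]_d -> R :=
  foldr (fun i h => 'D_(delta_mx ord0 i) h) g b.

Definition smooth g :=
  forall b, continuous (partials b g) /\
    forall i x, derivable (partials b g) x (delta_mx ord0 i).

Definition cpartials b f (x : 'rV[R]_d) : Cplx R :=
  Complex (partials b (fun y => complex.Re (f y)) x) (partials b (fun y => complex.Im (f y)) x).

Definition is_schwartz f :=
  [/\ smooth (fun x => complex.Re (f x)), smooth (fun x => complex.Im (f x)) &
      forall a b, exists M : R, forall x,
        `|monomial a x| * cabs (cpartials b f x) <= M].

Lemma partials_lin k l g h : smooth g -> smooth h -> forall b,
  partials b (fun x => k * g x + l * h x) =
  (fun x => k * partials b g x + l * partials b h x).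
Proof.
move=> sg sh; elim=> [//|i b IH] /=; rewrite IH; apply/funext => x.
have dg := (sg b).2 i x; have dh := (sh b).2 i x.
have := @deriveD _ _ _ (k *: partials b g) (l *: partials b h) x (delta_mx ord0 i)
  (@derivableZ _ _ _ _ k _ _ dg) (@derivableZ _ _ _ _ l _ _ dh).
by rewrite !deriveZ.
Qed.

Lemma smooth_lin k l g h : smooth g -> smooth h ->
  smooth (fun x => k * g x + l * h x).
Proof.
move=> sg sh b; rewrite partials_lin//; split.
  move=> x; apply: (@continuousD _ _ _ (k *: partials b g) (l *: partials b h)).
  - by apply: continuousZr; exact: (sg b).1.
  - by apply: continuousZr; exact: (sh b).1.
move=> i x; have dg := (sg b).2 i x; have dh := (sh b).2 i x.
exact: (@derivableD _ _ _ (k *: partials b g) (l *: partials b h) x (delta_mx ord0 i)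
  (@derivableZ _ _ _ _ k _ _ dg) (@derivableZ _ _ _ _ l _ _ dh)).
Qed.

Lemma cabs_ge0 (z : Cplx R) : 0 <= cabs z.
Proof. by case: z => x y; exact: sqrtr_ge0. Qed.

Lemma cabs_Re (z : Cplx R) : `|complex.Re z| <= cabs z.
Proof.
case: z => x y /=; rewrite /cabs /= -sqrtr_sqr ler_wsqrtr// lerDl sqr_ge0 //.
Qed.

Lemma cabs_Im (z : Cplx R) : `|complex.Im z| <= cabs z.
Proof.
case: z => x y /=; rewrite /cabs /= -sqrtr_sqr ler_wsqrtr// lerDr sqr_ge0 //.
Qed.

Lemma cabs_le (z : Cplx R) : cabs z <= `|complex.Re z| + `|complex.Im z|.
Proof.
case: z => x y /=; rewrite /cabs /=.
rewrite -(ger0_norm (addr_ge0 (normr_ge0 x) (normr_ge0 y))) -sqrtr_sqr.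
rewrite ler_wsqrtr// sqrrD !real_normK ?num_real//.
by rewrite addrAC lerDl mulrn_wge0// mulr_ge0.
Qed.

Lemma Re_lin k f f' : (fun x => complex.Re ((k *: f + f') x)) =
  (fun x => 1 * (complex.Re k * complex.Re (f x) +
                 - complex.Im k * complex.Im (f x)) + 1 * complex.Re (f' x)).
Proof.
apply/funext => x; rewrite !mul1r -[(k *: f + f') x]/(k * f x + f' x).
by case: k (f x) (f' x) => [k1 k2] [f1 f2] [g1 g2] /=; rewrite mulNr.
Qed.

Lemma Im_lin k f f' : (fun x => complex.Im ((k *: f + f') x)) =
  (fun x => 1 * (complex.Re k * complex.Im (f x) +
                 complex.Im k * complex.Re (f x)) + 1 * complex.Im (f' x)).
Proof.
apply/funext => x; rewrite !mul1r -[(k *: f + f') x]/(k * f x + f' x).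
by case: k (f x) (f' x) => [k1 k2] [f1 f2] [g1 g2].
Qed.

Lemma cpartials_lin k f f' b : is_schwartz f -> is_schwartz f' ->
  cpartials b (k *: f + f') = k *: cpartials b f + cpartials b f'.
Proof.
move=> [sRf sIf _] [sRg sIg _]; apply/funext => x.
rewrite -[RHS]/(k * cpartials b f x + cpartials b f' x).
have sR := smooth_lin (complex.Re k) (- complex.Im k) sRf sIf.
have sI := smooth_lin (complex.Re k) (complex.Im k) sIf sRf.
rewrite /cpartials Re_lin Im_lin !partials_lin// {sR sI}.
by case: k => [k1 k2]; rewrite !mul1r mulNr.
Qed.

Lemma cabs_lin (k z w : Cplx R) : cabs (k * z + w) <= cabs k * cabs z + cabs w.
Proof. by rewrite /cabs -Normc.normcM; exact: le_normcD. Qed.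

End partials.

Section schwartz.
Context (R : realType) (d : nat).

Definition schwartz_pred : {pred 'rV[R]_d -> Cplx R} :=
  fun f => `[< is_schwartz f >].

Lemma schwartz_submod_closed : GRing.submod_closed schwartz_pred.
Proof.
have s0 : smooth (fun _ : 'rV[R]_d => 0 : R).
  have E b : partials b (fun _ : 'rV[R]_d => 0 : R) = (fun _ => 0).
    by elim: b => //= i b ->; apply/funext => x; exact: (derive_cst (0 : R)).
  move=> b; rewrite E; split; first by move=> x; exact: cst_continuous.
  by move=> i x; exact: derivable_cst.
have P0 b x : partials b (fun _ : 'rV[R]_d => 0 : R) x = 0.
  by elim: b x => //= i b IH x; rewrite (funext IH); exact: (derive_cst (0 : R)).
split.
  apply/asboolP; split => // a b; exists 0 => x.
  by rewrite /cpartials /= !P0 /cabs /= expr0n /= addr0 sqrtr0 mulr0.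
move=> k f g /asboolP Sf /asboolP Sg.
have [[sRf sIf bf] [sRg sIg bg]] := (Sf, Sg).
apply/asboolP; split.
- by rewrite Re_lin; apply: smooth_lin => //; exact: smooth_lin.
- by rewrite Im_lin; apply: smooth_lin => //; exact: smooth_lin.
move=> a b; have [M1 HM1] := bf a b; have [M2 HM2] := bg a b.
exists (cabs k * M1 + M2) => x; rewrite cpartials_lin//.
apply: (le_trans (ler_wpM2l (normr_ge0 _) (cabs_lin _ _ _))).
rewrite mulrDr; apply: lerD => //; rewrite mulrCA; apply: ler_wpM2l => //.
exact: cabs_ge0.
Qed.

HB.instance Definition _ := GRing.isSubmodClosed.Build (Cplx R)
  ('rV[R]_d -> Cplx R) schwartz_pred schwartz_submod_closed.

Record schwartz := Schwartz {
  schwartz_fun :> 'rV[R]_d -> Cplx R;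
  _ : schwartz_fun \in schwartz_pred }.

HB.instance Definition _ := [isSub for schwartz_fun].
HB.instance Definition _ := [Choice of schwartz by <:].
HB.instance Definition _ := [SubChoice_isSubLmodule of schwartz by <:].

End schwartz.

Section gaussian.
Context (R : realType) (d : nat).
Implicit Types (x t : 'rV[R]_d) (z : 'rV[R]_d * 'rV[R]_d).

Definition dotrv x t : R := \sum_i x ord0 i * t ord0 i.

Definition cis (u : R) : Cplx R := Complex (cos u) (sin u).

Definition tf_shift z (f : 'rV[R]_d -> Cplx R) : 'rV[R]_d -> Cplx R :=
  fun t => cis (2 * pi * dotrv z.2 t) * f (t - z.1).

Definition gaussian t : Cplx R :=
  Complex (2 `^ (d%:R / 4) * expR (- pi * dotrv t t)) 0.

Inductive poly_fun : ('rV[R]_d -> R) -> Prop :=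
| poly_cst c : poly_fun (fun _ => c)
| poly_coord i : poly_fun (fun x => x ord0 i)
| poly_add f g : poly_fun f -> poly_fun g -> poly_fun (fun x => f x + g x)
| poly_mul f g : poly_fun f -> poly_fun g -> poly_fun (fun x => f x * g x).

(* Real and imaginary parts of the partial derivatives of tf_shift z gaussian
   belong to gauss_class z. *)
Definition gauss_class z (f : 'rV[R]_d -> R) := exists P Q,
  [/\ poly_fun P, poly_fun Q & f = fun x =>
      expR (- pi * dotrv (x - z.1) (x - z.1)) *
      (P x * cos (2 * pi * dotrv z.2 x) + Q x * sin (2 * pi * dotrv z.2 x))].

Lemma is_derive_coord x i (v : 'rV[R]_d) :
  is_derive x v (fun y : 'rV[R]_d => y ord0 i) (v ord0 i).
Proof.
have df := @differentiable_coord R 1 d x ord0 i.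
apply: DeriveDef; first exact: diff_derivable.
rewrite /derive; apply: cvg_lim => //.
apply: cvg_near_cst; near=> h.
rewrite /= !mxE addrK /GRing.scale /= mulKf//.
by near: h; exact: nbhs_dnbhs_neq.
Unshelve. all: by end_near. Qed.

Lemma derive_line (g : 'rV[R]_d -> R) x v :
  'D_(1 : R) (fun h : R => g (h *: v + x)) 0 = 'D_v g x.
Proof.
rewrite /derive; set g1 := fun h => h^-1 *: _; set g2 := fun h => h^-1 *: _.
suff -> : g1 = g2 by [].
by apply/funext => h; rewrite /g1 /g2 /= [h *: 1]mulr1 addr0 scale0r add0r.
Qed.

Lemma is_derive_chain (F : R -> R) (g : 'rV[R]_d -> R) x v dF dg :
  is_derive x v g dg -> is_derive (g x) 1 F dF ->
  is_derive x v (fun y => F (g y)) (dF * dg).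
Proof.
move=> [gx <-] FX.
pose G (h : R) := g (h *: v + x).
have G0 : G 0 = g x by rewrite /G scale0r add0r.
have dG : derivable G 0 1 by exact: (derivable1P g x v).1.
have DG : is_derive (0 : R) 1 G ('D_v g x).
  by apply: DeriveDef => //; exact: derive_line.
have FG : is_derive (G 0) 1 F dF by rewrite G0.
have H := is_derive1_comp FG DG.
apply: DeriveDef.
  by apply/derivable1P; exact: (@ex_derive _ _ _ _ _ _ _ H).
rewrite -[RHS](@derive_val _ _ _ _ _ _ _ H).
by rewrite -(derive_line (fun y => F (g y))).
Qed.

Lemma poly_funE f g : poly_fun f -> f =1 g -> poly_fun g.
Proof. by move=> pf /funext <-. Qed.

Lemma poly_sum (F : 'I_d -> 'rV[R]_d -> R) :
  (forall i, poly_fun (F i)) -> poly_fun (fun x => \sum_i F i x).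
Proof.
move=> pF; elim: (index_enum _) => [|i s IH].
  by apply: poly_funE (poly_cst 0) _ => x; rewrite big_nil.
by apply: poly_funE (poly_add (pF i) IH) _ => x; rewrite big_cons.
Qed.

Lemma poly_bump z : poly_fun (fun x => - pi * dotrv (x - z.1) (x - z.1)).
Proof.
apply: poly_mul; first exact: poly_cst.
have pc i : poly_fun (fun x => (x - z.1) ord0 i).
  apply: poly_funE (poly_add (poly_coord i) (poly_cst (- z.1 ord0 i))) _ => x.
  by rewrite !mxE.
by apply: poly_sum => i; exact: poly_mul.
Qed.

Lemma poly_phase z : poly_fun (fun x => 2 * pi * dotrv z.2 x).
Proof.
apply: poly_mul; first exact: poly_cst.
by apply: poly_sum => i; apply: poly_mul; [exact: poly_cst|exact: poly_coord].
Qed.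

Lemma poly_monomial a : poly_fun (monomial a).
Proof.
elim: a => [|i a IH].
  by apply: poly_funE (poly_cst 1) _ => x; rewrite /monomial big_nil.
apply: poly_funE (poly_mul (poly_coord i) IH) _ => x.
by rewrite /monomial big_cons.
Qed.

Lemma poly_derive P i : poly_fun P -> exists P', poly_fun P' /\
  forall x, is_derive x (delta_mx ord0 i : 'rV[R]_d) P (P' x).
Proof.
elim=> [c|j|f g _ [f' [pf' df]] _ [g' [pg' dg]]
       |f g pf [f' [pf' df]] pg [g' [pg' dg]]].
- by exists (fun _ => 0); split; [exact: poly_cst|move=> x; exact: is_derive_cst].
- exists (fun _ => (delta_mx ord0 i : 'rV[R]_d) ord0 j).
  by split; [exact: poly_cst|move=> x; exact: is_derive_coord].
- exists (fun x => f' x + g' x); split; first exact: poly_add.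
  by move=> x; exact: is_deriveD.
- exists (fun x => f x * g' x + g x * f' x); split.
    by apply: poly_add; exact: poly_mul.
  by move=> x; exact: is_deriveM.
Qed.

Lemma poly_continuous P : poly_fun P -> continuous P.
Proof.
elim=> [c|j|f g _ cf _ cg|f g _ cf _ cg] x.
- exact: cst_continuous.
- exact: coord_continuous.
- by apply: (@continuousD _ _ _ f g); [exact: cf|exact: cg].
- by apply: continuousM; [exact: cf|exact: cg].
Qed.

Lemma gauss_derive z f i : gauss_class z f -> exists f', gauss_class z f' /\
  forall x, is_derive x (delta_mx ord0 i : 'rV[R]_d) f (f' x).
Proof.
move=> [P [Q [pP pQ ->]]].
have [P' [pP' dP]] := poly_derive i pP.
have [Q' [pQ' dQ]] := poly_derive i pQ.
have [B' [pB' dB]] := poly_derive i (poly_bump z).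
have [F' [pF' dF]] := poly_derive i (poly_phase z).
have [pPB pQB pPF pQF] : [/\ poly_fun (fun x => P x * B' x),
  poly_fun (fun x => Q x * B' x), poly_fun (fun x => P x * F' x) &
  poly_fun (fun x => Q x * F' x)] by split; exact: poly_mul.
have pNPF := poly_mul (poly_cst (- 1)) pPF.
pose P1 x := P' x + P x * B' x + Q x * F' x.
pose Q1 x := Q' x + Q x * B' x + - 1 * (P x * F' x).
exists (fun x => expR (- pi * dotrv (x - z.1) (x - z.1)) *
  (P1 x * cos (2 * pi * dotrv z.2 x) + Q1 x * sin (2 * pi * dotrv z.2 x))).
split.
  exists P1, Q1; split => //.
  - by apply: poly_add => //; exact: poly_add.
  - by apply: poly_add => //; exact: poly_add.
move=> x.
have dE := is_derive_chain (dB x) (is_derive_expR _).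
have dC := is_derive_chain (dF x) (is_derive_cos _).
have dS := is_derive_chain (dF x) (is_derive_sin _).
have dPC := is_deriveM (dP x) dC.
have dQS := is_deriveM (dQ x) dS.
have dT := is_deriveM dE (is_deriveD dPC dQS).
apply: is_derive_eq dT _.
rewrite /P1 /Q1 /GRing.scale /=.
set E := expR _; set C := cos _; set S := sin _.
transitivity (E * (P x * (- S * F' x) + C * P' x + (Q x * (C * F' x) + S * Q' x)) +
  (P x * C + Q x * S) * (E * B' x)); first by [].
by ring.
Qed.

Lemma gauss_continuous z f : gauss_class z f -> continuous f.
Proof.
move=> [P [Q [pP pQ ->]]] x.
have cF := @poly_continuous _ (poly_phase z) x.
have cE : {for x, continuous (fun x => expR (- pi * dotrv (x - z.1) (x - z.1)))}.
  apply: (@continuous_comp _ _ _ _ expR); last exact: continuous_expR.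
  exact: (@poly_continuous _ (poly_bump z)).
have cC : {for x, continuous (fun x => cos (2 * pi * dotrv z.2 x))}.
  by apply: (@continuous_comp _ _ _ _ cos) => //; exact: continuous_cos.
have cS : {for x, continuous (fun x => sin (2 * pi * dotrv z.2 x))}.
  by apply: (@continuous_comp _ _ _ _ sin) => //; exact: continuous_sin.
have cP := @poly_continuous _ pP x; have cQ := @poly_continuous _ pQ x.
exact: (continuousM cE (continuousD (continuousM cP cC) (continuousM cQ cS))).
Qed.

Lemma gauss_partials z f b : gauss_class z f -> gauss_class z (partials b f).
Proof.
move=> gf; elim: b => //= i b /(gauss_derive i) [f' [gf' df']].
suff -> : 'D_(delta_mx ord0 i) (partials b f) = f' by [].
by apply/funext => x; exact: (@derive_val _ _ _ _ _ _ _ (df' x)).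
Qed.

Lemma gauss_smooth z f : gauss_class z f -> smooth f.
Proof.
move=> gf b; have gb := gauss_partials b gf.
split; first exact: gauss_continuous gb.
move=> i x; have [f' [_ df']] := gauss_derive i gb.
exact: (@ex_derive _ _ _ _ _ _ _ (df' x)).
Qed.

Lemma poly_growth P : poly_fun P -> exists A (k : nat), 0 <= A /\
  forall x, `|P x| <= A * expR (k%:R * \sum_i `|x ord0 i|).
Proof.
have S0 x : 0 <= \sum_i `|x ord0 i| :> R by exact: sumr_ge0.
elim=> [c|j|f g _ [A [k [A0 Af]]] _ [B [l [B0 Bg]]]
       |f g _ [A [k [A0 Af]]] _ [B [l [B0 Bg]]]].
- by exists `|c|, 0%N; split => // x; rewrite mul0r expR0 mulr1.
- exists 1, 1%N; split => // x; rewrite !mul1r.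
  rewrite (le_trans _ (expR_ge1Dx _))// (bigD1 j)//=.
  by rewrite addrCA lerDl addr_ge0// sumr_ge0.
- exists (A + B), (k + l)%N; split; first exact: addr_ge0.
  move=> x; rewrite (le_trans (ler_normD _ _))// mulrDl lerD//.
    rewrite (le_trans (Af x))// ler_wpM2l// ler_expR ler_wpM2r//.
    by rewrite ler_nat leq_addr.
  rewrite (le_trans (Bg x))// ler_wpM2l// ler_expR ler_wpM2r//.
  by rewrite ler_nat leq_addl.
- exists (A * B), (k + l)%N; split; first exact: mulr_ge0.
  move=> x; rewrite normrM natrD mulrDl expRD mulrACA.
  exact: ler_pM.
Qed.

Lemma poly_decay z P : poly_fun P -> exists M, forall x,
  expR (- pi * dotrv (x - z.1) (x - z.1)) * `|P x| <= M.
Proof.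
move=> /poly_growth [A [k [A0 Ak]]].
exists (A * expR (\sum_i (k%:R * `|z.1 ord0 i| + k%:R ^+ 2))) => x.
apply: (@le_trans _ _ (expR (- pi * dotrv (x - z.1) (x - z.1)) *
  (A * expR (k%:R * \sum_i `|x ord0 i|)))).
  by apply: ler_wpM2l => //; exact: expR_ge0.
rewrite mulrCA -expRD ler_wpM2l// ler_expR.
rewrite /dotrv mulr_sumr mulr_sumr -big_split /=.
apply: ler_sum => i _; rewrite !mxE.
set u := x ord0 i; set a := z.1 ord0 i.
have Hu : `|u| <= `|u - a| + `|a| by rewrite -{1}(subrK a u) ler_normD.
have H2 : (u - a) * (u - a) = `|u - a| ^+ 2 by rewrite -expr2 -normrX ger0_norm// sqr_ge0.
have k0 : 0 <= k%:R :> R by [].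
have p2 := @pi_ge2 R.
move: (normr_ge0 (u - a)) Hu; rewrite H2 => {H2}.
move: `|u - a| `|u| `|a| k%:R k0 => s v c m k0 s0 Hu.
have Hk := ler_wpM2l k0 Hu.
have Hsq : 0 <= (s - m / 2) ^+ 2 by exact: sqr_ge0.
have Hp : 0 <= (pi - 1) * s ^+ 2 :> R.
  by apply: mulr_ge0; [rewrite subr_ge0; lra|exact: sqr_ge0].
have K2 : 0 <= m ^+ 2 by exact: sqr_ge0.
by nra.
Qed.

Lemma gauss_decay z f b : gauss_class z f ->
  exists M, forall x, `|monomial b x| * `|f x| <= M.
Proof.
move=> [P [Q [pP pQ ->]]].
have [M HM] := poly_decay z (poly_mul (poly_monomial b) pP).
have [N HN] := poly_decay z (poly_mul (poly_monomial b) pQ).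
exists (M + N) => x; set E := expR _; set c := cos _; set s := sin _.
have E0 : 0 <= E by exact: expR_ge0.
apply: (le_trans _ (lerD (HM x) (HN x))).
rewrite -/E normrM (ger0_norm E0) mulrCA -mulrDr ler_wpM2l//.
rewrite !normrM -mulrDr ler_wpM2l//.
rewrite (le_trans (ler_normD _ _))// !normrM lerD//.
  by rewrite ler_piMr// ler_norml cos_geN1 cos_le1.
by rewrite ler_piMr// ler_norml sin_geN1 sin_le1.
Qed.

Lemma tf_shift_gaussian_schwartz z : is_schwartz (tf_shift z gaussian).
Proof.
pose K : R := 2 `^ (d%:R / 4).
have gR : gauss_class z (fun x => complex.Re (tf_shift z gaussian x)).
  exists (fun _ => K), (fun _ => 0); split; [exact: poly_cst|exact: poly_cst|].
  by apply/funext => x; rewrite /tf_shift /gaussian /cis /= -/K; ring.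
have gI : gauss_class z (fun x => complex.Im (tf_shift z gaussian x)).
  exists (fun _ => 0), (fun _ => K); split; [exact: poly_cst|exact: poly_cst|].
  by apply/funext => x; rewrite /tf_shift /gaussian /cis /= -/K; ring.
split; [exact: gauss_smooth gR|exact: gauss_smooth gI|] => a b.
have [M HM] := gauss_decay a (gauss_partials b gR).
have [N HN] := gauss_decay a (gauss_partials b gI).
exists (M + N) => x; apply: (le_trans _ (lerD (HM x) (HN x))).
by rewrite -mulrDr ler_wpM2l//; exact: cabs_le.
Qed.

End gaussian.

Section schwartz_topology.
Context (R : realType) (d : nat).
Local Notation S := (schwartz R d).
Implicit Types (f g h : S) (N : nat) (e : R).

Lemma schwartzP f : is_schwartz f.
Proof. by case: f => f /= /asboolP. Qed.

(* All seminorms sup_x |x^a (d^b f)(x)| with |a|, |b| <= N are at most e. *)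
Definition schwartz_le N e f := forall a b, (size a <= N)%N -> (size b <= N)%N ->
  forall x, `|monomial a x| * cabs (cpartials b f x) <= e.

Lemma schwartz_leD N e e' f g :
  schwartz_le N e f -> schwartz_le N e' g -> schwartz_le N (e + e') (f + g).
Proof.
move=> Nf Ng a b aN bN x.
have E : cpartials b (f + g) = cpartials b f + cpartials b g.
  have := cpartials_lin 1 b (schwartzP f) (schwartzP g).
  by rewrite !scale1r.
rewrite E; apply: (le_trans (ler_wpM2l (normr_ge0 _) (le_normcD _ _))).
by rewrite mulrDr lerD//; [exact: Nf|exact: Ng].
Qed.

Lemma schwartz_le0 N e : 0 < e -> schwartz_le N e 0.
Proof.
move=> e0 a b aN bN x.
have -> : cpartials b (0 : S) = 0.
  have := cpartials_lin (-1) b (schwartzP 0) (schwartzP 0).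
  by rewrite !scaleN1r !addNr.
by rewrite [cabs _]Normc.normc0 mulr0 ltW.
Qed.

Definition schwartz_nbhs f : set_system S :=
  [set A | exists N e, 0 < e /\ forall g, schwartz_le N e (g - f) -> A g].

HB.instance Definition _ := isPointed.Build S 0.
HB.instance Definition _ := hasNbhs.Build S schwartz_nbhs.

Let schwartz_nbhs_filter f : ProperFilter (nbhs f).
Proof.
split.
  by move=> [N [e [e0 /(_ f)]]]; apply; rewrite subrr; exact: schwartz_le0.
split.
- by exists 0%N, 1; split.
- move=> A B [N [e [e0 HA]]] [M [r [r0 HB]]].
  exists (maxn N M), (Num.min e r); split; first by rewrite lt_min e0.
  move=> g Hg; split.
  + apply: HA => a b aN bN x; apply: le_trans (Hg a b _ _ x) _.
    * by rewrite leq_max aN.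
    * by rewrite leq_max bN.
    * by rewrite ge_min lexx.
  + apply: HB => a b aN bN x; apply: le_trans (Hg a b _ _ x) _.
    * by rewrite leq_max aN orbT.
    * by rewrite leq_max bN orbT.
    * by rewrite ge_min lexx orbT.
- by move=> A B AB [N [e [e0 HA]]]; exists N, e; split => // g /HA /AB.
Qed.

Let schwartz_nbhs_singleton f (A : set S) : nbhs f A -> A f.
Proof.
by move=> [N [e [e0 HA]]]; apply: HA; rewrite subrr; exact: schwartz_le0.
Qed.

Let schwartz_nbhs_nbhs f (A : set S) : nbhs f A -> nbhs f (nbhs^~ A).
Proof.
move=> [N [e [e0 HA]]]; exists N, (e / 2); split; first exact: divr_gt0.
move=> g Hg; exists N, (e / 2); split; first exact: divr_gt0.
move=> h Hh; apply: HA; rewrite (splitr e) -(subrKA g).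
exact: schwartz_leD.
Qed.

HB.instance Definition _ := Nbhs_isNbhsTopological.Build S
  schwartz_nbhs_filter schwartz_nbhs_singleton schwartz_nbhs_nbhs.

End schwartz_topology.

Section tempered.
Context (R : realType) (d : nat).

(* <u, f> is conjugate-linear in f, so that it extends the L^2 inner product. *)
Definition tempered_pred : {pred schwartz R d -> Cplx R} := fun u =>
  `[< (forall k f g, u (k *: f + g) = cconj k * u f + u g) /\ continuous u >].

Lemma tempered_submod_closed : GRing.submod_closed tempered_pred.
Proof.
split.
  apply/asboolP; split; last by move=> f; exact: cst_continuous.
  by move=> k f g; rewrite mulr0 addr0.
move=> c u v /asboolP[lu cu] /asboolP[lv cv]; apply/asboolP; split.
  move=> k f g; rewrite -![(c *: u + v) _]/(c * u _ + v _) lu lv; ring.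
move=> f; apply: (@continuousD _ _ _ (c *: u) v); last exact: cv.
by apply: continuousZr; exact: cu.
Qed.

HB.instance Definition _ := GRing.isSubmodClosed.Build (Cplx R)
  (schwartz R d -> Cplx R) tempered_pred tempered_submod_closed.

Record tempered := Tempered {
  tempered_fun :> schwartz R d -> Cplx R;
  _ : tempered_fun \in tempered_pred }.

HB.instance Definition _ := [isSub for tempered_fun].
HB.instance Definition _ := [Choice of tempered by <:].
HB.instance Definition _ := [SubChoice_isSubLmodule of tempered by <:].

(* The weak-* topology: u --> v iff <u, f> --> <v, f> for all f. *)
HB.instance Definition _ := Topological.copy tempered
  (initial_topology (tempered_fun : tempered -> {ptws schwartz R d -> Cplx R})).

(* The space of continuous linear operators from S(R^d) to S'(R^d). *)
Record operator := Operator {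
  operator_fun :> schwartz R d -> tempered;
  operator_linear : linear operator_fun;
  operator_continuous : continuous operator_fun }.

Lemma continuous_cconj : continuous (@cconj R).
Proof.
move=> z A /nbhs_ballP [e e0 eA]; apply/nbhs_ballP; exists e => // w zw.
apply: eA; move: zw; rewrite /ball /= => zw.
apply: le_lt_trans zw; rewrite /cconj -(rmorphB (@conjc R)) !normc_def lecR.
by case: (z - w) => x y /=; rewrite sqrrN.
Qed.

Lemma adjoint_subproof (T : operator) (h : schwartz R d) :
  (fun g => cconj (T g h)) \in tempered_pred.
Proof.
apply/asboolP; split.
  by move=> k f g; rewrite operator_linear /cconj -rmorphM -rmorphD.
move=> f; apply: (@continuous_comp _ _ _ (fun g => T g h) (@cconj R)); last first.
  exact: continuous_cconj.
apply: (@continuous_comp _ _ _ T (fun u : tempered => u h)).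
  exact: operator_continuous.
apply: (@continuous_comp _ _ _ (tempered_fun : tempered -> {ptws schwartz R d -> Cplx R})
  (proj h)).
  exact: initial_continuous.
exact: proj_continuous.
Qed.

(* <T^* h, g> is the complex conjugate of <T g, h>. *)
Definition adjoint (T : operator) (h : schwartz R d) : tempered :=
  Tempered (adjoint_subproof T h).

End tempered.

Section modulation.
Context (R : realType) (d : nat).
Local Notation phase_space := ('rV[R]_d * 'rV[R]_d)%type.
Implicit Types (u v : tempered R d) (z w : phase_space) (T : operator R d).

Definition lebesgue_phase : {measure set phase_space -> \bar R} :=
  (lebesgue_rV R d \x lebesgue_rV R d)%E.

Lemma coherent_subproof z :
  tf_shift z (gaussian (R := R) (d := d)) \in schwartz_pred (R := R) (d := d).
Proof. by apply/asboolP; exact: tf_shift_gaussian_schwartz. Qed.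

(* pi(z) phi_0 *)
Definition coherent z : schwartz R d := Schwartz (coherent_subproof z).

(* V_{phi_0} u (z) *)
Definition stft u z : Cplx R := u (coherent z).

Definition modulation_norm (r : \bar R) u : \bar R :=
  Lnorm lebesgue_phase r (fun z => (cabs (stft u z))%:E).

Definition modulation (r : \bar R) : set (tempered R d) :=
  [set u | (modulation_norm r u < +oo)%E].

Definition cintegral (F : phase_space -> Cplx R) : Cplx R :=
  Complex (Rintegral lebesgue_phase setT (fun z => complex.Re (F z)))
          (Rintegral lebesgue_phase setT (fun z => complex.Im (F z))).

(* The duality of M^r' and M^r; no normalizing factor since phi_0 has L^2
   norm 1. *)
Definition modulation_pairing u v : Cplx R :=
  cintegral (fun z => stft u z * cconj (stft v z)).

Definition gabor_kernel T w z : Cplx R := T (coherent w) (coherent z).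

Definition opmodulation_norm (p q : R) T : \bar R :=
  ((\int[lebesgue_phase]_z
     (\int[lebesgue_phase]_w ((cabs (gabor_kernel T w z)) `^ p)%:E) `^ (q / p))
   `^ q^-1)%E.

Definition opmodulation (p q : R) : set (operator R d) :=
  [set T | (opmodulation_norm p q T < +oo)%E].

(* A is the canonical extension of T to M^r, where r is the conjugate exponent
   of p: <A f, h> = <f, T^* h> for the duality of M^r and M^p. *)
Definition canonical_extension (p : R) T (A : tempered R d -> tempered R d) :=
  (forall h, modulation p%:E (adjoint T h)) /\
  (forall f, modulation (hoelder_conjugate p%:E) f ->
     forall h, A f h = modulation_pairing f (adjoint T h)).

End modulation.

(* A normed space is given by a subset D of a C-vector space, its underlying
   set, together with a norm N, of which only the values on D matter. *)
Section summing.
Context (R : realType) (V W : lmodType (Cplx R)).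

Definition linear_on (U : lmodType (Cplx R)) (D : set V) (f : V -> U) :=
  forall k x y, D x -> D y -> f (k *: x + y) = k *: f x + f y.

Definition dual_ball (D : set V) (N : V -> \bar R) : set (V -> Cplx R) :=
  [set xi | linear_on D xi /\ forall x, D x -> ((cabs (xi x))%:E <= N x)%E].

Definition bounded_operator (D : set V) (N : V -> \bar R)
    (D' : set W) (N' : W -> \bar R) (A : V -> W) :=
  [/\ forall x, D x -> D' (A x), linear_on D A &
      exists C : R, forall x, D x -> (N' (A x) <= C%:E * N x)%E].

Definition summing (q : R) (D : set V) (N : V -> \bar R)
    (D' : set W) (N' : W -> \bar R) (A : V -> W) :=
  bounded_operator D N D' N' A /\
  exists2 C : R, 0 < C & forall n (x : 'I_n -> V), (forall i, D (x i)) ->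
    (\sum_(i < n) N' (A (x i)) `^ q <=
     (C `^ q)%:E * ereal_sup [set (\sum_(i < n) cabs (xi (x i)) `^ q)%:E |
                              xi in dual_ball D N])%E.

End summing.

(* Main.v *)
(** The coherent states reproduce Schwartz functions: for h in S(R^d),
    h = \int V_{phi_0}h(z) pi(z)phi_0 dz, also after applying any partial
    derivative, and the integral is a limit of finite combinations of coherent
    states in the topology of S(R^d).  Hence every tempered u satisfies
    |<u, h>| <= C |h|_N \int wt(z)^-1 |V_{phi_0}u(z)| dz for a fixed Schwartz
    seminorm |.|_N and a weight wt of polynomial growth with integrable inverse.
    Applied to u = T pi(w)phi_0, and combined with an elementary weighted
    inequality for mixed norms, this shows that T^* h lies in M^p, with norm at
    most B |h|_N.  The extension A f = <f, T^* .> therefore exists on M^p', and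
    Hoelder's inequality gives |V_{phi_0}(A f)(z)| <= 2 |f|_{M^p'} g(z), where
    g(z) = |T^* pi(z)phi_0|_{M^p} has L^q norm |T|_{M^{p,q}}.  So
    f |-> V_{phi_0}(A f)(z) / (2 g(z)) lies in the dual ball for each z, and
    integrating sum_n |V_{phi_0}(A f_n)(z)|^q over z gives the summing bound. *)

Require Import Defs.
From HB Require Import structures.
From mathcomp Require Import all_boot all_order all_algebra.
From mathcomp Require Import all_classical all_reals all_analysis.
From mathcomp Require Import measurable_realfun ess_sup_inf.
From mathcomp Require Import complex ring lra.

Set Implicit Arguments.
Unset Strict Implicit.
Unset Printing Implicit Defensive.

Import Order.TTheory GRing.Theory Num.Theory.
Import numFieldNormedType.Exports.

Local Open Scope classical_set_scope.
Local Open Scope ring_scope.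

(** * Integration on R^n *)

(** Of a tempered distribution only continuity for the Schwartz seminorms is known, so the
    reproducing integral has to be realised by finite sums before it can be evaluated. Phase space
    is therefore approximated by maps [s k] of finite range that never increase a coordinate in
    absolute value, and every x^a d^b of a coherent state is shown to be Lipschitz in z, uniformly
    in x, with a constant of polynomial growth. The same maps give the measurability of short-time
    Fourier transforms and the joint measurability of the Gabor kernel. Complex integrals are
    handled through real and imaginary parts, a sine being a cosine of shifted phase; bounding the
    two parts separately is the origin of the factor 2. The reproducing formula comes from a
    Gaussian cutoff in frequency, which makes Fubini applicable and turns the formula into a
    Gaussian approximate identity; it appears with the factor [kappa], the squared norm of the
    window. Two degenerate cases need care: p = 1, where Hoelder's inequality involves an essential
    supremum, and g(z) = 0, where the normalised functional is undefined but V_{phi_0}(A f)(z)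
    vanishes. *)

Section lebesgue_translation.
Context (R : realType).
Local Notation mu := (@lebesgue_measure R).

Lemma measurable_addr (c : R) :
  measurable_fun [set: measurableTypeR R]
    (fun x : measurableTypeR R => x + c : measurableTypeR R).
Proof. exact: measurable_funD. Qed.

(** The image of Lebesgue measure under the translation agrees with it on half-open intervals, hence
    equals it by uniqueness; the change of variables is then the pushforward formula. *)
Lemma ge0_integral_addr (f : measurableTypeR R -> \bar R) (c : R) :
  measurable_fun setT f -> (forall x, 0 <= f x)%E ->
  (\int[mu]_x f (x + c)%R = \int[mu]_x f x)%E.
Proof.
move=> mf f0; pose s (x : measurableTypeR R) : measurableTypeR R := x + c.
have ms : measurable_fun setT s by exact: measurable_addr.
pose S : {mfun measurableTypeR R >-> measurableTypeR R} := mfun_Sub (mem_set ms).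
have E A : measurable A -> pushforward mu S A = mu A.
  move=> mA; apply/esym/lebesgue_measure_unique => //= _ [[a b]] _ <-.
  rewrite /pushforward/= /s.
  have -> : (fun x : measurableTypeR R => x + c) @^-1` `]a, b]%classic = `](a - c), (b - c)]%classic.
    by apply/seteqP; split=> x /=; rewrite !in_itv/= ltrBlDr lerBrDr.
  rewrite !lebesgue_measure_itv/= !lte_fin ltrD2r.
  by case: ifP => // _; rewrite -!EFinD; congr (_%:E); lra.
transitivity (\int[pushforward mu S]_x f x)%E.
  by rewrite ge0_integral_pushforward.
by apply: eq_measure_integral => A mA _; exact: E.
Qed.

End lebesgue_translation.

Section rV_integral.
Context (R : realType).
Local Notation mu n := (lebesgue_rV R n).

Lemma measurable_consrV n : measurable_fun setT (@cons_rV R n).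
Proof. exact: measurable_funPT. Qed.

Lemma ge0_integral_rVS n (f : 'rV[R]_n.+1 -> \bar R) :
  measurable_fun setT f -> (forall x, 0 <= f x)%E ->
  (\int[mu n.+1]_x f x = \int[lebesgue_measure]_x \int[mu n]_v f (cons_rV (x, v)))%E.
Proof.
move=> mf f0.
transitivity (\int[pushforward (lebesgue_measure \x mu n)%E (@cons_rV R n)]_x f x)%E.
  by apply: eq_measure_integral => A mA _.
rewrite ge0_integral_pushforward//= fubini_tonelli1//.
by apply: measurableT_comp => //; exact: measurable_consrV.
Qed.

Lemma ge0_integral_rV0 (f : 'rV[R]_0 -> \bar R) :
  measurable_fun setT f -> (\int[mu 0]_x f x = f 0%R)%E.
Proof.
move=> mf; transitivity (\int[\d_(0%R : 'rV[R]_0)]_x f x)%E; first by [].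
by rewrite integral_dirac// diracT mul1e.
Qed.

Lemma measurable_rV_addr n (c : 'rV[R]_n) : measurable_fun setT (fun x : 'rV[R]_n => x + c).
Proof.
apply: measurable_fun_rV => i; under eq_fun do rewrite mxE.
by apply: measurable_funD => //; exact: measurable_coord.
Qed.

Lemma cons_rV_addr n (x a : R) (v w : 'rV[R]_n) :
  cons_rV (x, v) + cons_rV (a, w) = cons_rV (x + a, v + w).
Proof.
by apply/rowP => i; rewrite !mxE /=; case: (unliftP ord0 i) => [j _|_] //=; rewrite mxE.
Qed.

Lemma cons_rV_surj n (x : 'rV[R]_n.+1) :
  x = cons_rV (x ord0 ord0, \row_j x ord0 (lift ord0 j)).
Proof.
apply/rowP => i; rewrite !mxE; case: (unliftP ord0 i) => [j ->|->] //=.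
by rewrite !mxE.
Qed.

Lemma ge0_integral_rV_addr n (f : 'rV[R]_n -> \bar R) (c : 'rV[R]_n) :
  measurable_fun setT f -> (forall x, 0 <= f x)%E ->
  (\int[mu n]_x f (x + c)%R = \int[mu n]_x f x)%E.
Proof.
elim: n f c => [|n IH] f c mf f0.
  by congr integral; apply/funext => x; congr f; exact: (etrans (thinmx0 _) (esym (thinmx0 _))).
have mfc : measurable_fun setT (fun x : 'rV[R]_n.+1 => f (x + c)).
  exact: measurableT_comp mf (measurable_rV_addr c).
rewrite !ge0_integral_rVS// (cons_rV_surj c).
set a := c _ _; set w := \row_j _.
under eq_integral => x _.
  under eq_integral => v _ do rewrite cons_rV_addr.
  rewrite (IH (fun v => f (cons_rV (x + a, v))))//; last first.
    apply: measurableT_comp => //.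
    exact: measurableT_comp (@measurable_consrV n) (measurable_pair1 _).
  over.
rewrite (@ge0_integral_addr R (fun x => \int[mu n]_v f (cons_rV (x, v)))%E a)//.
- apply: (@measurable_fun_fubini_tonelli_F _ _ _ _ _ _ (fun xv => f (cons_rV xv))) => //.
  exact: measurableT_comp mf (@measurable_consrV n).
- by move=> x; exact: integral_ge0.
Qed.

(** Tonelli along the recursive construction of [lebesgue_rV]. This is the source of all explicit
    n-dimensional integrals: Gaussians and the inverse weight are both products over the
    coordinates. *)
Lemma ge0_integral_rV_prod n (f : 'I_n -> R -> R) :
  (forall i, measurable_fun [set: measurableTypeR R] (f i)) -> (forall i x, 0 <= f i x) ->
  (\int[mu n]_x (\prod_i f i (x ord0 i))%:E =
   \prod_i \int[lebesgue_measure]_x (f i x)%:E)%E.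
Proof.
elim: n f => [|n IH] f mf f0.
  by rewrite ge0_integral_rV0; [rewrite !big_ord0|under eq_fun do rewrite big_ord0; exact: measurable_cst].
have mp : measurable_fun setT (fun x : 'rV[R]_n.+1 => (\prod_i f i (x ord0 i))%:E).
  apply/measurable_EFinP; apply: measurable_prod => i _.
  by apply: measurableT_comp (mf i) _; exact: measurable_coord.
have p0 k (g : 'I_k -> R -> R) (g0 : forall i x, 0 <= g i x) (x : 'rV[R]_k) : (0 <= (\prod_i g i (x ord0 i))%:E)%E.
  by rewrite lee_fin prodr_ge0.
rewrite ge0_integral_rVS//; last by move=> x; exact: p0.
have mp' : measurable_fun setT (fun v : 'rV[R]_n => (\prod_i f (lift ord0 i) (v ord0 i))%:E).
  apply/measurable_EFinP; apply: measurable_prod => i _.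
  by apply: measurableT_comp (mf _) _; exact: measurable_coord.
have E (x : R) : (\int[mu n]_v (\prod_i f i (cons_rV (x, v) ord0 i))%:E =
    (f ord0 x)%:E * \int[mu n]_v (\prod_i f (lift ord0 i) (v ord0 i))%:E)%E.
  rewrite -ge0_integralZl_EFin//; last by move=> v _; exact: (p0 n (fun i => f (lift ord0 i))).
  apply: eq_integral => v _; rewrite big_ord_recl mxE unlift_none /= EFinM.
  by congr (_ * (_)%:E)%E; apply: eq_bigr => i _; rewrite mxE liftK.
under eq_integral do rewrite E.
rewrite ge0_integralZr//; last 3 first.
- exact/measurable_EFinP.
- by move=> x _; rewrite lee_fin.
- by apply: integral_ge0 => v _; exact: (p0 n (fun i => f (lift ord0 i))).
by rewrite big_ord_recl (IH (fun i => f (lift ord0 i))).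

Qed.

End rV_integral.

(** * Finitely valued approximations of the identity *)

Section simple_maps.
Import HBNNSimple.
Context (R : realType).

(** The target carries no sigma-algebra: finite range and measurable fibres make [F \o s] measurable
    for every [F] whatsoever. *)
Definition simple_map d (T : measurableType d) (T' : Type) (s : T -> T') :=
  finite_set (range s) /\ forall v, measurable (s @^-1` [set v]).

(** On each of the finitely many fibres of [s] the second argument of [F] is frozen, so
    measurability in the first argument alone suffices. This is how joint measurability of the Gabor
    kernel is reached. *)
Lemma measurable_simple_arg d1 d2 d3 (X : measurableType d1) (T : measurableType d2)
    (T' : Type) (U : measurableType d3) (s : T -> T') (F : X -> T' -> U) :
  simple_map s -> (forall v, measurable_fun setT (F^~ v)) ->
  measurable_fun setT (fun xt : X * T => F xt.1 (s xt.2)).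
Proof.
move=> [fs ms] mF _ B mB; rewrite setTI.
have -> : (fun xt : X * T => F xt.1 (s xt.2)) @^-1` B =
    \bigcup_(v in range s) ((F^~ v @^-1` B) `*` (s @^-1` [set v])).
  apply/seteqP; split => [[x t] /= BF|[x t] /= [v _ [/= Fv ->]] //].
  by exists (s t).
apply: fin_bigcup_measurable => // v _; apply: measurableX => //.
by rewrite -[X in measurable X]setTI; exact: mF.
Qed.

Lemma measurable_simple_comp d2 d3 (T : measurableType d2)
    (T' : Type) (U : measurableType d3) (s : T -> T') (F : T' -> U) :
  simple_map s -> measurable_fun setT (F \o s).
Proof.
move=> [fs ms] _ B mB; rewrite setTI.
have -> : (F \o s) @^-1` B = \bigcup_(v in range s `&` F @^-1` B) (s @^-1` [set v]).
  apply/seteqP; split => [t /= BF|t /= [v [_ Fv] /= ->] //].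
  by exists (s t).
by apply: fin_bigcup_measurable => //; exact: finite_setIl.
Qed.

Lemma simple_approx_R : exists s : nat -> R -> R,
  [/\ forall n, simple_map (s n : measurableTypeR R -> R), forall n x, `|s n x| <= `|x| &
      forall x, s n x @[n --> \oo] --> x].
Proof.
have mn : measurable_fun [set: measurableTypeR R] (fun x : measurableTypeR R => (`|x|%:E)).
  apply/measurable_EFinP; exact: normr_measurable.
pose g := nnsfun_approx measurableT mn.
have g0 (x : measurableTypeR R) : [set: measurableTypeR R] x -> (0 <= `|x|%:E)%E by [].
have gle n x : g n x <= `|x|.
  by rewrite -lee_fin nnsfun_approxE; exact: le_approx.
(* The sign restores what is lost by approximating the absolute value from below; hence the
   domination by [|x|], which later keeps the polynomial weights from growing under
   approximation. *)
pose s n (x : R) := Num.sg x * g n x.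
exists s; split.
- move=> n; split.
    apply: (@sub_finite_set _ _ ((fun xy : R * R => xy.1 * xy.2) @`
        ([set -1; 0; 1] `*` range (g n)))).
      move=> _ [x _ <-]; exists (Num.sg x, g n x) => //; split => /=; last by exists x.
      by case: sgrP; [left; right|right|left; left].
    apply: finite_image; apply: finite_setX; last exact: fimfunP.
    by rewrite !finite_setU; do !split; exact: finite_set1.
  move=> v; have ms : measurable_fun setT (s n : measurableTypeR R -> measurableTypeR R).
    apply: measurable_funM; last exact: measurable_funPT.
    rewrite (_ : Num.sg = (fun x : R => \1_[set x : R | 0 < x] x - \1_[set x : R | x < 0] x)); last first.
      apply/funext => x; rewrite !indicE.
      have -> : (x \in [set x0 : R | 0 < x0]) = (0 < x) by apply/idP/idP; rewrite inE.
      have -> : (x \in [set x0 : R | x0 < 0]) = (x < 0) by apply/idP/idP; rewrite inE.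
      by case: sgrP; rewrite ?subrr ?subr0 ?sub0r.
    apply: measurable_funB; apply: measurable_indic.
      by rewrite (_ : mkset _ = `]0, +oo[%classic)//; apply/seteqP; split => x /=; rewrite in_itv/= andbT.
    by rewrite (_ : mkset _ = `]-oo, 0[%classic)//; apply/seteqP; split => x /=; rewrite in_itv/=.
  by rewrite -[X in measurable X]setTI; exact: ms.
- move=> n x; rewrite /s normrM normr_sg ger0_norm; last exact: fun_ge0.
  by case: (x != 0); rewrite ?mul1r ?mul0r.
- move=> x; rewrite [X in _ --> X](numEsg x).
  apply: cvgM; first exact: cvg_cst.
  have := cvg_nnsfun_approx measurableT mn g0 (I : setT x).
  by move=> /fine_cvgP [].
Qed.

Lemma simple_approx_rV d : exists s : nat -> 'rV[R]_d -> 'rV[R]_d,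
  [/\ forall n, simple_map (s n), forall n x i, `|s n x ord0 i| <= `|x ord0 i|,
      forall x i, s n x ord0 i @[n --> \oo] --> x ord0 i &
      forall x, s n x @[n --> \oo] --> x].
Proof.
have [r [sr rle rx]] := simple_approx_R.
pose s n (x : 'rV[R]_d) : 'rV[R]_d := \row_i r n (x ord0 i).
have sx x i : s n x ord0 i @[n --> \oo] --> x ord0 i.
  by under eq_fun do rewrite mxE; exact: rx.
exists s; split => //.
- move=> n; have [fr mr] := sr n; split.
    have /finite_seqP [L LE] := fr.
    pose F (f : {ffun 'I_d -> 'I_(size L)}) : 'rV[R]_d := \row_i L`_(f i).
    apply: (@sub_finite_set _ _ (F @` setT)); last exact: finite_image.
    move=> _ [x _ <-].
    have xL i : (index (r n (x ord0 i)) L < size L)%N.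
      rewrite index_mem; have : range (r n) (r n (x ord0 i)) by exists (x ord0 i).
      by rewrite LE.
    exists [ffun i => Ordinal (xL i)] => //; apply/rowP => i.
    by rewrite !mxE ffunE /= nth_index// -index_mem.
  move=> v.
  have -> : s n @^-1` [set v] = \bigcap_(i in [set: 'I_d])
      ((fun x : 'rV[R]_d => x ord0 i : measurableTypeR R) @^-1` (r n @^-1` [set v ord0 i])).
    apply/seteqP; split => x /=.
      by move=> <- i _ /=; rewrite mxE.
    by move=> xv; apply/rowP => i; rewrite mxE; exact: xv.
  apply: fin_bigcap_measurable => // i _.
  by rewrite -[X in measurable X]setTI; exact: (@measurable_coord R d i).
- by move=> n x i; rewrite mxE; exact: rle.
- move=> x; apply/cvgrPdist_lt => e e0; near=> n.
  have H i : `|x ord0 i - s n x ord0 i| < e.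
    move: i; near: n; apply: filter_forall => i.
    by have /cvgrPdist_lt := sx x i; exact.
  rewrite [`|_|]mx_normrE; apply/bigmax_ltP; split => // -[i j] _ /=.
  by rewrite !mxE ord1; have := H j; rewrite mxE.
Unshelve. all: by end_near. Qed.

(** Each [f \o s n] is measurable without any hypothesis on [f], so convergence along the
    approximation, a mere regularity property, is enough for measurability. *)
Lemma measurable_fun_approx d (T : measurableType d) (s : nat -> T -> T) (f : T -> R) :
  (forall n, simple_map (s n)) -> (forall x, f (s n x) @[n --> \oo] --> f x) ->
  measurable_fun setT f.
Proof.
move=> ss sf; apply: (@measurable_fun_cvg _ _ _ _ (fun n x => f (s n x))) => //.
by move=> n; exact: (measurable_simple_comp f (ss n)).
Qed.

Lemma continuous_measurable_rV d (f : 'rV[R]_d -> R) :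
  continuous f -> measurable_fun setT f.
Proof.
move=> cf; have [s [ss _ _ sx]] := simple_approx_rV d.
apply: (measurable_fun_approx ss) => x.
exact: (@cvg_comp _ _ _ (fun n => s n x) f _ _ _ (sx x) (cf x)).
Qed.

Local Notation phase d := ('rV[R]_d * 'rV[R]_d)%type.

Lemma simple_approx_phase d : exists s : nat -> phase d -> phase d,
  [/\ forall n, simple_map (s n),
      forall n z i, `|(s n z).1 ord0 i| <= `|z.1 ord0 i| /\ `|(s n z).2 ord0 i| <= `|z.2 ord0 i| &
      forall z i, (s n z).1 ord0 i @[n --> \oo] --> z.1 ord0 i /\
                  (s n z).2 ord0 i @[n --> \oo] --> z.2 ord0 i].
Proof.
have [s [ss sle sx _]] := simple_approx_rV d.
exists (fun n z => (s n z.1, s n z.2)); split => //= n.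
have [fs ms] := ss n; split.
  apply: (@sub_finite_set _ _ (range (s n) `*` range (s n))); last exact: finite_setX.
  by move=> _ [z _ <-]; split; [exists z.1|exists z.2].
move=> v; have -> : (fun z : phase d => (s n z.1, s n z.2)) @^-1` [set v] =
    (s n @^-1` [set v.1]) `*` (s n @^-1` [set v.2]).
  by apply/seteqP; split => [z /= <-//|z /= [-> ->]]; case: v.
exact: measurableX.
Qed.

End simple_maps.

(** * Dominated integrals of real functions and Fubini *)

Section real_integrals.
Context d (T : measurableType d) (R : realType) (m : {measure set T -> \bar R}).
Implicit Types f g : T -> R.
Local Notation intg f := (m.-integrable setT (EFin \o f)).
Local Notation I f := (Rintegral m setT f).

Lemma intg_measurable f : intg f -> measurable_fun setT f.
Proof. by move=> /integrableP[/measurable_EFinP]. Qed.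

Lemma intg_dom f g : measurable_fun setT f -> (forall x, `|f x| <= g x) -> intg g -> intg f.
Proof.
move=> mf fg ig; apply: (le_integrable measurableT _ _ ig) => [|x _ /=].
  exact/measurable_EFinP.
by rewrite lee_fin (le_trans (fg x))// ler_norm.
Qed.

Lemma intgZ (c : R) f : intg f -> intg (fun x => c * f x).
Proof. by move=> /(integrableZl measurableT c). Qed.

Lemma intgD f g : intg f -> intg g -> intg (fun x => f x + g x).
Proof. exact: integrableD. Qed.

Lemma intgB f g : intg f -> intg g -> intg (fun x => f x - g x).
Proof. exact: integrableB. Qed.

Lemma ge0_intg f : measurable_fun setT f -> (forall x, 0 <= f x) ->
  (\int[m]_x (f x)%:E < +oo)%E -> intg f.
Proof.
move=> mf f0 fo; apply/integrableP; split; first exact/measurable_EFinP.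
by under eq_integral do rewrite /= ger0_norm//.
Qed.

Lemma RintE f : intg f -> (I f)%:E = (\int[m]_x (f x)%:E)%E.
Proof. by move=> /integrable_fin_num => /(_ measurableT) ff; rewrite /Rintegral fineK. Qed.

Lemma Rint_le_dom f g : measurable_fun setT f -> (forall x, `|f x| <= g x) -> intg g ->
  `|I f| <= I g.
Proof.
move=> mf fg ig; have jf := intg_dom mf fg ig.
apply: (le_trans (le_normr_Rintegral measurableT jf)).
apply: le_Rintegral => //; exact: integrable_norm.
Qed.

Lemma Rint_dct (f_ : nat -> T -> R) f g : (forall n, measurable_fun setT (f_ n)) ->
  (forall x, f_ n x @[n --> \oo] --> f x) -> intg g -> (forall n x, `|f_ n x| <= g x) ->
  intg f /\ I (f_ n) @[n --> \oo] --> I f.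
Proof.
move=> mf_ ff ig fg; have mf : measurable_fun setT f by exact: (measurable_fun_cvg mf_ (fun x _ => ff x)).
have := @dominated_convergence _ T R m setT measurableT (fun n => EFin \o f_ n)
  (EFin \o f) (EFin \o g).
move=> /(_ (fun n => (measurable_EFinP _ _).2 (mf_ n)) ((measurable_EFinP _ _).2 mf) _ ig).
case.
- by apply: nearW => x _; apply/fine_cvgP; split; [exact: nearW|exact: ff].
- by apply: nearW => x n _ /=; rewrite lee_fin; exact: fg.
move=> jf _ /= Hc; split => //.
apply: fine_cvg; rewrite -/(I f) RintE//.
Qed.

Lemma sum_Rint (J : Type) (L : seq J) (F : J -> T -> R) : (forall i, intg (F i)) ->
  intg (fun z => \sum_(i <- L) F i z) /\ I (fun z => \sum_(i <- L) F i z) = \sum_(i <- L) I (F i).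
Proof.
move=> iF; elim: L => [|i L [iS E]].
  split; last by rewrite big_nil; under eq_Rintegral do rewrite big_nil; rewrite Rintegral_cst// mul0r.
  by apply: eq_integrable (integrable0 _ _) => // x _ /=; rewrite big_nil.
have e : (fun z => \sum_(j <- i :: L) F j z) = (fun z => F i z + \sum_(j <- L) F j z).
  by apply/funext => z; rewrite big_cons.
rewrite e big_cons -E; split; first exact: intgD.
by rewrite RintegralD.
Qed.

End real_integrals.

Section fubini.
Context d1 d2 (T1 : measurableType d1) (T2 : measurableType d2) (R : realType).
Context (m1 : {sigma_finite_measure set T1 -> \bar R}) (m2 : {sigma_finite_measure set T2 -> \bar R}).
Implicit Types (f : T1 * T2 -> R).
Local Notation intg m f := (integrable m setT (EFin \o f)).

Lemma intg_prod (a : T1 -> R) (b : T2 -> R) : intg m1 a -> intg m2 b ->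
  (forall x, 0 <= a x) -> (forall y, 0 <= b y) ->
  intg (m1 \x m2)%E (fun z => a z.1 * b z.2).
Proof.
move=> ia ib a0 b0; have ma := intg_measurable ia; have mb := intg_measurable ib.
have mab : measurable_fun setT (fun z : T1 * T2 => a z.1 * b z.2).
  by apply: measurable_funM; [exact: measurableT_comp ma measurable_fst|
    exact: measurableT_comp mb measurable_snd].
apply: ge0_intg => //; first by move=> z; exact: mulr_ge0.
rewrite fubini_tonelli1//=; last 2 first.
- exact/measurable_EFinP.
- by move=> z; rewrite lee_fin mulr_ge0.
have E x : (\int[m2]_y (a x * b y)%:E = (a x * Rintegral m2 setT b)%:E)%E.
  under eq_integral do rewrite EFinM.
  rewrite ge0_integralZl_EFin//; last exact/measurable_EFinP.
  - by rewrite -RintE.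
  - by move=> y _; rewrite lee_fin.
rewrite /fubini_F/=; under eq_integral do rewrite E mulrC EFinM.
rewrite ge0_integralZl_EFin//; last 3 first.
- by move=> x _; rewrite lee_fin.
- exact/measurable_EFinP.
- exact: Rintegral_ge0.
by rewrite -RintE// -EFinM ltry.
Qed.

(** A product majorant supplies integrability on the product and on every slice at once; it also
    survives in the bound on the inner integral. *)
Lemma Rint_fubini f (a : T1 -> R) (b : T2 -> R) : measurable_fun setT f ->
  intg m1 a -> intg m2 b -> (forall x, 0 <= a x) -> (forall y, 0 <= b y) ->
  (forall x y, `|f (x, y)| <= a x * b y) ->
  [/\ Rintegral (m1 \x m2)%E setT f = Rintegral m1 setT (fun x => Rintegral m2 setT (fun y => f (x, y))),
      Rintegral (m1 \x m2)%E setT f = Rintegral m2 setT (fun y => Rintegral m1 setT (fun x => f (x, y))),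
      measurable_fun setT (fun x => Rintegral m2 setT (fun y => f (x, y))),
      intg (m1 \x m2)%E f &
      forall x, `|Rintegral m2 setT (fun y => f (x, y))| <= a x * Rintegral m2 setT b].
Proof.
move=> mf ia ib a0 b0 fab.
have iab := intg_prod ia ib a0 b0.
have jf : intg (m1 \x m2)%E f.
  by apply: (intg_dom mf _ iab) => -[x y]; exact: fab.
have i2 x : intg m2 (fun y => f (x, y)).
  apply: (intg_dom _ (fab x)); last exact: intgZ.
  exact: measurableT_comp mf (measurable_pair1 _).
have i1 y : intg m1 (fun x => f (x, y)).
  apply: (@intg_dom _ _ _ _ _ (fun x => b y * a x)).
  - exact: measurableT_comp mf (measurable_pair2 _).
  - by move=> x; rewrite mulrC; exact: fab.
  - exact: intgZ.
split => //.
- rewrite /Rintegral -integral12_prod_meas1//; congr fine.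
  by apply: eq_integral => x _; rewrite [RHS]RintE.
- rewrite /Rintegral -integral21_prod_meas1//; congr fine.
  by apply: eq_integral => x _; rewrite [RHS]RintE.
- apply/measurable_EFinP.
  rewrite (_ : _ \o _ = fun x => (\int[m2]_y (f (x, y))%:E)%E); last first.
    by apply/funext => x /=; rewrite [LHS]RintE.
  exact: (@measurable_fubini_F _ _ _ _ _ m1 m2 (EFin \o f)).
- move=> x; rewrite -RintegralZl//; apply: Rint_le_dom => //; last exact: intgZ.
  exact: measurableT_comp mf (measurable_pair1 _).
Qed.

End fubini.

(** * The polynomial weight *)

Section weight.
Context (R : realType).
Implicit Types n : nat.

(** A product of one-dimensional weights rather than a power of 1 + |x|^2: its inverse is integrable
    by Tonelli, and its powers expand into monomials. *)
Definition W n (x : 'rV[R]_n) : R := \prod_i (1 + x ord0 i ^+ 2).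

Lemma prod_ge1 I (r : seq I) (P : pred I) (F : I -> R) :
  (forall i, P i -> 1 <= F i) -> 1 <= \prod_(i <- r | P i) F i.
Proof. by move=> F1; elim/big_ind : _ => // x y x1 y1; exact: mulr_ege1. Qed.

Lemma W_ge1 n (x : 'rV[R]_n) : 1 <= W x.
Proof. by apply: prod_ge1 => i _; rewrite lerDl sqr_ge0. Qed.

Lemma W_gt0 n (x : 'rV[R]_n) : 0 < W x.
Proof. exact: lt_le_trans (W_ge1 x). Qed.

Lemma W_ge_coord n (x : 'rV[R]_n) i : `|x ord0 i| <= W x.
Proof.
have h : 1 + x ord0 i ^+ 2 <= W x.
  rewrite /W (bigD1 i)//= ler_peMr//; first by rewrite addr_ge0// sqr_ge0.
  by apply: prod_ge1 => j _; rewrite lerDl sqr_ge0.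
apply: le_trans h; rewrite -real_normK ?num_real//; have := normr_ge0 (x ord0 i).
by move: `|_| => r r0; nra.
Qed.

Lemma W_le n (x y : 'rV[R]_n) : (forall i, `|x ord0 i| <= `|y ord0 i|) -> W x <= W y.
Proof.
move=> xy; apply: ler_prod => i _; rewrite addr_ge0 ?sqr_ge0//= lerD2l.
by rewrite -(real_normK (num_real (x _ _))) -(real_normK (num_real (y _ _))) lerXn2r ?nnegrE.
Qed.

Lemma WN n (x : 'rV[R]_n) : W (- x) = W x.
Proof. by apply: eq_bigr => i _; rewrite mxE sqrrN. Qed.

(** A Peetre-type inequality, coordinatewise 1 + (a + b)^2 <= 2 (1 + a^2)(1 + b^2). It is what moves
    the weight across translations. *)
Lemma W_add n (x y : 'rV[R]_n) : W (x + y) <= 2 ^+ n * (W x * W y).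
Proof.
rewrite /W -[in 2 ^+ n](card_ord n) -prodr_const -!big_split /=; apply: ler_prod => i _.
rewrite addr_ge0 ?sqr_ge0//= mxE; move: (x _ _) (y _ _) => a b.
have := sqr_ge0 (a - b); have := sqr_ge0 (a * b); nra.
Qed.

Lemma measurable_W n : measurable_fun setT (@W n).
Proof.
apply: measurable_prod => i _; apply: measurable_funD => //; apply: measurable_funX.
exact: measurable_coord.
Qed.

Lemma integral_oneDsqrV :
  (\int[@lebesgue_measure R]_x ((1 + x ^+ 2)^-1)%:E < +oo)%E.
Proof.
have mf : measurable_fun setT (fun x : measurableTypeR R => ((1 + x ^+ 2)^-1)%:E).
  apply/measurable_EFinP; apply: continuous_measurable_fun; exact: continuous_oneDsqrV.
have f0 (x : R) : (0 <= ((1 + x ^+ 2)^-1)%:E)%E by rewrite lee_fin invr_ge0 addr_ge0// sqr_ge0.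
rewrite ge0_symfun_integralT; last 3 first.
- by move=> x; rewrite -lee_fin.
- exact: continuous_oneDsqrV.
- by move=> x /=; rewrite sqrrN.
rewrite -set_itvcy.
have -> : (\int[@lebesgue_measure R]_(x in `[0%R, +oo[) ((1 + x ^+ 2)^-1)%:E = (pi / 2)%:E)%E.
  exact: integral0y_oneDsqr.
by rewrite -EFinM ltry.
Qed.

Lemma invW_prod n (x : 'rV[R]_n) : (W x)^-1 = \prod_i (1 + x ord0 i ^+ 2)^-1.
Proof. by rewrite /W prodfV. Qed.

Lemma ge0_prode_lty I (r : seq I) (F : I -> \bar R) : (forall i, 0 <= F i)%E ->
  (forall i, F i < +oo)%E -> (\prod_(i <- r) F i < +oo)%E.
Proof.
move=> F0 Fo; suff : (\prod_(i <- r) F i)%E \is a fin_num by rewrite fin_numE => /andP[_]; rewrite ltey.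
elim: r => [|i r IH]; first by rewrite big_nil.
by rewrite big_cons fin_numM// ge0_fin_numE.
Qed.

Lemma intg_invW n : (lebesgue_rV R n).-integrable setT (EFin \o (fun x => (W x)^-1)).
Proof.
have f0 (x : R) : 0 <= (1 + x ^+ 2)^-1 by rewrite invr_ge0 addr_ge0// sqr_ge0.
apply: ge0_intg.
- rewrite (_ : (fun _ => _) = fun x : 'rV[R]_n => \prod_i (1 + x ord0 i ^+ 2)^-1); last first.
    by apply/funext => x; exact: invW_prod.
  apply: measurable_prod => i _; apply: (@measurableT_comp _ _ _ _ _ _ (fun x : measurableTypeR R => (1 + x ^+ 2)^-1)); last exact: measurable_coord.
  apply: continuous_measurable_fun; exact: continuous_oneDsqrV.
- by move=> x; rewrite invr_ge0 ltW// W_gt0.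
under eq_integral do rewrite invW_prod.
rewrite (ge0_integral_rV_prod (f := fun _ x => (1 + x ^+ 2)^-1))//; last first.
  move=> _; apply: continuous_measurable_fun; exact: continuous_oneDsqrV.
apply: ge0_prode_lty => i; last exact: integral_oneDsqrV.
by apply: integral_ge0 => x _; rewrite lee_fin.
Qed.

End weight.

(** * Gaussian integrals *)

Section gaussians.
Context (R : realType).

Definition gs n (a : R) (x : 'rV[R]_n) : R := expR (- pi * a * dotrv x x).

Lemma gs_ge0 n a (x : 'rV[R]_n) : 0 <= gs a x. Proof. exact: expR_ge0. Qed.

Lemma gs_prod n a (x : 'rV[R]_n) : gs a x = \prod_i expR (- pi * a * x ord0 i ^+ 2).
Proof. by rewrite /gs /dotrv mulr_sumr expR_sum; apply: eq_bigr => i _; rewrite expr2. Qed.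

Lemma measurable_gs n a : measurable_fun setT (@gs n a).
Proof.
rewrite (_ : @gs n a = fun x : 'rV[R]_n => \prod_i expR (- pi * a * x ord0 i ^+ 2)); last first.
  by apply/funext => x; exact: gs_prod.
apply: measurable_prod => i _; apply: measurableT_comp; first exact: measurable_expR.
by apply: measurable_funM => //; apply: measurable_funX; exact: measurable_coord.
Qed.

Lemma gauss1 (a : R) : 0 < a ->
  (\int[@lebesgue_measure R]_x (expR (- pi * a * x ^+ 2))%:E = ((Num.sqrt a)^-1)%:E)%E.
Proof.
(* The standard deviation for which x^2 / (2 s^2) = pi a x^2; the peak of the normal density is then
   sqrt a, and its total mass 1 gives the integral. *)
move=> a0; pose s : R := (Num.sqrt (2 * pi * a))^-1.
have fE (p b : R) : p != 0 -> b != 0 -> (2 * p * b)^-1 * p * 2 = b^-1.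
  by move=> p_n0 b_n0; field; apply/andP; split.
have fE2 (p b y : R) : p != 0 -> b != 0 -> - p * b * y = - y / ((2 * p * b)^-1 * 2).
  by move=> p_n0 b_n0; field; apply/andP; split.
have p0 : 0 < pi :> R := pi_gt0 R.
have [pn an] : pi != 0 :> R /\ a != 0 by rewrite !gt_eqF.
have s0 : 0 < s by rewrite invr_gt0 sqrtr_gt0 !mulr_gt0.
have s2 : s ^+ 2 = (2 * pi * a)^-1 by rewrite exprVn sqr_sqrtr// ltW// !mulr_gt0.
have k0 : 0 < normal_peak s by rewrite normal_peak_gt0// gt_eqF.
have kE : normal_peak s = Num.sqrt a.
  rewrite /normal_peak s2 -mulr_natr (_ : (2 * pi * a)^-1 * pi * 2 = a^-1).
    by rewrite sqrtrV ?invrK// ltW.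
  exact: fE.
have := integral_normal_pdf 0 s.
rewrite normal_pdfE ?gt_eqF//.
under eq_integral do rewrite EFinM.
rewrite ge0_integralZl_EFin//; last 3 first.
- by move=> x _; rewrite lee_fin expR_ge0.
- by apply/measurable_EFinP; exact: measurable_normal_fun.
- exact: ltW.
rewrite kE => H.
have -> : (\int[@lebesgue_measure R]_x (expR (- pi * a * x ^+ 2))%:E =
  \int[@lebesgue_measure R]_x (normal_fun 0 s x)%:E)%E.
  apply: eq_integral => x _; congr ((expR _)%:E); rewrite subr0 s2 -mulr_natr; exact: fE2.
have sa : Num.sqrt a != 0 by rewrite gt_eqF// sqrtr_gt0.
by rewrite -[LHS]mul1e -(mulVf sa) EFinM -muleA H mule1.
Qed.

Lemma gs_integral n (a : R) : 0 < a ->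
  (\int[lebesgue_rV R n]_x (gs a x)%:E = ((Num.sqrt a)^-1 ^+ n)%:E)%E.
Proof.
move=> a0; under eq_integral do rewrite gs_prod.
rewrite (ge0_integral_rV_prod (f := fun _ x => expR (- pi * a * x ^+ 2)))//; last first.
  move=> i; apply: measurableT_comp; first exact: measurable_expR.
  by apply: measurable_funM => //; exact: measurable_funX.
rewrite gauss1//; elim: n => [|n IH]; first by rewrite big_ord0.
by rewrite big_ord_recl IH -EFinM exprS.
Qed.

Lemma intg_gs n (a : R) : 0 < a -> (lebesgue_rV R n).-integrable setT (EFin \o (gs a)).
Proof.
move=> a0; apply: ge0_intg; [exact: measurable_gs|exact: gs_ge0|].
by rewrite gs_integral// ltry.
Qed.

Lemma Rint_gs n (a : R) : 0 < a -> Rintegral (lebesgue_rV R n) setT (gs a) = (Num.sqrt a)^-1 ^+ n.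
Proof. by move=> a0; rewrite /Rintegral gs_integral. Qed.

End gaussians.

(** * Directional derivatives and integration by parts *)

Section directional.
Context (R : realType) (n : nat).
Implicit Types (F : 'rV[R]_n -> R) (x v : 'rV[R]_n).

Lemma is_derive_along F x v (s : R) dF :
  is_derive (s *: v + x) v F dF -> is_derive s 1 (fun h : R => F (h *: v + x)) dF.
Proof.
move=> [dx <-].
have E : (fun h : R => h^-1 *: (F ((h *: (1 : R) + s) *: v + x) - F (s *: v + x))) =
    (fun h : R => h^-1 *: (F (h *: v + (s *: v + x)) - F (s *: v + x))).
  by apply/funext => h; rewrite [h *: _]mulr1 scalerDl addrA.
apply: DeriveDef.
  by move: dx; rewrite /derivable /= -E.
rewrite /derive; set g1 := fun h => h^-1 *: _; set g2 := fun h => h^-1 *: _.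
by have -> : g1 = g2 by exact: E.
Qed.

Lemma mvt_coord F F' x v (s : R) : (forall y, is_derive y v F (F' y)) ->
  exists t : R, `|t| <= `|s| /\ F (s *: v + x) - F x = s * F' (t *: v + x).
Proof.
move=> dF; pose G (h : R) := F (h *: v + x).
have dG (h : R) : is_derive h 1 G (F' (h *: v + x)) by exact: is_derive_along.
have cG (A : set R) : {within A, continuous G}.
  apply: continuous_subspaceT => h; apply: differentiable_continuous.
  by apply/derivable1_diffP; exact: (@ex_derive _ _ _ _ _ _ _ (dG h)).
have G0 : G 0 = F x by rewrite /G scale0r add0r.
have [s0|s0] := leP 0 s.
  have [t] := MVT_segment s0 (fun h _ => dG h) (cG _).
  rewrite in_itv /= => /andP[t0 ts] E; exists t.
  by rewrite !ger0_norm// -G0 [LHS]E subr0 mulrC.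
have [t] := MVT_segment (ltW s0) (fun h _ => dG h) (cG _).
rewrite in_itv /= => /andP[t0 ts] E; exists t; rewrite !ler0_norm ?lerN2//; last exact: ltW.
split => //.
by rewrite -G0 -[LHS]opprB [G 0 - _]E sub0r mulrN opprK mulrC.
Qed.

(** The derivative is written as a limit along the steps 1/(k+1), because dominated convergence is
    available for sequences. *)
Lemma is_derive_seq F x v dF : is_derive x v F dF ->
  k.+1%:R * (F (k.+1%:R^-1 *: v + x) - F x) @[k --> \oo] --> dF.
Proof.
move=> [dx <-]; have /cvgr_dnbhsP : (fun h : R => h^-1 *: (F (h *: v + x) - F x)) h @[h --> 0^'] --> 'D_v F x.
  exact: dx.
move=> /(_ (fun k => k.+1%:R^-1)) H.
have : k.+1%:R^-1 @[k --> \oo] --> (0 : R) by exact: cvg_harmonic.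
move=> h0; have /H : (forall k : nat, k.+1%:R^-1 != 0 :> R) /\ k.+1%:R^-1 @[k --> \oo] --> (0 : R).
  by split => // k; rewrite invr_neq0.
by rewrite (_ : (fun k : nat => _) = (fun k : nat => k.+1%:R * (F (k.+1%:R^-1 *: v + x) - F x)))//;
   apply/funext => k; rewrite invrK.
Qed.

End directional.

Section integration_by_parts.
Context (R : realType) (n : nat).
Local Notation mu := (lebesgue_rV R n).
Local Notation intg f := (mu.-integrable setT (EFin \o f)).
Local Notation I f := (Rintegral mu setT f).
Implicit Types (F : 'rV[R]_n -> R) (x v : 'rV[R]_n).

Lemma intg_addr F v : intg F -> intg (fun x => F (x + v)) /\ I (fun x => F (x + v)) = I F.
Proof.
move=> iF; have mF := intg_measurable iF.
have mFv : measurable_fun setT (fun x => F (x + v)).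
  exact: measurableT_comp mF (measurable_rV_addr v).
have E (g : 'rV[R]_n -> \bar R) : measurable_fun setT g -> (forall x, 0 <= g x)%E ->
    (\int[mu]_x g (x + v)%R = \int[mu]_x g x)%E by exact: ge0_integral_rV_addr.
split.
  apply/integrableP; split; first exact/measurable_EFinP.
  move: iF => /integrableP[_]; rewrite -(E (fun x => `|(F x)%:E|%E))//.
  by apply: measurableT_comp => //; exact/measurable_EFinP.
rewrite /Rintegral; congr fine; rewrite integralE [in RHS]integralE.
congr (_ - _)%E.
- rewrite -(E (fun x => (F x)%:E)^\+%E)//; last exact/measurable_funepos/measurable_EFinP.
  by apply: eq_integral => x _; rewrite !funeposE.
- rewrite -(E (fun x => (F x)%:E)^\-%E)//; last exact/measurable_funeneg/measurable_EFinP.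
  by apply: eq_integral => x _; rewrite !funenegE.
Qed.

(** The integral of [F'] is the limit of the integrals of the difference quotients of [F], and each
    of those is zero by translation invariance. Domination comes from the mean value theorem, so no
    iterated integral along [v] is needed. *)
Lemma Rint_derive0 F F' (v : 'rV[R]_n) (C : R) : (forall x, is_derive x v F (F' x)) ->
  measurable_fun setT F ->
  (forall x, `|F x| <= C * (W x)^-1) -> (forall x, `|F' x| <= C * (W x)^-1) ->
  I F' = 0 /\ intg F'.
Proof.
move=> dF mF FC F'C.
have iW := intgZ C (intg_invW R n).
have iF : intg F by exact: (intg_dom mF FC iW).
pose D k x : R := k.+1%:R * (F (k.+1%:R^-1 *: v + x) - F x).
have C0 : 0 <= C.
  have /(le_trans (normr_ge0 _)) := FC 0; rewrite pmulr_lge0// invr_gt0; exact: W_gt0.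
have mshift k : measurable_fun setT (fun x => F (k.+1%:R^-1 *: v + x)).
  rewrite (_ : (fun x => _) = fun x => F (x + k.+1%:R^-1 *: v)).
    exact: measurableT_comp mF (measurable_rV_addr _).
  by apply/funext => x; rewrite addrC.
have mD k : measurable_fun setT (D k).
  by apply: measurable_funM => //; apply: measurable_funB.
have DF x : D k x @[k --> \oo] --> F' x by exact: is_derive_seq.
(* The mean value theorem evaluates [F'] at [t *: v + x] with [|t| <= 1]; by [W_add] the factor
   [2 ^+ n * W v] brings the weight back to [x], uniformly in [k]. *)
pose K := C * (2 ^+ n * W v).
have iG : intg (fun x => K * (W x)^-1) by exact/intgZ/intg_invW.
have Dle k x : `|D k x| <= K * (W x)^-1.
  rewrite /D; have [t [tk ->]] := mvt_coord x k.+1%:R^-1 dF.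
  rewrite mulVKf//.
  apply: (le_trans (F'C _)); rewrite -mulrA; apply: ler_wpM2l => //.
  rewrite ler_pdivlMr ?W_gt0// mulrC ler_pdivrMr ?W_gt0//.
  rewrite {1}(_ : x = - (t *: v) + (t *: v + x)); last by rewrite addKr.
  apply: (le_trans (W_add _ _)); rewrite -mulrA ler_wpM2l ?exprn_ge0//.
  apply: ler_wpM2r; first by rewrite ltW// W_gt0.
  rewrite WN; apply: W_le => i; rewrite mxE normrM ler_piMl//.
  by rewrite (le_trans tk)// ger0_norm// invf_le1// ler1n.
have [iF' H] := Rint_dct mD DF iG Dle; split => //.
have D0 k : I (D k) = 0.
  have [is1 E] := intg_addr (k.+1%:R^-1 *: v) iF.
  rewrite /D RintegralZl//; last first.
    rewrite (_ : (EFin \o _) = EFin \o (fun x => F (x + k.+1%:R^-1 *: v) - F x)); first exact: intgB.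
    by apply/funext => x; rewrite /= [_ + x]addrC.
  under eq_Rintegral do rewrite [_ + (_ : 'rV[R]_n)]addrC.
  by rewrite RintegralB// E subrr mulr0.
move: H; rewrite (funext D0) => H.
by apply: (@cvg_unique _ (@Rhausdorff R) _ _ _ _ H (cvg_cst _)).
Qed.

End integration_by_parts.

(** * Fourier inversion with a Gaussian window *)

Section dot.
Context (R : realType) (n : nat).
Implicit Types (x v : 'rV[R]_n).
Local Notation e_ j := (delta_mx ord0 j : 'rV[R]_n).

Lemma dotrvZr x v (s : R) : dotrv x (s *: v) = s * dotrv x v.
Proof. by rewrite /dotrv mulr_sumr; apply: eq_bigr => i _; rewrite mxE mulrCA. Qed.

Lemma dotrvZl x v (s : R) : dotrv (s *: x) v = s * dotrv x v.
Proof. by rewrite /dotrv mulr_sumr; apply: eq_bigr => i _; rewrite mxE mulrA. Qed.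

Lemma dotrvC x v : dotrv x v = dotrv v x.
Proof. by apply: eq_bigr => i _; rewrite mulrC. Qed.

Lemma dotrvDr x v w : dotrv x (v + w) = dotrv x v + dotrv x w.
Proof. by rewrite /dotrv -big_split; apply: eq_bigr => i _; rewrite mxE mulrDr. Qed.

Lemma dotrvNr x v : dotrv x (- v) = - dotrv x v.
Proof. by rewrite -scaleN1r dotrvZr mulN1r. Qed.

Lemma dotrvBr x v w : dotrv x (v - w) = dotrv x v - dotrv x w.
Proof. by rewrite dotrvDr dotrvNr. Qed.

Lemma dotrv_poly v : poly_fun (fun x => dotrv x v).
Proof. by apply: poly_sum => i; apply: poly_mul; [exact: poly_coord|exact: poly_cst]. Qed.

Lemma dotrv_sq_poly : poly_fun (fun x : 'rV[R]_n => dotrv x x).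
Proof. by apply: poly_sum => i; apply: poly_mul; exact: poly_coord. Qed.

Lemma is_derive_dotl x v j : is_derive x (e_ j) (fun y => dotrv y v) (v ord0 j).
Proof.
have H : is_derive x (e_ j) (\sum_(i < n) (fun y : 'rV[R]_n => y ord0 i * v ord0 i)) (\sum_(i < n) v ord0 i * (e_ j) ord0 i).
  apply: is_derive_sum => i.
  have := is_deriveM (is_derive_coord x i (e_ j)) (is_derive_cst (v ord0 i) x (e_ j)).
  by rewrite scaler0 add0r.
rewrite (_ : (fun y => dotrv y v) = \sum_(i < n) (fun y : 'rV[R]_n => y ord0 i * v ord0 i)); last first.
  by apply/funext => y; rewrite fct_sumE.
apply: is_derive_eq H _.
rewrite (bigD1 j)//= big1 ?addr0 ?mxE ?eqxx ?mulr1// => i ij.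
by rewrite mxE eqxx (negbTE ij) mulr0.
Qed.

Lemma is_derive_sq x j : is_derive x (e_ j) (fun y => dotrv y y) (2 * x ord0 j).
Proof.
have H : is_derive x (e_ j) (\sum_(i < n) (fun y : 'rV[R]_n => y ord0 i * y ord0 i))
   (\sum_(i < n) (x ord0 i * (e_ j) ord0 i + x ord0 i * (e_ j) ord0 i)).
  by apply: is_derive_sum => i; exact: is_deriveM (is_derive_coord x i (e_ j)) (is_derive_coord x i (e_ j)).
rewrite (_ : (fun y => dotrv y y) = \sum_(i < n) (fun y : 'rV[R]_n => y ord0 i * y ord0 i)); last first.
  by apply/funext => y; rewrite fct_sumE.
apply: is_derive_eq H _.
rewrite (bigD1 j)//= big1 ?addr0 ?mxE ?eqxx ?mulr1 => [|i ij]; first by rewrite mulr_natl.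
by rewrite mxE eqxx (negbTE ij) mulr0 addr0.
Qed.

Lemma is_derive_gs a x j :
  is_derive x (e_ j) (@gs R n a) (- (2 * pi * a) * x ord0 j * gs a x).
Proof.
have H := is_deriveM (is_derive_cst (- pi * a) x (e_ j)) (is_derive_sq x j).
apply: is_derive_eq (is_derive_chain H (is_derive_expR _)) _.
rewrite scaler0 addr0 /gs /= [LHS]mulrC.
by congr (_ * _); rewrite /GRing.scale /=; ring.
Qed.

Lemma poly_scale (s : R) P : poly_fun P -> poly_fun (fun x : 'rV[R]_n => P (s *: x)).
Proof.
elim=> [c|i|f g _ pf _ pg|f g _ pf _ pg].
- exact: poly_cst.
- by apply: poly_funE (poly_mul (poly_cst _ s) (poly_coord _ i)) _ => x; rewrite mxE.
- exact: poly_add.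
- exact: poly_mul.
Qed.

Lemma poly_W : poly_fun (@W R n).
Proof.
rewrite /W; elim: (index_enum _) => [|i s IH].
  by apply: poly_funE (poly_cst _ 1) _ => x; rewrite big_nil.
have p1 : poly_fun (fun x : 'rV[R]_n => 1 + x ord0 i * x ord0 i).
  by apply: poly_add; [exact: poly_cst|apply: poly_mul; exact: poly_coord].
by apply: poly_funE (poly_mul p1 IH) _ => x; rewrite big_cons expr2.
Qed.

Lemma poly_exp P k : poly_fun P -> poly_fun (fun x : 'rV[R]_n => P x ^+ k).
Proof.
move=> pP; elim: k => [|k IH]; first exact: poly_cst.
by apply: poly_funE (poly_mul pP IH) _ => x; rewrite exprS.
Qed.

(** The dilation by sqrt a turns [gs a] into the standard Gaussian, for which [poly_decay] applies
    to the dilated polynomial. *)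
Lemma poly_gs_bound (a : R) P : 0 < a -> poly_fun P ->
  exists2 M, 0 <= M & forall x, gs a x * `|P x| <= M.
Proof.
move=> a0 pP; pose s := Num.sqrt a; have s0 : s != 0 by rewrite gt_eqF// sqrtr_gt0.
have [M HM] := poly_decay (0, 0) (poly_scale s^-1 pP).
have H x : gs a x * `|P x| <= M.
  have := HM (s *: x); rewrite /= subr0 scalerA mulVf// scale1r.
  rewrite dotrvZl dotrvZr mulrA -expr2 sqr_sqrtr; last exact: ltW.
  by rewrite mulrA.
exists M => //; apply: le_trans (H 0); rewrite mulr_ge0//; exact: gs_ge0.
Qed.

Lemma poly_gs_W (a : R) P k : 0 < a -> poly_fun P ->
  exists2 C, 0 <= C & forall x, gs a x * `|P x| <= C * (W x ^+ k)^-1.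
Proof.
move=> a0 pP; have [M M0 HM] := poly_gs_bound a0 (poly_mul pP (poly_exp k poly_W)).
exists M => // x; have := HM x.
rewrite ler_pdivlMr ?exprn_gt0 ?W_gt0// -mulrA normrM (ger0_norm (_ : 0 <= W x ^+ k))//.
by rewrite exprn_ge0// ltW// W_gt0.
Qed.

End dot.

(** * The Fourier transform of a Gaussian *)

Section gaussian_fourier.
Context (R : realType) (n : nat).
Local Notation mu := (lebesgue_rV R n).
Local Notation intg f := (mu.-integrable setT (EFin \o f)).
Local Notation I f := (Rintegral mu setT f).
Implicit Types (xi : 'rV[R]_n).

Lemma measurable_poly (P : 'rV[R]_n -> R) : poly_fun P -> measurable_fun setT P.
Proof. by move=> pP; apply: continuous_measurable_rV; exact: poly_continuous. Qed.

Lemma measurable_cosf d (T : measurableType d) (f : T -> R) :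
  measurable_fun setT f -> measurable_fun setT (fun x => cos (f x)).
Proof.
by apply: measurableT_comp; apply: continuous_measurable_fun; exact: continuous_cos.
Qed.

Lemma measurable_sinf d (T : measurableType d) (f : T -> R) :
  measurable_fun setT f -> measurable_fun setT (fun x => sin (f x)).
Proof.
by apply: measurableT_comp; apply: continuous_measurable_fun; exact: continuous_sin.
Qed.

Lemma cos_abs (u : R) : `|cos u| <= 1.
Proof. by rewrite ler_norml cos_geN1 cos_le1. Qed.

Lemma sin_abs (u : R) : `|sin u| <= 1.
Proof. by rewrite ler_norml sin_geN1 sin_le1. Qed.

Context (a : R) (a0 : 0 < a) (v : 'rV[R]_n) (th : R).

(** The parameter [s] joins the plain Gaussian integral at 0 to the Fourier integral at 1. The free
    phase [th] lets a single cosine formula cover sines too. *)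
Let ph (s : R) xi := 2 * pi * s * dotrv xi v + th.

Let measurable_ph s : measurable_fun setT (ph s).
Proof.
apply: measurable_poly; apply: poly_add; last exact: poly_cst.
by apply: poly_mul; [exact: poly_cst|exact: dotrv_poly].
Qed.

Let J (s : R) := I (fun xi => gs a xi * cos (ph s xi)).

Let dom P (t : 'rV[R]_n -> R) : poly_fun P -> measurable_fun setT t -> (forall x, `|t x| <= 1) ->
  exists2 C, 0 <= C & forall xi, `|P xi * gs a xi * t xi| <= C * (W xi)^-1.
Proof.
move=> pP mt t1; have [C C0 HC] := poly_gs_W 1 a0 pP; exists C => // xi.
apply: le_trans (HC xi); rewrite -mulrA mulrC -mulrA !normrM (ger0_norm (gs_ge0 _ _)) ler_wpM2l ?gs_ge0//.
by rewrite ler_piMl.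
Qed.

Let mtrm P (t : 'rV[R]_n -> R) : poly_fun P -> measurable_fun setT t ->
  measurable_fun setT (fun xi => P xi * gs a xi * t xi).
Proof.
move=> pP mt; apply: measurable_funM => //; apply: measurable_funM; last exact: measurable_gs.
exact: measurable_poly.
Qed.

Let itrm P (t : 'rV[R]_n -> R) : poly_fun P -> measurable_fun setT t -> (forall x, `|t x| <= 1) ->
  intg (fun xi => P xi * gs a xi * t xi).
Proof.
move=> pP mt t1; have [C C0 HC] := dom pP mt t1.
exact: (intg_dom (mtrm pP mt) HC (intgZ C (intg_invW R n))).
Qed.

(* Integrating the j-th partial derivative of gs a * sin gives a linear ODE for J. *)
Let gauss_ibp s j :
  a * I (fun xi => xi ord0 j * gs a xi * sin (ph s xi)) = s * v ord0 j * J s.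
Proof.
pose F xi := gs a xi * sin (ph s xi).
pose A xi := xi ord0 j * gs a xi * sin (ph s xi).
pose B xi := 1 * gs a xi * cos (ph s xi).
pose F' xi := - (2 * pi * a) * A xi + (2 * pi * s * v ord0 j) * B xi.
have dF xi : is_derive xi (delta_mx ord0 j : 'rV[R]_n) F (F' xi).
  have H1 := is_deriveD (is_deriveM (is_derive_cst (2 * pi * s) xi (delta_mx ord0 j)) (is_derive_dotl xi v j)) (is_derive_cst th xi (delta_mx ord0 j)).
  apply: is_derive_eq (is_deriveM (is_derive_gs a xi j) (is_derive_chain H1 (is_derive_sin _))) _.
  by rewrite /F' /A /B /GRing.scale /= /GRing.scale /=; rewrite -/(ph s xi); ring.
have ms : measurable_fun setT (fun xi => sin (ph s xi)) by exact: measurable_sinf.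
have mc : measurable_fun setT (fun xi => cos (ph s xi)) by exact: measurable_cosf.
have [C1 C10 H1] := dom (poly_coord R j) ms (fun x => sin_abs _).
have [C2 C20 H2] := dom (poly_cst n 1) mc (fun x => cos_abs _).
have [C3 C30 H3] := dom (poly_cst n 1) ms (fun x => sin_abs _).
have iA := itrm (poly_coord R j) ms (fun x => sin_abs _).
have iB := itrm (poly_cst n 1) mc (fun x => cos_abs _).
pose C := C3 + (`|2 * pi * a| * C1 + `|2 * pi * s * v ord0 j| * C2).
have W0 xi : 0 <= (W xi)^-1 by rewrite invr_ge0 ltW// W_gt0.
have [|||E iF'] := @Rint_derive0 R n F F' _ C dF.
- by apply: measurable_funM => //; exact: measurable_gs.
- move=> xi; rewrite /F -[gs a xi]mul1r (le_trans (H3 xi))// ler_wpM2r// lerDl.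
  by rewrite addr_ge0// mulr_ge0.
- move=> xi; rewrite /F'; apply: (le_trans (ler_normD _ _)).
  have -> : C * (W xi)^-1 = C3 * (W xi)^-1 + (`|2 * pi * a| * (C1 * (W xi)^-1)
      + `|2 * pi * s * v ord0 j| * (C2 * (W xi)^-1)) by rewrite /C !mulrDl !mulrA.
  apply: ler_wpDl; first exact: mulr_ge0.
  rewrite normrM [X in _ + X <= _]normrM normrN.
  by apply: lerD; apply: ler_wpM2l => //; [exact: H1|exact: H2].
move: E; rewrite /F' RintegralD//; last 2 first.
- exact: intgZ.
- exact: intgZ.
rewrite !RintegralZl// => E.
have -> : J s = I B by apply: eq_Rintegral => xi _; rewrite /B mul1r.
have p0 : 2 * pi != 0 :> R by rewrite mulf_neq0// gt_eqF// pi_gt0.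
apply: (mulfI p0); move: E; rewrite -/A => /eqP; rewrite addrC mulNr subr_eq0 => /eqP E.
by rewrite mulrA -E; ring.
Qed.

Let dcos (s : R) xi : is_derive s 1 (fun s : R => gs a xi * cos (ph s xi))
  (- (2 * pi) * (dotrv xi v * gs a xi * sin (ph s xi))).
Proof.
have H : is_derive s 1 (fun s : R => ph s xi) (2 * pi * dotrv xi v).
  have := is_deriveD (is_deriveM (is_deriveM (is_derive_cst (2 * pi : R) s 1) (is_derive_id s 1)) (is_derive_cst (dotrv xi v) s 1)) (is_derive_cst th s 1).
  by move/is_derive_eq; apply; rewrite /GRing.scale /=; ring.
apply: is_derive_eq (is_deriveM (is_derive_cst (gs a xi) s 1) (is_derive1_comp (is_derive_cos _) H)) _.
by rewrite /GRing.scale /=; ring.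
Qed.

(** Differentiation under the integral brings down the factor [dotrv xi v]; expanding it in
    coordinates and applying [gauss_ibp] to each gives back [J] with the factor [dotrv v v]. *)
Let J_derive (s : R) : is_derive s 1 J (- (2 * pi * a^-1 * dotrv v v) * s * J s).
Proof.
pose f (s : R) xi := gs a xi * cos (ph s xi).
pose G xi := 2 * pi * (gs a xi * `|dotrv xi v|).
have pd := dotrv_poly v.
have p0 : 0 <= 2 * pi :> R by rewrite mulr_ge0// pi_ge0.
have ms t : measurable_fun setT (fun xi => sin (ph t xi)) by exact: measurable_sinf.
have mc t : measurable_fun setT (fun xi => cos (ph t xi)) by exact: measurable_cosf.
have Is : s \in `](s - 1), (s + 1)[%R by rewrite in_itv /= ltrBlDr ltrDl ltr01.
have intf (t : R) : `](s - 1), (s + 1)[%classic t -> intg (f t).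
  move=> _; rewrite (_ : f t = fun xi => 1 * gs a xi * cos (ph t xi)).
    by apply: itrm => // *; [exact: poly_cst|exact: cos_abs].
  by apply/funext => xi; rewrite mul1r.
have derf1 (t : R) xi : `](s - 1), (s + 1)[%classic t -> [set: 'rV[R]_n] xi -> derivable (f ^~ xi) t 1.
  by move=> _ _; exact: (@ex_derive _ _ _ _ _ _ _ (dcos t xi)).
have d1E t xi : partial1of2 f t xi = - (2 * pi) * (dotrv xi v * gs a xi * sin (ph t xi)).
  by rewrite partial1of2E; exact: (@derive_val _ _ _ _ _ _ _ (dcos t xi)).
have G0 xi : 0 <= G xi by rewrite /G !mulr_ge0// ?gs_ge0// pi_ge0.
have iG : intg G.
  apply: intgZ; rewrite (_ : (fun _ => _) = fun xi => `|dotrv xi v| * gs a xi); last first.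
    by apply/funext => xi; rewrite mulrC.
  have [C C0 HC] := dom pd (measurable_cst (1 : R)) (fun _ => eq_ind_r (fun y => y <= 1) (lexx 1) (normr1 R)).
  apply: (intg_dom _ _ (intgZ C (intg_invW R n))).
    apply: measurable_funM; last exact: measurable_gs.
    by apply: measurableT_comp => //; exact: measurable_poly.
  by move=> xi; have := HC xi; rewrite mulr1 !normrM normr_id.
have G_ub (t : R) xi : `](s - 1), (s + 1)[%classic t -> [set: 'rV[R]_n] xi -> `|partial1of2 f t xi| <= G xi.
  move=> _ _; rewrite d1E /G normrM normrN (ger0_norm p0) ler_wpM2l// !normrM.
  by rewrite (ger0_norm (gs_ge0 _ _)) [leRHS]mulrC ler_piMr// ?sin_abs// mulr_ge0// gs_ge0.
have DJ := @derivable_under_integral R _ _ mu f setT measurableT s _ _ Is intf derf1 G G0 iG G_ub.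
have DE := @differentiation_under_integral R _ _ mu f setT measurableT s _ _ Is intf derf1 G G0 iG G_ub.
apply: DeriveDef; first exact: DJ.
rewrite -derive1E DE.
transitivity (I (fun xi => - (2 * pi) * \sum_j v ord0 j * (xi ord0 j * gs a xi * sin (ph s xi)))).
  apply: eq_Rintegral => xi _; rewrite d1E; congr (_ * _).
  rewrite /dotrv !mulr_suml; apply: eq_bigr => j _; ring.
have ij j : intg (fun xi => xi ord0 j * gs a xi * sin (ph s xi)).
  by apply: itrm => //; [exact: poly_coord|move=> x; exact: sin_abs].
have [i1 E1] := sum_Rint (index_enum 'I_n) (fun j => intgZ (v ord0 j) (ij j)).
rewrite RintegralZl// E1.
under eq_bigr do rewrite RintegralZl// -[I _](mulKf (lt0r_neq0 a0)) gauss_ibp.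
have -> : \sum_j v ord0 j * (a^-1 * (s * v ord0 j * J s)) = dotrv v v * (a^-1 * s * J s).
  by rewrite /dotrv mulr_suml; apply: eq_bigr => j _; ring.
by move: (a^-1) (dotrv v v) (J s) => b w y; ring.
Qed.

(** The equation J' = - K s J makes J(s) exp(K s^2 / 2) constant, with K = 2 pi |v|^2 / a. Comparing
    s = 0 with s = 1 yields the formula, since exp(- K / 2) is [gs a^-1 v]. *)
Lemma gauss_fourier : I (fun xi => gs a xi * cos (2 * pi * dotrv xi v + th)) =
  cos th * (Num.sqrt a)^-1 ^+ n * gs a^-1 v.
Proof.
pose K := 2 * pi * a^-1 * dotrv v v.
pose psi (s : R) := J s * expR (K / 2 * (s * s)).
have dpsi (s : R) : is_derive s 1 psi 0.
  have H := is_deriveM (is_derive_cst (K / 2) s 1) (is_deriveM (is_derive_id s 1) (is_derive_id s 1)).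
  apply: is_derive_eq (is_deriveM (J_derive s) (is_derive1_comp (is_derive_expR _) H)) _.
  have alg (y k E t : R) : y * (E * (k / 2 * (t * 1 + t * 1) + t * t * 0)) + E * (- k * t * y) = 0 by field.
  exact: (alg (J s) K (expR (K / 2 * (s * s))) s).
have J0 : J 0 = cos th * (Num.sqrt a)^-1 ^+ n.
  rewrite -Rint_gs// -RintegralZl//; last exact: intg_gs.
  by apply: eq_Rintegral => xi _; rewrite /ph mulr0 mul0r add0r mulrC.
have := is_derive_0_is_cst 1 0 dpsi; rewrite /psi !mulr0 expR0 !mulr1 J0 => <-.
rewrite -mulrA /gs -expRD (_ : _ + _ = 0).
  by rewrite expR0 mulr1; apply: eq_Rintegral => xi _; rewrite /ph mulr1.
have alg (p b w : R) : 2 * p * b * w / 2 + - p * b * w = 0 by field.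
exact: alg.
Qed.

End gaussian_fourier.

Section measurable_rV_ops.
Context d (T : measurableType d) (R : realType) (n : nat).
Implicit Types (u v : T -> 'rV[R]_n).

Lemma measurable_coordf u i : measurable_fun setT u -> measurable_fun setT (fun t => u t ord0 i).
Proof. by move=> mu; exact: measurableT_comp (measurable_coord i) mu. Qed.

Lemma measurable_subrV u v : measurable_fun setT u -> measurable_fun setT v ->
  measurable_fun setT (fun t => u t - v t).
Proof.
move=> mu mv; apply: measurable_fun_rV => i.
rewrite (_ : (fun t => _) = (fun t => u t ord0 i - v t ord0 i)); last by apply/funext => t; rewrite !mxE.
by apply: measurable_funB; exact: measurable_coordf.
Qed.

Lemma measurable_dotrv u v : measurable_fun setT u -> measurable_fun setT v ->
  measurable_fun setT (fun t => dotrv (u t) (v t)).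
Proof.
by move=> mu mv; apply: measurable_sum => i; apply: measurable_funM; exact: measurable_coordf.
Qed.

Lemma measurable_gsf u a : measurable_fun setT u -> measurable_fun setT (fun t => gs a (u t)).
Proof. exact: measurableT_comp (@measurable_gs R n a). Qed.

End measurable_rV_ops.

(** * Gaussian approximate identity *)

Section approximate_identity.
Context (R : realType) (n : nat).
Local Notation mu := (lebesgue_rV R n).
Local Notation intg f := (mu.-integrable setT (EFin \o f)).
Local Notation I f := (Rintegral mu setT f).
Implicit Types (x v t : 'rV[R]_n).

Lemma dotrv_ge0 v : 0 <= dotrv v v.
Proof. by apply: sumr_ge0 => i _; rewrite -expr2 sqr_ge0. Qed.

Lemma gs_le1 a v : 0 <= a -> gs a v <= 1.
Proof.
move=> a0; rewrite -expR0 ler_expR !mulNr oppr_le0 !mulr_ge0// ?pi_ge0//.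
exact: dotrv_ge0.
Qed.

(** Half of the exponent is spent on absorbing |v|^2 through w exp(- w) <= 1. The wider Gaussian
    that remains is integrable, so the second moment is of order [a]. *)
Lemma gs_moment a v : 0 < a -> dotrv v v * gs a^-1 v <= 2 * a / pi * gs (2 * a)^-1 v.
Proof.
move=> a0; have p0 : 0 < pi :> R by exact: pi_gt0.
pose w := pi * (2 * a)^-1 * dotrv v v.
have w0 : 0 <= w by rewrite !mulr_ge0 ?dotrv_ge0// ?invr_ge0 ?mulr_ge0// ltW.
have -> : gs a^-1 v = expR (- w) * gs (2 * a)^-1 v.
  rewrite /gs -expRD; congr expR; rewrite /w.
  have alg (p b y : R) : b != 0 -> - p * b^-1 * y = - (p * (2 * b)^-1 * y) + - p * (2 * b)^-1 * y by move=> b0; field.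
  by apply: alg; rewrite gt_eqF.
rewrite mulrA ler_wpM2r ?gs_ge0//.
have -> : dotrv v v = 2 * a / pi * w.
  have alg (p b y : R) : p != 0 -> b != 0 -> y = 2 * b / p * (p * (2 * b)^-1 * y) by move=> h1 h2; field; apply/andP; split.
  by apply: alg; rewrite gt_eqF.
rewrite -[leLHS]mulrA; apply: ler_piMr; first by rewrite divr_ge0 ?mulr_ge0// ltW.
rewrite expRN ler_pdivrMr ?expR_gt0// mul1r (le_trans _ (expR_ge1Dx _))// lerDr//.
Qed.

(** A Chebyshev argument. Near [x] the oscillation of [k] is small; at distance at least [del] it is
    at most 2 B, hence at most 2 B |t - x|^2 / del^2, whose integral against the kernel tends to 0
    with the second moment. *)
Lemma approx_identity (k : 'rV[R]_n -> R) (B : R) x : measurable_fun setT k ->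
  {for x, continuous k} -> (forall t, `|k t| <= B) ->
  I (fun t => k t * ((Num.sqrt m.+1%:R^-1)^-1 ^+ n * gs m.+1%:R (t - x))) @[m --> \oo] --> k x.
Proof.
move=> mk kx kB.
pose a m : R := m.+1%:R^-1.
have a0 m : 0 < a m by rewrite invr_gt0.
have aV m : (a m)^-1 = m.+1%:R by rewrite invrK.
pose c m := (Num.sqrt (a m))^-1 ^+ n.
have c0 m : 0 <= c m by rewrite exprn_ge0// invr_ge0 sqrtr_ge0.
have sqrtV (b : R) : 0 < b -> (Num.sqrt b^-1)^-1 = Num.sqrt b by move=> b0; rewrite sqrtrV ?invrK// ltW.
have igs b : 0 < b -> intg (fun t => gs b (t - x)) /\ I (fun t => gs b (t - x)) = (Num.sqrt b)^-1 ^+ n.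
  by move=> b0; rewrite -Rint_gs//; have [] := intg_addr (- x) (intg_gs n b0).
pose q m t := c m * gs (a m)^-1 (t - x).
have q0 m t : 0 <= q m t by rewrite mulr_ge0// gs_ge0.
have [iq q1] : (forall m, intg (q m)) /\ (forall m, I (q m) = 1).
  have aV0 m : 0 < (a m)^-1 by rewrite invr_gt0.
  split => m; have [i1 E1] := igs _ (aV0 m); first exact: intgZ.
  rewrite /q RintegralZl// E1 sqrtV// /c -exprMn mulVf ?expr1n//.
  by rewrite gt_eqF// sqrtr_gt0.
have mq m : measurable_fun setT (q m) by exact: intg_measurable (iq m).
have B0 : 0 <= B by exact: le_trans (normr_ge0 _) (kB x).
have ikq m : intg (fun t => k t * q m t).
  apply: (intg_dom _ _ (intgZ B (iq m))); first exact: measurable_funM.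
  by move=> t; rewrite normrM (ger0_norm (q0 _ _)) ler_wpM2r.
pose K := (Num.sqrt 2 : R) ^+ n.
have mom m : intg (fun t => dotrv (t - x) (t - x) * q m t) /\
    I (fun t => dotrv (t - x) (t - x) * q m t) <= 2 * a m / pi * K.
  have a20 : 0 < (2 * a m)^-1 by rewrite invr_gt0 mulr_gt0.
  have [i2 E2] := igs _ a20.
  have le t : `|dotrv (t - x) (t - x) * q m t| <= 2 * a m / pi * (c m * gs (2 * a m)^-1 (t - x)).
    rewrite ger0_norm; last by rewrite mulr_ge0// dotrv_ge0.
    rewrite /q mulrCA [leRHS]mulrCA; apply: ler_wpM2l => //; exact: gs_moment.
  have mt : measurable_fun setT (fun t => dotrv (t - x) (t - x) * q m t).
    apply: measurable_funM => //.
    by apply: measurable_dotrv; apply: measurable_subrV.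
  have ir := intgZ (2 * a m / pi) (intgZ (c m) i2).
  split; first exact: intg_dom mt le ir.
  apply: le_trans (ler_norm _) _; apply: (le_trans (Rint_le_dom mt le ir)).
  rewrite RintegralZl//; last exact: intgZ.
  rewrite RintegralZl// E2 sqrtV; last by rewrite mulr_gt0.
  rewrite /c -exprMn sqrtrM// mulrCA mulVf ?mulr1//.
  by rewrite gt_eqF// sqrtr_gt0.
apply/cvgrPdist_le => e e0.
have [del d0 kd] : exists2 del, 0 < del & forall t, dotrv (t - x) (t - x) < del ^+ 2 -> `|k x - k t| <= e / 2.
  move/cvgrPdist_le : kx => /(_ (e / 2)); rewrite divr_gt0// => /(_ isT) /nbhs_ballP[del /= d0 H].
  exists del => // t tx; apply: H; split => // i j; rewrite /ball /= ord1.
  rewrite -(@ltr_pXn2r _ 2%N)// ?nnegrE//; last exact: ltW.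
  apply: le_lt_trans tx; rewrite real_normK ?num_real//.
  rewrite /dotrv (bigD1 j)//= !mxE expr2 -mulrNN !opprB lerDl.
  by apply: sumr_ge0 => l _; rewrite -expr2 sqr_ge0.
have key m : `|k x - I (fun t => k t * q m t)| <= e / 2 + (2 * B / del ^+ 2) * (2 * a m / pi * K).
  have -> : k x - I (fun t => k t * q m t) = I (fun t => k x * q m t - k t * q m t).
    by rewrite RintegralB//; [rewrite RintegralZl// q1 mulr1|exact: intgZ].
  have [im Hm] := mom m.
  have le t : `|k x * q m t - k t * q m t| <= e / 2 * q m t + (2 * B / del ^+ 2) * (dotrv (t - x) (t - x) * q m t).
    rewrite -mulrBl normrM (ger0_norm (q0 _ _)) mulrA -mulrDl ler_wpM2r//.
    have [/kd h|h] := ltP (dotrv (t - x) (t - x)) (del ^+ 2).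
      apply: (le_trans h); rewrite lerDl mulr_ge0 ?dotrv_ge0// divr_ge0 ?sqr_ge0// mulr_ge0//.
    apply: (@le_trans _ _ (2 * B)).
      apply: (le_trans (ler_normB _ _)); rewrite mulr_natl mulr2n; exact: lerD.
    apply: ler_wpDl; first by rewrite divr_ge0// ltW.
    by rewrite mulrAC ler_pdivlMr ?exprn_gt0// ler_wpM2l// mulr_ge0.
  have ir := intgD (intgZ (e / 2) (iq m)) (intgZ (2 * B / del ^+ 2) im).
  apply: (le_trans (Rint_le_dom _ le ir)).
    by apply: measurable_funB; exact: measurable_funM.
  rewrite RintegralD//; [|exact: intgZ..].
  rewrite (RintegralZl (f := q m))// (RintegralZl (f := fun t => dotrv (t - x) (t - x) * q m t))//.
  rewrite q1 mulr1 lerD2l; apply: ler_wpM2l => //.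
  by rewrite divr_ge0 ?sqr_ge0// mulr_ge0.
have lim0 : (2 * B / del ^+ 2) * (2 * a m / pi * K) @[m --> \oo] --> (0 : R).
  rewrite (_ : (fun m => _) = (fun m => (2 * B / del ^+ 2 * 2 / pi * K) * a m)); last by apply/funext => m; ring.
  rewrite -[X in _ --> X](mulr0 (2 * B / del ^+ 2 * 2 / pi * K)).
  by apply: cvgM; [exact: cvg_cst|exact: cvg_harmonic].
have e2 : 0 < e / 2 by rewrite divr_gt0.
move/cvgrPdist_le : lim0 => /(_ _ e2); apply: filterS => m; rewrite sub0r normrN => h.
rewrite (_ : (fun t => _) = (fun t => k t * q m t)).
  by apply: (le_trans (key m)); rewrite [leRHS](splitr e) lerD2l (le_trans (ler_norm _)).
by apply/funext => t; rewrite /q /c aV.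
Qed.

End approximate_identity.

(** * Inversion of the short-time Fourier transform *)

Section inversion.
Context (R : realType) (n : nat).
Local Notation mu := (lebesgue_rV R n).
Local Notation intg m f := (integrable m setT (EFin \o f)).
Local Notation I m f := (Rintegral m setT f).
Local Notation phase := ('rV[R]_n * 'rV[R]_n)%type.
Implicit Types (x v t xi y : 'rV[R]_n) (z : phase).

(** [lebesgue_phase] is typed as a plain measure, while Fubini asks for sigma-finiteness. This copy
    carries the stronger structure and remains convertible to the original, so results transfer by
    conversion. *)
Definition lphase_fun : set phase -> \bar R := lebesgue_phase R n.

HB.instance Definition _ := Measure.copy lphase_fun (lebesgue_phase R n).

Let lphase_sigma_finite : sigma_finite setT lphase_fun.
Proof.
have /sigma_finiteP[F [TF ndF Foo]] := sigma_finiteT mu.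
exists (fun n => F n `*` F n).
  rewrite -setXTT {1}TF {1}TF predeqE => -[x y]; split.
    move=> [/= [i _ Fnx] [k _ Gky]]; exists (maxn i k) => //; split.
    - by move: x Fnx; exact/subsetPset/ndF/leq_maxl.
    - by move: y Gky; exact/subsetPset/ndF/leq_maxr.
  by move=> [i _ []/= ? ?]; split; exists i.
move=> k; have [? ?] := Foo k.
split; first exact: measurableX.
by rewrite /lphase_fun [X in (X < _)%E]product_measure1E// lte_mul_pinfty// ge0_fin_numE.
Qed.

HB.instance Definition _ := Measure_isSigmaFinite.Build _ _ _ lphase_fun lphase_sigma_finite.

Definition lphase : {sigma_finite_measure set phase -> \bar R} := lphase_fun.

Definition k0 : R := 2 `^ (n%:R / 4).
Definition g0 t : R := k0 * gs 1 t.

Lemma k0_gt0 : 0 < k0. Proof. exact: powR_gt0. Qed.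

Lemma gaussianE t : gaussian t = Complex (g0 t) 0.
Proof. by rewrite /gaussian /g0 /gs mulr1. Qed.

Lemma g0_ge0 t : 0 <= g0 t. Proof. by rewrite mulr_ge0// ?gs_ge0// ltW// k0_gt0. Qed.

Lemma g0_le t : g0 t <= k0.
Proof. by apply: ler_piMr; [exact: ltW k0_gt0|exact: gs_le1]. Qed.

Lemma g0N t : g0 (- t) = g0 t.
Proof. by rewrite /g0 /gs dotrvNr dotrvC dotrvNr opprK. Qed.

Lemma measurable_g0 : measurable_fun setT g0.
Proof. by apply: measurable_funM => //; exact: measurable_gs. Qed.

Lemma intg_g0 : intg mu g0.
Proof. by apply: intgZ; exact: intg_gs. Qed.

(* The squared L^2 norm of phi_0, in fact equal to 1; only its positivity matters. *)
Definition kappa : R := k0 ^+ 2 * (Num.sqrt 2)^-1 ^+ n.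

Lemma kappa_gt0 : 0 < kappa.
Proof. by rewrite mulr_gt0// exprn_gt0 ?k0_gt0// invr_gt0 sqrtr_gt0. Qed.

(** Completing the square: |x - y|^2 + |t - y|^2 = |t - x|^2 / 2 + 2 |y - (x + t)/2|^2, and the last
    term integrates to a constant by translation. *)
Lemma g0_corr x t : intg mu (fun y => g0 (x - y) * g0 (t - y)) /\
  I mu (fun y => g0 (x - y) * g0 (t - y)) = kappa * gs 2^-1 (t - x).
Proof.
have [i2 E2] := intg_addr (- (2^-1 *: (x + t))) (@intg_gs R n 2 ltac:(by [])).
have E y : g0 (x - y) * g0 (t - y) = k0 ^+ 2 * gs 2^-1 (t - x) * gs 2 (y - 2^-1 *: (x + t)).
  rewrite /g0 mulrACA -expr2 -mulrA; congr (_ * _); rewrite /gs -!expRD; congr expR.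
  rewrite -!mulrA -!mulrDr; congr (_ * _).
  rewrite mul1r /dotrv !mulr_sumr -!big_split /=; apply: eq_bigr => i _; rewrite !mxE.
  by field.
split; first by under eq_fun do rewrite E; exact: intgZ.
under eq_Rintegral do rewrite E.
by rewrite RintegralZl// E2 Rint_gs// /kappa mulrAC.
Qed.

Lemma Rint_prod (a b : 'rV[R]_n -> R) : intg mu a -> intg mu b ->
  I lphase (fun z => a z.1 * b z.2) = I mu a * I mu b.
Proof.
move=> ia ib; have ma := intg_measurable ia; have mb := intg_measurable ib.
have mab : measurable_fun setT (fun z : phase => a z.1 * b z.2).
  by apply: measurable_funM; [exact: measurableT_comp ma measurable_fst|
    exact: measurableT_comp mb measurable_snd].
have [|||||-> _ _ _ _] // := @Rint_fubini _ _ _ _ R mu mu (fun z => a z.1 * b z.2) (fun x => `|a x|) (fun x => `|b x|) mab.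
- exact: integrable_norm.
- exact: integrable_norm.
- by move=> x y /=; rewrite normrM.
transitivity (I mu (fun x => a x * I mu b)); last by rewrite RintegralZr.
by apply: eq_Rintegral => x _; rewrite -RintegralZl.
Qed.

Context (f : 'rV[R]_n -> R) (C : R) (x : 'rV[R]_n) (th : R).
Context (cf : continuous f).
Context (fC : forall t, `|f t| <= C * (W t)^-1).

(** For [th = 0] this is the real part of e^(2 pi i z_2.x) V_{phi_0}f(z), and for [th = pi / 2] its
    imaginary part. The decay [FC'] is a hypothesis here and is supplied later by integration by
    parts. *)
Let F z := I mu (fun t => f t * g0 (t - z.1) * cos (2 * pi * dotrv z.2 (t - x) + th)).

Context (C' : R).
Context (FC' : forall z, `|F z| <= C' * ((W z.1)^-1 * (W z.2)^-1)).

Let mf : measurable_fun setT f. Proof. exact: continuous_measurable_rV. Qed.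

Let C0 : 0 <= C.
Proof.
have /(le_trans (normr_ge0 _)) := fC 0; rewrite pmulr_lge0// invr_gt0; exact: W_gt0.
Qed.

Let fle t : `|f t| <= C.
Proof.
by rewrite (le_trans (fC t))// ler_piMr// invf_le1 ?W_gt0// W_ge1.
Qed.

Let if_ : intg mu f.
Proof. exact: (intg_dom mf fC (intgZ C (intg_invW R n))). Qed.

Let G (a : R) (zt : phase * 'rV[R]_n) :=
  g0 (x - zt.1.1) * gs a zt.1.2 * (f zt.2 * g0 (zt.2 - zt.1.1) * cos (2 * pi * dotrv zt.1.2 (zt.2 - x) + th)).

Let mG a : measurable_fun setT (G a).
Proof.
have m11 : measurable_fun setT (fun zt : phase * 'rV[R]_n => zt.1.1) by exact: measurableT_comp measurable_fst measurable_fst.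
have m12 : measurable_fun setT (fun zt : phase * 'rV[R]_n => zt.1.2) by exact: measurableT_comp measurable_snd measurable_fst.
have m2 : measurable_fun setT (fun zt : phase * 'rV[R]_n => zt.2) by exact: measurable_snd.
apply: measurable_funM.
  apply: measurable_funM; last exact: measurable_gsf.
  by apply: (measurableT_comp measurable_g0); exact: measurable_subrV.
apply: measurable_funM.
  apply: measurable_funM; first exact: measurableT_comp mf m2.
  by apply: (measurableT_comp measurable_g0); exact: measurable_subrV.
apply: measurable_cosf; apply: measurable_funD => //; apply: measurable_funM => //.
by apply: measurable_dotrv => //; exact: measurable_subrV.
Qed.

Let ig0x : intg mu (fun y => g0 (x - y)) .
Proof.
have [i1 _] := intg_addr (- x) intg_g0.
by rewrite (_ : (fun y => _) = (fun y => g0 (y - x)))//; apply/funext => y; rewrite -g0N opprB.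
Qed.

Let trm_le t (s : 'rV[R]_n) (w : R) : `|f t * g0 s * cos w| <= k0 * `|f t|.
Proof.
rewrite normrM; apply: (le_trans (ler_piMr (normr_ge0 _) (cos_abs _))).
rewrite normrM (ger0_norm (g0_ge0 s)) mulrC; apply: ler_wpM2r => //; exact: g0_le.
Qed.

(** The cutoff [gs a] in frequency makes the triple integral absolutely convergent. After exchanging
    the order, the position integral is [g0_corr] and the frequency integral is [gauss_fourier],
    whose result is the kernel of an approximate identity in [t]. *)
Let regularized a : 0 < a ->
  [/\ measurable_fun setT (fun z => g0 (x - z.1) * gs a z.2 * F z) &
  I lphase (fun z => g0 (x - z.1) * gs a z.2 * F z) =
  cos th * kappa * I mu (fun t => f t * gs 2^-1 (t - x) * ((Num.sqrt a)^-1 ^+ n * gs a^-1 (t - x)))].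
Proof.
move=> a0.
have iA : intg lphase (fun z => g0 (x - z.1) * gs a z.2).
  exact: (intg_prod ig0x (intg_gs n a0) (fun y => g0_ge0 _) (@gs_ge0 R n a)).
have iB : intg mu (fun t => k0 * `|f t|) by apply: intgZ; exact: integrable_norm.
have c0 z : 0 <= g0 (x - z.1) * gs a z.2 by apply: mulr_ge0; [exact: g0_ge0|exact: gs_ge0].
have [|||E1 E2 mE _ _] := Rint_fubini (mG a) iA iB.
- exact: c0.
- by move=> t; apply: mulr_ge0 => //; exact: ltW k0_gt0.
- move=> z t; rewrite /G /= normrM (ger0_norm (c0 z)).
  by apply: ler_wpM2l; [exact: c0|exact: trm_le].
have FE z : I mu (fun t => G a (z, t)) = g0 (x - z.1) * gs a z.2 * F z.
  rewrite /G /= RintegralZl//; apply: (@intg_dom _ _ _ _ _ (fun t => k0 * `|f t|)) => //.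
    apply: measurable_funM.
      apply: measurable_funM => //; apply: (measurableT_comp measurable_g0).
      exact: measurable_subrV.
    apply: measurable_cosf; apply: measurable_funD => //; apply: measurable_funM => //.
    by apply: measurable_dotrv => //; exact: measurable_subrV.
have -> : (fun z => g0 (x - z.1) * gs a z.2 * F z) = (fun z => I mu (fun t => G a (z, t))).
  by apply/funext => z; rewrite FE.
split; first exact: mE.
rewrite -E1 E2.
rewrite -RintegralZl//; last first.
  have aV0 : 0 < a^-1 by rewrite invr_gt0.
  have [i1 _] := intg_addr (- x) (intg_gs n aV0).
  apply: (intg_dom _ _ (intgZ (C * (Num.sqrt a)^-1 ^+ n) i1)).
    apply: measurable_funM.
      by apply: measurable_funM => //; apply: measurable_gsf; exact: measurable_subrV.
    by apply: measurable_funM => //; apply: measurable_gsf; exact: measurable_subrV.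
  move=> t; rewrite -[leRHS]mulrA normrM; apply: ler_pM => //.
    rewrite normrM -[leRHS]mulr1; apply: ler_pM => //.
    by rewrite ger0_norm ?gs_ge0// gs_le1.
  by rewrite ger0_norm// mulr_ge0 ?gs_ge0// exprn_ge0// invr_ge0.
apply: eq_Rintegral => t _.
have [iC EC] := g0_corr x t.
have := @gauss_fourier R n a a0 (t - x) th.
have iD : intg mu (fun xi => gs a xi * cos (2 * pi * dotrv xi (t - x) + th)).
  apply: (intg_dom _ _ (intg_gs n a0)).
    apply: measurable_funM; first exact: measurable_gs.
    apply: measurable_cosf; apply: measurable_funD => //; apply: measurable_funM => //.
    exact: measurable_dotrv.
  by move=> xi; rewrite normrM (ger0_norm (gs_ge0 _ _)) ler_piMr ?gs_ge0// cos_abs.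
move=> ED.
transitivity (I lphase (fun z => (f t * (g0 (x - z.1) * g0 (t - z.1))) * (gs a z.2 * cos (2 * pi * dotrv z.2 (t - x) + th)))).
  by apply: eq_Rintegral => z _; rewrite /G /=; ring.
rewrite (Rint_prod (a := fun y => f t * (g0 (x - y) * g0 (t - y))) (intgZ (f t) iC) iD) RintegralZl// EC ED.
by ring.
Qed.

(** The cutoff is removed along a = 1/(m+1). The left side converges by domination through [FC'];
    the right side by [approx_identity] applied to [f t * gs 2^-1 (t - x)], whose value at t = x is
    [f x]. *)
Lemma inversion : I lphase (fun z => g0 (x - z.1) * F z) = cos th * kappa * f x.
Proof.
pose a m : R := m.+1%:R^-1.
have a0 m : 0 < a m by rewrite invr_gt0.
have iW : intg lphase (fun z => (W z.1)^-1 * (W z.2)^-1).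
  have W0 (y : 'rV[R]_n) : 0 <= (W y)^-1 by rewrite invr_ge0 ltW// W_gt0.
  exact: (intg_prod (intg_invW R n) (intg_invW R n) W0 W0).
have mR m := (regularized (a0 m)).1.
have g0F z : `|g0 (x - z.1) * F z| <= k0 * C' * ((W z.1)^-1 * (W z.2)^-1).
  by rewrite normrM (ger0_norm (g0_ge0 _)) -mulrA ler_pM ?g0_ge0// g0_le.
have a_lim : a m @[m --> \oo] --> (0 : R) by exact: cvg_harmonic.
have [||_ lim1] := Rint_dct (f_ := fun m z => g0 (x - z.1) * gs (a m) z.2 * F z)
  (f := fun z => g0 (x - z.1) * F z) mR _ (intgZ (k0 * C') iW).
- move=> z; apply: cvgM; last exact: cvg_cst.
  rewrite -[X in _ --> X]mulr1; apply: cvgM; first exact: cvg_cst.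
  rewrite (_ : (fun m => _) = (fun m => expR (- pi * dotrv z.2 z.2 * a m))); last first.
    by apply/funext => m; rewrite /gs mulrAC.
  have h : - pi * dotrv z.2 z.2 * a m @[m --> \oo] --> (0 : R).
    by rewrite -[X in _ --> X](mulr0 (- pi * dotrv z.2 z.2)); apply: cvgM => //; exact: cvg_cst.
  by rewrite -expR0; exact: (cvg_comp _ _ h (@continuous_expR R 0)).
- move=> m z; apply: le_trans (g0F z).
  rewrite mulrAC normrM ler_piMr// ger0_norm ?gs_ge0//; apply: gs_le1; exact: ltW.
have lim2 : I lphase (fun z => g0 (x - z.1) * gs (a m) z.2 * F z) @[m --> \oo] --> cos th * kappa * f x.
  rewrite (_ : (fun m => _) = (fun m => cos th * kappa * I mu (fun t => f t * gs 2^-1 (t - x) *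
      ((Num.sqrt m.+1%:R^-1)^-1 ^+ n * gs m.+1%:R (t - x))))); last first.
    by apply/funext => m; rewrite (regularized (a0 m)).2 /a invrK.
  apply: cvgM; first exact: cvg_cst.
  have E : f x = f x * gs 2^-1 (x - x).
    by rewrite subrr /gs /dotrv big1 ?mulr0 ?expR0 ?mulr1// => i _; rewrite mxE mul0r.
  rewrite [X in _ --> X]E; apply: (@approx_identity R n (fun t => f t * gs 2^-1 (t - x)) C).
  - by apply: measurable_funM => //; apply: measurable_gsf; exact: measurable_subrV.
  - apply: continuousM; first exact: cf.
    apply: (@continuous_comp _ _ _ _ expR); last exact: continuous_expR.
    apply: continuousM; first exact: cst_continuous.
    have := @poly_bump R n (x, 0) => /= pb.
    have pb2 := poly_mul (poly_cst n (- pi)^-1) pb.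
    apply: (@poly_continuous R n); apply: poly_funE pb2 _ => t /=.
    by rewrite mulKf// oppr_eq0 gt_eqF// pi_gt0.
  - move=> t; rewrite normrM -[leRHS]mulr1; apply: ler_pM => //.
    by rewrite ger0_norm ?gs_ge0// gs_le1.
exact: (cvg_unique _ lim1 lim2).
Qed.

End inversion.

(** * Decay of the short-time Fourier transform *)

Section seminorms.
Context (R : realType) (n : nat).
Implicit Types (f g : 'rV[R]_n -> R) (x y t xi : 'rV[R]_n).
Local Notation e_ j := (delta_mx ord0 j : 'rV[R]_n).

Lemma W_ge0 x : 0 <= W x. Proof. exact: ltW (W_gt0 x). Qed.

(** Writing the power as a product along a word, k copies of all coordinates, opens it to the
    word-indexed Schwartz seminorms. *)
Lemma W_exp_prod x k :
  W x ^+ k = \prod_(i <- flatten (nseq k (index_enum 'I_n))) (1 + x ord0 i ^+ 2).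
Proof.
by elim: k => [|k IH]; [rewrite big_nil|rewrite exprS IH /= big_cat].
Qed.

Lemma size_flatten_nseq k : size (flatten (nseq k (index_enum 'I_n))) = (k * n)%N.
Proof.
elim: k => //= k IH; rewrite size_cat IH mulSn; congr (_ + _)%N.
by rewrite -[RHS]card_ord cardE enumT.
Qed.

(** There are finitely many words of bounded length, so constants found word by word can be merged:
    the [C] are added and the [M] maximised, which is harmless because [Q] is monotone in both. *)
Lemma words_uniform (Q : seq 'I_n -> R -> nat -> Prop) :
  (forall a (C C' : R) M M', C <= C' -> (M <= M')%N -> Q a C M -> Q a C' M') ->
  (forall a, exists C M, 0 <= C /\ Q a C M) ->
  forall N, exists C M, 0 <= C /\ forall a, (size a <= N)%N -> Q a C M.
Proof.
move=> mono ex; elim=> [|N [C [M [C0 H]]]].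
  have [C [M [C0 H]]] := ex [::].
  by exists C, M; split => // a; rewrite leqn0 => /nilP ->.
have /choice[F HF] : forall a : N.+1.-tuple 'I_n, exists CM : R * nat, 0 <= CM.1 /\ Q a CM.1 CM.2.
  by move=> a; have [C' [M' ?]] := ex a; exists (C', M').
have S0 : 0 <= \sum_a (F a).1 by apply: sumr_ge0 => a _; exact: (HF a).1.
exists (C + \sum_a (F a).1), (maxn M (\max_a (F a).2)); split; first exact: addr_ge0.
move=> a; rewrite leq_eqVlt => /orP[/eqP aN|aN].
  pose at_ : N.+1.-tuple 'I_n := tcast aN (in_tuple a).
  have atE : at_ = a :> seq _ by rewrite /at_ val_tcast.
  rewrite -atE; apply: mono (HF at_).2.
    apply: ler_wpDl => //; rewrite (bigD1 at_)//= lerDl.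
    by apply: sumr_ge0 => c _; exact: (HF c).1.
  by rewrite leq_max; apply/orP; right; exact: leq_bigmax.
by apply: mono (H a aN); [rewrite lerDl|rewrite leq_max leqnn].
Qed.

(** The product is expanded one factor 1 + x_i^2 at a time: each factor either leaves the current
    monomial alone or appends the letter i twice. Hence 2^(k n) terms, with monomials of degree at
    most 2 k n. *)
Lemma W_monomial_bound x (X e : R) N k :
  (forall a, (size a <= N)%N -> `|monomial a x| * X <= e) -> (2 * (k * n) <= N)%N ->
  W x ^+ k * X <= 2 ^+ (k * n) * e.
Proof.
move=> H; rewrite W_exp_prod -size_flatten_nseq; move: (flatten _) => L.
suff G a : (size a + 2 * size L <= N)%N ->
    \prod_(i <- L) (1 + x ord0 i ^+ 2) * (`|monomial a x| * X) <= 2 ^+ size L * e.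
  by move=> LN; have := G [::]; rewrite add0n /monomial big_nil normr1 mul1r; apply.
elim: L a => [|i L IH] a /=.
  by rewrite addn0 big_nil expr0 !mul1r; exact: H.
move=> aN; rewrite big_cons -mulrA mulrDl mul1r.
have -> : 2 ^+ (size L).+1 * e = 2 ^+ size L * e + 2 ^+ size L * e by rewrite exprS; ring.
apply: lerD; first by apply: IH; apply: leq_trans aN; rewrite leq_add2l mulnS leq_addl.
have E : monomial [:: i, i & a] x = x ord0 i ^+ 2 * monomial a x.
  by rewrite /monomial !big_cons mulrA expr2.
have := IH [:: i, i & a]; rewrite E normrM ger0_norm ?sqr_ge0// => /(_ _).
rewrite -mulrA mulrCA; apply; apply: leq_trans aN.
by rewrite /= mulnS addnA addn2.
Qed.

Definition rs_le N e f := forall a b, (size a <= N)%N -> (size b <= N)%N ->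
  forall x, `|monomial a x| * `|partials b f x| <= e.

Lemma rs_le_ge0 N e f : rs_le N e f -> 0 <= e.
Proof. by move=> /(_ [::] [::] isT isT 0); apply: le_trans; rewrite mulr_ge0. Qed.

Lemma rs_le_sub N M e f : (N <= M)%N -> rs_le M e f -> rs_le N e f.
Proof. by move=> NM H a b aN bN; apply: H; exact: leq_trans NM. Qed.

(** In the [foldr] encoding the last letter is the derivative taken first, so a derivative of [f]
    itself is absorbed at the end of the word. *)
Lemma partials_rcons b j f : partials (rcons b j) f = partials b ('D_(e_ j) f).
Proof. by rewrite /partials foldr_rcons. Qed.

Lemma rs_le_derive N e f j : rs_le N.+1 e f -> rs_le N e ('D_(e_ j) f).
Proof.
move=> H a b aN bN x; rewrite -partials_rcons; apply: H; first exact: leqW.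
by rewrite size_rcons.
Qed.

Lemma smooth_derive f j : smooth f -> smooth ('D_(e_ j) f).
Proof. by move=> sf b; rewrite -partials_rcons; exact: sf. Qed.

Lemma smooth_is_derive f j x : smooth f -> is_derive x (e_ j) f ('D_(e_ j) f x).
Proof. by move=> sf; apply: DeriveDef => //; exact: (sf [::]).2. Qed.

Lemma rs_le_W N e f b k : rs_le N e f -> (2 * (k * n) <= N)%N -> (size b <= N)%N ->
  forall x, `|partials b f x| <= 2 ^+ (k * n) * e * (W x ^+ k)^-1.
Proof.
move=> H kN bN x; rewrite ler_pdivlMr ?exprn_gt0 ?W_gt0// mulrC.
by apply: (W_monomial_bound _ kN) => a aN; exact: H.
Qed.

End seminorms.

Section gauss_poly.
Context (R : realType) (n : nat).
Implicit Types (f g : 'rV[R]_n -> R) (x y t xi : 'rV[R]_n).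
Local Notation e_ j := (delta_mx ord0 j : 'rV[R]_n).

(** A class of windows closed under differentiation: integration by parts puts derivatives on the
    window, so [phi_0] alone would not support the induction. *)
Definition gauss_poly g := exists2 P, poly_fun P & g = fun x => gs 1 x * P x.

Lemma gauss_poly_continuous g : gauss_poly g -> continuous g.
Proof.
move=> [P pP ->] x; apply: continuousM; last exact: poly_continuous.
apply: (@continuous_comp _ _ _ _ expR); last exact: continuous_expR.
by apply: (@poly_continuous R n); apply: poly_mul; [exact: poly_cst|exact: dotrv_sq_poly].
Qed.

Lemma gauss_poly_measurable g : gauss_poly g -> measurable_fun setT g.
Proof. by move=> /gauss_poly_continuous; exact: continuous_measurable_rV. Qed.

Lemma gauss_poly_derive g j : gauss_poly g ->
  exists2 g', gauss_poly g' & forall x, is_derive x (e_ j) g (g' x).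
Proof.
move=> [P pP ->]; have [P' [pP' dP]] := poly_derive j pP.
exists (fun x => gs 1 x * (P' x + - (2 * pi * 1) * (x ord0 j * P x))).
  exists (fun x => P' x + - (2 * pi * 1) * (x ord0 j * P x)) => //.
  apply: poly_add => //; apply: poly_mul; first exact: poly_cst.
  by apply: poly_mul => //; exact: poly_coord.
move=> x; apply: is_derive_eq (is_deriveM (is_derive_gs 1 x j) (dP x)) _.
by rewrite /GRing.scale /=; ring.
Qed.

Lemma gauss_poly_W g k : gauss_poly g ->
  exists2 C, 0 <= C & forall x, `|g x| <= C * (W x ^+ k)^-1.
Proof.
move=> [P pP ->]; have [C C0 H] := poly_gs_W k (@ltr01 R) pP; exists C => // x.
by rewrite normrM (ger0_norm (gs_ge0 _ _)).
Qed.

Lemma gauss_poly_g0 : gauss_poly (@g0 R n).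
Proof.
exists (fun _ => k0 R n); first exact: poly_cst.
by apply/funext => x; rewrite /g0 mulrC.
Qed.

Lemma is_derive_translate g dg x y j : is_derive (x - y) (e_ j) g dg ->
  is_derive x (e_ j) (fun t => g (t - y)) dg.
Proof.
move=> [dx <-].
have E : (fun h : R => h^-1 *: (g (h *: e_ j + x - y) - g (x - y))) =
    (fun h : R => h^-1 *: (g (h *: e_ j + (x - y)) - g (x - y))).
  by apply/funext => h; rewrite addrA.
apply: DeriveDef; first by move: dx; rewrite /derivable /= -E.
rewrite /derive; set g1 := fun h => h^-1 *: _; set g2 := fun h => h^-1 *: _.
by have -> : g1 = g2 by exact: E.
Qed.

End gauss_poly.

(** * Decay in position and frequency *)

Section decay.
Context (R : realType) (n : nat).
Local Notation mu := (lebesgue_rV R n).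
Local Notation intg f := (mu.-integrable setT (EFin \o f)).
Local Notation I f := (Rintegral mu setT f).
Implicit Types (f g : 'rV[R]_n -> R) (x y t xi : 'rV[R]_n).
Local Notation e_ j := (delta_mx ord0 j : 'rV[R]_n).

(** For real [f] and [g] this is the real part of e^(- i th) V_g f(y, xi). *)
Definition FT f g y xi (th : R) := I (fun t => f t * g (t - y) * cos (2 * pi * dotrv xi t + th)).

Lemma measurable_FT_arg f g y xi th : smooth f -> gauss_poly g ->
  measurable_fun setT (fun t => f t * g (t - y) * cos (2 * pi * dotrv xi t + th)).
Proof.
move=> sf pg; apply: measurable_funM.
  apply: measurable_funM; first by apply: continuous_measurable_rV; exact: (sf [::]).1.
  by apply: (measurableT_comp (gauss_poly_measurable pg)); exact: measurable_subrV.
apply: measurable_cosf; apply: measurable_funD => //; apply: measurable_funM => //.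
exact: measurable_dotrv.
Qed.

(** By [W_add], W(y) is at most 2^n W(t) W(t - y). Of the k + 1 powers of decay of [f], k are
    combined with those of the window to produce decay in [y]; the last one is kept for
    integrability in [t]. *)
Lemma FT_arg_le f g y xi th N e k Cg : rs_le N e f -> (2 * (k.+1 * n) <= N)%N ->
  0 <= Cg -> (forall s, `|g s| <= Cg * (W s ^+ k)^-1) ->
  forall t, `|f t * g (t - y) * cos (2 * pi * dotrv xi t + th)| <=
    (2 ^+ n) ^+ k * (2 ^+ (k.+1 * n) * e * Cg) * (W y ^+ k)^-1 * (W t)^-1.
Proof.
move=> fN kN Cg0 gC t.
have e0 := rs_le_ge0 fN.
have f1 : `|f t| <= 2 ^+ (k.+1 * n) * e * (W t ^+ k.+1)^-1 by exact: (rs_le_W (b := [::]) fN).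
have Wp z j : 0 < W z ^+ j :> R by rewrite exprn_gt0// W_gt0.
have K0 : 0 <= 2 ^+ (k.+1 * n) * e by rewrite mulr_ge0// exprn_ge0.
rewrite normrM; apply: (le_trans (ler_piMr (normr_ge0 _) (cos_abs _))).
rewrite normrM; apply: (le_trans (ler_pM (normr_ge0 _) (normr_ge0 _) f1 (gC _))).
have Wy : W y ^+ k <= (2 ^+ n) ^+ k * (W t ^+ k * W (t - y) ^+ k).
  rewrite -!exprMn; apply: lerXn2r; rewrite ?nnegrE ?mulr_ge0 ?exprn_ge0 ?W_ge0//.
  by have := W_add t (- (t - y)); rewrite opprB addrC subrK -opprB WN.
rewrite exprS invfM.
have -> : 2 ^+ (k.+1 * n) * e * ((W t)^-1 * (W t ^+ k)^-1) * (Cg * (W (t - y) ^+ k)^-1) =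
    2 ^+ (k.+1 * n) * e * Cg * ((W t ^+ k)^-1 * (W (t - y) ^+ k)^-1) * (W t)^-1 by ring.
apply: ler_wpM2r; first by rewrite invr_ge0 ltW// W_gt0.
have -> : (2 ^+ n) ^+ k * (2 ^+ (k.+1 * n) * e * Cg) * (W y ^+ k)^-1 =
    2 ^+ (k.+1 * n) * e * Cg * ((2 ^+ n) ^+ k * (W y ^+ k)^-1) by ring.
apply: ler_wpM2l; first exact: mulr_ge0.
rewrite -invfM ler_pdivlMr// mulrC ler_pdivrMr; first exact: Wy.
by rewrite mulr_gt0.
Qed.

(** Each factor xi_j is traded for a derivative on [f] or on the window and a quarter-period shift
    of the phase. The inequality on [N] is strict because the differentiated [f] must still have the
    2 n orders that give integrability. *)
Lemma FT_ibp f g g' y xi th j N e : smooth f -> gauss_poly g -> gauss_poly g' ->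
  (forall x, is_derive x (e_ j) g (g' x)) -> rs_le N e f -> (2 * n < N)%N ->
  2 * pi * (xi ord0 j * FT f g y xi th) =
  - (FT ('D_(e_ j) f) g y xi (th - pi / 2) + FT f g' y xi (th - pi / 2)).
Proof.
move=> sf pg pg' dg fN nN.
have sf' := smooth_derive j sf.
have [Cg Cg0 gC] := gauss_poly_W 0 pg.
have [Cg' Cg'0 gC'] := gauss_poly_W 0 pg'.
have fN' : rs_le N.-1 e ('D_(e_ j) f) by apply: rs_le_derive; rewrite prednK//; exact: leq_ltn_trans nN.
have nN1 : (2 * (1 * n) <= N)%N by rewrite mul1n ltnW.
have nN2 : (2 * (1 * n) <= N.-1)%N by rewrite mul1n -ltnS prednK//; exact: leq_ltn_trans nN.
have sinE t : sin (2 * pi * dotrv xi t + th) = cos (2 * pi * dotrv xi t + (th - pi / 2)).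
  by rewrite addrA -cosBpihalf.
pose A := fun t => f t * g (t - y) * cos (2 * pi * dotrv xi t + th).
pose B1 := fun t => 'D_(e_ j) f t * g (t - y) * cos (2 * pi * dotrv xi t + (th - pi / 2)).
pose B2 := fun t => f t * g' (t - y) * cos (2 * pi * dotrv xi t + (th - pi / 2)).
pose F := fun t => f t * g (t - y) * cos (2 * pi * dotrv xi t + (th - pi / 2)).
pose F' := fun t => B1 t + B2 t + 2 * pi * xi ord0 j * A t.
have dF t : is_derive t (e_ j) F (F' t).
  have H1 := is_deriveM (smooth_is_derive j t sf) (is_derive_translate (dg (t - y))).
  have H2 := is_deriveD (is_deriveM (is_derive_cst (2 * pi : R) t (e_ j)) (is_derive_dotl t xi j)) (is_derive_cst th t (e_ j)).
  have H3 := is_deriveM H1 (is_derive_chain H2 (is_derive_sin _)).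
  have FE : F = (fun t => f t * g (t - y) * sin (2 * pi * dotrv t xi + th)).
    by apply/funext => s; rewrite /F -sinE dotrvC.
  rewrite FE; apply: is_derive_eq H3 _.
  rewrite /F' /B1 /B2 /A -sinE (dotrvC xi t) /GRing.scale /= /GRing.scale /=.
  have alg (a b a' b' c w q u v : R) : a * b * (c * (q * u + v * 0 + 0)) + w * (a * b' + b * a') =
    a' * b * w + a * b' * w + q * u * (a * b * c) by ring.
  exact: alg.
have le1 := FT_arg_le y xi th fN nN1 Cg0 gC.
have le2 := FT_arg_le y xi (th - pi / 2) fN' nN2 Cg0 gC.
have le3 := FT_arg_le y xi (th - pi / 2) fN nN1 Cg'0 gC'.
have le4 := FT_arg_le y xi (th - pi / 2) fN nN1 Cg0 gC.
have e0 := rs_le_ge0 fN.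
move: le1 le2 le3 le4.
set c1 := ((_ * _) * (W y ^+ 0)^-1 : R); set c3 := ((_ * (_ * _ * Cg')) * (W y ^+ 0)^-1 : R) => le1 le2 le3 le4.
have c10 : 0 <= c1 by rewrite /c1 !expr0 invr1 mulr1 mul1r; apply: mulr_ge0 => //; apply: mulr_ge0 => //; exact: exprn_ge0.
have c30 : 0 <= c3 by rewrite /c3 !expr0 invr1 mulr1 mul1r; apply: mulr_ge0 => //; apply: mulr_ge0 => //; exact: exprn_ge0.
have iW (c : R) := intgZ c (intg_invW R n).
have m1 := measurable_FT_arg y xi th sf pg.
have m2 := measurable_FT_arg y xi (th - pi / 2) sf' pg.
have m3 := measurable_FT_arg y xi (th - pi / 2) sf pg'.
have m4 := measurable_FT_arg y xi (th - pi / 2) sf pg.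
have i1 := intg_dom m1 le1 (iW c1).
have i2 := intg_dom m2 le2 (iW c1).
have i3 := intg_dom m3 le3 (iW c3).
pose K : R := `|2 * pi * xi ord0 j|.
pose CC := c1 + c3 + K * c1 + c1.
have W0 t : 0 <= (W t)^-1 by rewrite invr_ge0 W_ge0.
have K0 : 0 <= K * c1 by apply: mulr_ge0; [exact: normr_ge0|exact: c10].
have [|||E iF'] := @Rint_derive0 R n F F' _ CC dF.
- exact: m4.
- move=> t; apply: (le_trans (le4 t)); apply: ler_wpM2r => //.
  by rewrite /CC lerDr !addr_ge0.
- move=> t; apply: (@le_trans _ _ ((c1 + c3 + K * c1) * (W t)^-1)); last first.
    by apply: ler_wpM2r => //; rewrite /CC lerDl.
  have -> : (c1 + c3 + K * c1) * (W t)^-1 = c1 * (W t)^-1 + c3 * (W t)^-1 + K * (c1 * (W t)^-1).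
    by rewrite !mulrDl mulrA.
  apply: (le_trans (ler_normD _ _)); apply: lerD.
    by apply: (le_trans (ler_normD _ _)); apply: lerD; [exact: le2|exact: le3].
  by rewrite normrM; apply: ler_wpM2l; [exact: normr_ge0|exact: le1].
move: E; rewrite /F' RintegralD//; last 2 first.
- exact: intgD.
- exact: intgZ.
rewrite RintegralD// RintegralZl// => /eqP; rewrite addrC addr_eq0 => /eqP <-.
by rewrite mulrA.
Qed.

(** Induction on the frequency monomial. The window is generalised and [f] is quantified inside the
    conclusion, since [FT_ibp] replaces either of them by its derivative. *)
Lemma FT_decay b g k : gauss_poly g -> exists C N, 0 <= C /\
  forall f e, smooth f -> rs_le N e f -> forall y xi th,
    `|monomial b xi| * (W y ^+ k * `|FT f g y xi th|) <= C * e.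
Proof.
elim: b g => [|j b IH] g pg.
  have [Cg Cg0 gC] := gauss_poly_W k pg.
  pose IW := I (fun t => (W t)^-1).
  have IW0 : 0 <= IW by apply: Rintegral_ge0 => t _; rewrite invr_ge0 W_ge0.
  exists ((2 ^+ n) ^+ k * (2 ^+ (k.+1 * n) * Cg) * IW), (2 * (k.+1 * n))%N; split.
    by rewrite !mulr_ge0// !exprn_ge0.
  move=> f e sf fN y xi th.
  rewrite /monomial big_nil normr1 mul1r mulrC -ler_pdivlMr ?exprn_gt0 ?W_gt0//.
  have le1 := FT_arg_le y xi th fN (leqnn _) Cg0 gC.
  apply: (le_trans (Rint_le_dom (measurable_FT_arg y xi th sf pg) le1 (intgZ _ (intg_invW R n)))).
  rewrite RintegralZl//; last exact: intg_invW.
  by rewrite -/IW le_eqVlt; apply/orP; left; apply/eqP; ring.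
have [g' pg' dg] := gauss_poly_derive j pg.
have [C1 [N1 [C10 H1]]] := IH g pg.
have [C2 [N2 [C20 H2]]] := IH g' pg'.
have p0 : 0 < 2 * pi :> R by rewrite mulr_gt0// pi_gt0.
(* [N1.+1] pays for the derivative on [f]; [(2 * n).+1] is the strict bound demanded by [FT_ibp]. *)
exists ((2 * pi)^-1 * (C1 + C2)), (maxn (maxn N1.+1 N2) (2 * n).+1); split.
  by rewrite mulr_ge0 ?addr_ge0// invr_ge0 ltW.
move=> f e sf fN y xi th.
have fN1 : rs_le N1 e ('D_(e_ j) f).
  by apply: rs_le_derive; apply: rs_le_sub fN; rewrite !leq_max leqnn.
have fN2 : rs_le N2 e f by apply: rs_le_sub fN; rewrite !leq_max leqnn !orbT.
have nN : (2 * n < maxn (maxn N1.+1 N2) (2 * n).+1)%N by rewrite leq_max leqnn orbT.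
have E := FT_ibp y xi th sf pg pg' dg fN nN.
have E' : `|xi ord0 j| * `|FT f g y xi th| <= (2 * pi)^-1 *
    (`|FT ('D_(e_ j) f) g y xi (th - pi / 2)| + `|FT f g' y xi (th - pi / 2)|).
  rewrite ler_pdivlMl// -normrM -[2 * pi]gtr0_norm// -normrM E normrN.
  exact: ler_normD.
rewrite /monomial big_cons -/(monomial b xi) normrM.
have Wk : 0 <= W y ^+ k by rewrite exprn_ge0 ?W_ge0.
have -> : `|xi ord0 j| * `|monomial b xi| * (W y ^+ k * `|FT f g y xi th|) =
    `|monomial b xi| * (W y ^+ k * (`|xi ord0 j| * `|FT f g y xi th|)) by ring.
apply: (@le_trans _ _ (`|monomial b xi| * (W y ^+ k * ((2 * pi)^-1 *
    (`|FT ('D_(e_ j) f) g y xi (th - pi / 2)| + `|FT f g' y xi (th - pi / 2)|))))).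
  by apply: ler_wpM2l => //; apply: ler_wpM2l.
have alg (m w c u v : R) : m * (w * (c * (u + v))) = c * (m * (w * u) + m * (w * v)) by ring.
rewrite alg -[leRHS]mulrA; apply: ler_wpM2l; first by rewrite invr_ge0 ltW.
rewrite [leRHS]mulrDl; apply: lerD; first exact: H1 (smooth_derive j sf) fN1 _ _ _.
exact: H2.
Qed.

Lemma FT_decay_W g k l : gauss_poly g -> exists C N, 0 <= C /\
  forall f e, smooth f -> rs_le N e f -> forall y xi th,
    `|FT f g y xi th| <= C * e * ((W y ^+ k)^-1 * (W xi ^+ l)^-1).
Proof.
move=> pg; pose M := (2 * (l * n))%N.
have [C [N [C0 H]]] : exists C N, 0 <= C /\ forall b, (size b <= M)%N ->
  forall f e, smooth f -> rs_le N e f -> forall y xi th,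
    `|monomial b xi| * (W y ^+ k * `|FT f g y xi th|) <= C * e.
  have mono b (C C' : R) (N N' : nat) : C <= C' -> (N <= N')%N ->
      (forall f e, smooth f -> rs_le N e f -> forall y xi th,
        `|monomial b xi| * (W y ^+ k * `|FT f g y xi th|) <= C * e) ->
      forall f e, smooth f -> rs_le N' e f -> forall y xi th,
        `|monomial b xi| * (W y ^+ k * `|FT f g y xi th|) <= C' * e.
    move=> CC NN H f e sf fN y xi th.
    apply: (le_trans (H f e sf (rs_le_sub NN fN) y xi th)).
    by apply: ler_wpM2r => //; exact: rs_le_ge0 fN.
  exact: (words_uniform mono (fun b => FT_decay b k pg)).
exists (2 ^+ (l * n) * C), N; split; first by rewrite mulr_ge0// exprn_ge0.
move=> f e sf fN y xi th.
have := @W_monomial_bound R n xi (W y ^+ k * `|FT f g y xi th|) (C * e) M l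
  (fun a aM => H a aM f e sf fN y xi th) (leqnn _).
rewrite -invfM ler_pdivlMr; last by rewrite mulr_gt0// exprn_gt0 ?W_gt0.
have alg (a b c : R) : c * (a * b) = b * (a * c) by ring.
by rewrite alg -[_ * C * e]mulrA.
Qed.

End decay.

(** * Regularity of coherent states *)

Section lipschitz.
Context (R : realType) (n : nat).
Local Notation e_ j := (delta_mx ord0 j : 'rV[R]_n).
Implicit Types (x y : 'rV[R]_n).

Definition l1 x : R := \sum_i `|x ord0 i|.

Lemma l1_ge0 x : 0 <= l1 x. Proof. exact: sumr_ge0. Qed.

(** The segment from [y] to [x] is replaced by a path parallel to the axes, with the mean value
    theorem on each piece; this is why the distance is the l^1 one. *)
Lemma lipschitz_rV (F : 'rV[R]_n -> R) (F' : 'I_n -> 'rV[R]_n -> R) (L : R) :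
  (forall j x, is_derive x (e_ j) F (F' j x)) -> (forall j x, `|F' j x| <= L) ->
  forall x y, `|F x - F y| <= L * l1 (x - y).
Proof.
move=> dF F'L x y.
have H (s : seq 'I_n) (c : 'I_n -> R) : `|F (\sum_(j <- s) c j *: e_ j + y) - F y| <= L * \sum_(j <- s) `|c j|.
  elim: s => [|j s IH]; first by rewrite !big_nil add0r subrr normr0 mulr0.
  rewrite !big_cons mulrDr -addrA.
  set z := \sum_(_ <- s) _ + y in IH *.
  rewrite -(subrKA (F z)); apply: (le_trans (ler_normD _ _)); apply: lerD; last exact: IH.
  have [t [_ ->]] := mvt_coord z (c j) (dF j).
  by rewrite normrM mulrC; apply: ler_wpM2r.
have := H (index_enum _) (fun j => (x - y) ord0 j).
rewrite (_ : \sum_j _ = x - y); first by rewrite subrK.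
by rewrite [RHS]row_sum_delta.
Qed.

Lemma cos_lip (a b : R) : `|cos a - cos b| <= `|a - b|.
Proof.
wlog ab : a b / a <= b.
  move=> H; have [|/ltW] := leP a b; first exact: H.
  by move=> /H; rewrite distrC [leRHS]distrC.
have cc : {within `[a, b], continuous (@cos R)} by apply: continuous_subspaceT; exact: continuous_cos.
have [t _ E] := MVT_segment ab (fun (x : R) _ => is_derive_cos x) cc.
by rewrite distrC E normrM normrN [leRHS]distrC ler_piMl// sin_abs.
Qed.

Lemma l1_dot x y : `|dotrv x y| <= l1 x * W y.
Proof.
rewrite /dotrv (le_trans (ler_norm_sum _ _ _))// /l1 mulr_suml; apply: ler_sum => i _.
by rewrite normrM; apply: ler_wpM2l => //; exact: W_ge_coord.
Qed.

End lipschitz.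

Section coherent_class.
Context (R : realType) (n : nat).
Local Notation e_ j := (delta_mx ord0 j : 'rV[R]_n).
Local Notation phase := ('rV[R]_n * 'rV[R]_n)%type.
Implicit Types (x y : 'rV[R]_n) (z : phase).

Definition wt z : R := W z.1 * W z.2.

Lemma wt_ge1 z : 1 <= wt z. Proof. by rewrite mulr_ege1// W_ge1. Qed.
Lemma wt_gt0 z : 0 < wt z. Proof. exact: lt_le_trans (wt_ge1 z). Qed.
Lemma wt_ge0 z : 0 <= wt z. Proof. exact: ltW (wt_gt0 z). Qed.

Lemma wt_W1 z : W z.1 <= wt z.
Proof. by rewrite /wt ler_peMr ?W_ge0 ?W_ge1. Qed.

Lemma wt_W2 z : W z.2 <= wt z.
Proof. by rewrite /wt ler_peMl ?W_ge0 ?W_ge1. Qed.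

Lemma wt_exp_le z k l : (k <= l)%N -> wt z ^+ k <= wt z ^+ l.
Proof. by move=> kl; rewrite ler_weXn2l// wt_ge1. Qed.

Definition pdist z z' : R := l1 (z.1 - z'.1) + l1 (z.2 - z'.2).

Lemma pdist_ge0 z z' : 0 <= pdist z z'.
Proof. by rewrite addr_ge0// l1_ge0. Qed.

(* Functions of (z, x) spanned by z^k * g(x - z_1) * cos(2 pi z_2 . x + th);
   they contain all x^a d_x^b of the real and imaginary parts of coherent z. *)
Inductive coh_fun : (phase -> 'rV[R]_n -> R) -> Prop :=
| coh_base g th : gauss_poly g -> coh_fun (fun z x => g (x - z.1) * cos (2 * pi * dotrv z.2 x + th))
| coh_add f g : coh_fun f -> coh_fun g -> coh_fun (fun z x => f z x + g z x)
| coh_scale (c : R) f : coh_fun f -> coh_fun (fun z x => c * f z x)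
| coh_mul1 j f : coh_fun f -> coh_fun (fun z x => z.1 ord0 j * f z x)
| coh_mul2 j f : coh_fun f -> coh_fun (fun z x => z.2 ord0 j * f z x).

Lemma coh_derive f j : coh_fun f -> exists2 f', coh_fun f' &
  forall z x, is_derive x (e_ j) (f z) (f' z x).
Proof.
elim=> [g th pg|f1 g1 _ [f' cf df] _ [g' cg dg]|c f1 _ [f' cf df]|i f1 _ [f' cf df]|i f1 _ [f' cf df]].
- have [g' pg' dg] := gauss_poly_derive j pg.
  exists (fun z x => g' (x - z.1) * cos (2 * pi * dotrv z.2 x + th) +
     2 * pi * (z.2 ord0 j * (g (x - z.1) * cos (2 * pi * dotrv z.2 x + (th + pi / 2))))).
    by apply: coh_add; [exact: coh_base|apply/coh_scale/coh_mul2; exact: coh_base].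
  move=> z x.
  have H2 := is_deriveD (is_deriveM (is_derive_cst (2 * pi : R) x (e_ j)) (is_derive_dotl x z.2 j)) (is_derive_cst th x (e_ j)).
  have H3 := is_deriveM (is_derive_translate (dg (x - z.1))) (is_derive_chain H2 (is_derive_cos _)).
  rewrite (_ : (fun x => _) = (fun x => g (x - z.1) * cos (2 * pi * dotrv x z.2 + th))); last first.
    by apply/funext => y; rewrite dotrvC.
  apply: is_derive_eq H3 _.
  rewrite addrA cosDpihalf (dotrvC z.2).
  have alg (a b a' c w q u v : R) : a * (- w * (q * u + v * 0 + 0)) + c * a' = a' * c + q * (u * (a * - w)) by ring.
  exact: alg.
- exists (fun z x => f' z x + g' z x); first exact: coh_add.
  by move=> z x; exact: is_deriveD.
- exists (fun z x => c * f' z x); first exact: coh_scale.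
  by move=> z x; apply: is_derive_eq (is_deriveM (is_derive_cst c x (e_ j)) (df z x)) _; rewrite scaler0 addr0.
- exists (fun z x => z.1 ord0 i * f' z x); first exact: coh_mul1.
  by move=> z x; apply: is_derive_eq (is_deriveM (is_derive_cst (z.1 ord0 i) x (e_ j)) (df z x)) _; rewrite scaler0 addr0.
- exists (fun z x => z.2 ord0 i * f' z x); first exact: coh_mul2.
  by move=> z x; apply: is_derive_eq (is_deriveM (is_derive_cst (z.2 ord0 i) x (e_ j)) (df z x)) _; rewrite scaler0 addr0.
Qed.

Lemma coh_funE f g : coh_fun f -> (forall z x, f z x = g z x) -> coh_fun g.
Proof. by move=> cf fg; rewrite (_ : g = f)//; apply/funext => z; apply/funext => x. Qed.

(** Split x_i = (x - z_1)_i + (z_1)_i: the first summand is absorbed into the polynomial of the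
    window, the second is a multiplication by a coordinate of z. *)
Lemma coh_mulx f i : coh_fun f -> coh_fun (fun z x => x ord0 i * f z x).
Proof.
elim=> [g th pg|f1 g1 _ IH1 _ IH2|c f1 _ IH|j f1 _ IH|j f1 _ IH].
- have pg2 : gauss_poly (fun x => x ord0 i * g x).
    case: pg => P pP ->; exists (fun x => x ord0 i * P x).
      by apply: poly_mul => //; exact: poly_coord.
    by apply/funext => x; ring.
  apply: coh_funE (coh_add (coh_base th pg2) (coh_mul1 i (coh_base th pg))) _ => z x.
  by rewrite !mxE; ring.
- by apply: coh_funE (coh_add IH1 IH2) _ => z x; ring.
- by apply: coh_funE (coh_scale c IH) _ => z x; ring.
- by apply: coh_funE (coh_mul1 j IH) _ => z x; ring.
- by apply: coh_funE (coh_mul2 j IH) _ => z x; ring.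
Qed.

Lemma coh_monomial a f : coh_fun f -> coh_fun (fun z x => monomial a x * f z x).
Proof.
move=> cf; elim: a => [|i a IH].
  by apply: coh_funE cf _ => z x; rewrite /monomial big_nil mul1r.
by apply: coh_funE (coh_mulx i IH) _ => z x; rewrite /monomial big_cons mulrA.
Qed.

Lemma coh_partials b f : coh_fun f -> coh_fun (fun z => partials b (f z)).
Proof.
move=> cf; elim: b => [//|i b IH] /=.
have [f' cf' df] := coh_derive i IH.
by apply: coh_funE cf' _ => z x; rewrite (@derive_val _ _ _ _ _ _ _ (df z x)).
Qed.

Lemma coh_growth f : coh_fun f -> exists C M, 0 <= C /\
  forall z x, `|f z x| <= C * wt z ^+ M.
Proof.
elim=> [g th pg|f1 g1 _ [C1 [M1 [C10 H1]]] _ [C2 [M2 [C20 H2]]]|c f1 _ [C [M [C0 H]]]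
  |j f1 _ [C [M [C0 H]]]|j f1 _ [C [M [C0 H]]]].
- have [C C0 H] := gauss_poly_W 0 pg; exists C, 0%N; split => // z x.
  rewrite normrM; apply: (le_trans (ler_piMr (normr_ge0 _) (cos_abs _))).
  by have := H (x - z.1); rewrite !expr0 invr1.
- exists (C1 + C2), (maxn M1 M2); split; first exact: addr_ge0.
  move=> z x; apply: (le_trans (ler_normD _ _)); rewrite [leRHS]mulrDl; apply: lerD.
    apply: (le_trans (H1 z x)); apply: ler_wpM2l => //; apply: wt_exp_le; exact: leq_maxl.
  apply: (le_trans (H2 z x)); apply: ler_wpM2l => //; apply: wt_exp_le; exact: leq_maxr.
- exists (`|c| * C), M; split; first exact: mulr_ge0.
  by move=> z x; rewrite normrM -mulrA; apply: ler_wpM2l.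
- exists C, M.+1; split => // z x; rewrite normrM exprS mulrCA; apply: ler_pM => //.
  exact: le_trans (W_ge_coord _ _) (wt_W1 z).
- exists C, M.+1; split => // z x; rewrite normrM exprS mulrCA; apply: ler_pM => //.
  exact: le_trans (W_ge_coord _ _) (wt_W2 z).
Qed.

(** The base case is the only analytic one. Moving z_1 translates a Lipschitz window; moving z_2
    changes the phase by an amount proportional to x, which the Gaussian decay of the window must
    compensate to keep the estimate uniform in x. *)
Lemma coh_lipschitz f : coh_fun f -> exists C M, 0 <= C /\
  forall z z' x, `|f z x - f z' x| <= C * pdist z z' * (wt z * wt z') ^+ M.
Proof.
have ww1 z z' : 1 <= wt z * wt z' by rewrite mulr_ege1// wt_ge1.
have ww0 z z' M : 0 <= (wt z * wt z') ^+ M by rewrite exprn_ge0// mulr_ge0// wt_ge0.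
have wwle z z' k l : (k <= l)%N -> (wt z * wt z') ^+ k <= (wt z * wt z') ^+ l.
  by move=> kl; rewrite ler_weXn2l.
(* The product rule for a coordinate factor: it costs one power of the weight and calls on
   [coh_growth] for the undifferenced function. *)
have step (cz : phase -> R) f1 C M (cf : coh_fun f1) : 0 <= C ->
    (forall z, `|cz z| <= wt z) -> (forall z z', `|cz z - cz z'| <= pdist z z') ->
    (forall z z' x, `|f1 z x - f1 z' x| <= C * pdist z z' * (wt z * wt z') ^+ M) ->
    exists C M, 0 <= C /\ forall z z' x, `|cz z * f1 z x - cz z' * f1 z' x| <= C * pdist z z' * (wt z * wt z') ^+ M.
  move=> C0 c1 c2 H; have [C' [M' [C'0 H']]] := coh_growth cf.
  exists (C + C'), (maxn M.+1 M'); split; first exact: addr_ge0.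
  move=> z z' x.
  have -> : cz z * f1 z x - cz z' * f1 z' x = cz z * (f1 z x - f1 z' x) + (cz z - cz z') * f1 z' x by ring.
  have d0 := pdist_ge0 z z'.
  have wz : wt z <= wt z * wt z' by rewrite ler_peMr ?wt_ge0 ?wt_ge1.
  have wz' : wt z' <= wt z * wt z' by rewrite ler_peMl ?wt_ge0 ?wt_ge1.
  rewrite (_ : (C + C') * _ * _ = C * pdist z z' * (wt z * wt z') ^+ maxn M.+1 M' + C' * pdist z z' * (wt z * wt z') ^+ maxn M.+1 M'); last by rewrite mulrDl mulrDl.
  apply: (le_trans (ler_normD _ _)); rewrite !normrM; apply: lerD.
    apply: (@le_trans _ _ ((wt z * wt z') * (C * pdist z z' * (wt z * wt z') ^+ M))).
      by apply: ler_pM => //; exact: le_trans wz.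
    rewrite mulrCA -exprS; apply: ler_wpM2l; first exact: mulr_ge0.
    by apply: wwle; exact: leq_maxl.
  apply: (@le_trans _ _ (pdist z z' * (C' * wt z' ^+ M'))); first exact: ler_pM.
  rewrite mulrCA mulrA; apply: ler_wpM2l; first exact: mulr_ge0.
  apply: (@le_trans _ _ ((wt z * wt z') ^+ M')); last by apply: wwle; exact: leq_maxr.
  by apply: lerXn2r => //; rewrite nnegrE; [exact: wt_ge0|rewrite mulr_ge0// wt_ge0].
have coordle x i : `|x ord0 i| <= l1 x.
  by rewrite /l1 (bigD1 i)//= lerDl sumr_ge0.
elim=> [g th pg|f1 g1 _ [C1 [M1 [C10 H1]]] _ [C2 [M2 [C20 H2]]]|c f1 _ [C [M [C0 H]]]
  |j f1 cf [C [M [C0 H]]]|j f1 cf [C [M [C0 H]]]].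
- have /choice[g' Hg'] : forall j, exists g', gauss_poly g' /\ forall x, is_derive x (e_ j) g (g' x).
    by move=> j; have [g' ? ?] := gauss_poly_derive j pg; exists g'.
  have /choice[L HL] : forall j, exists L, 0 <= L /\ forall x, `|g' j x| <= L.
    move=> j; have [L L0 H] := gauss_poly_W 0 (Hg' j).1; exists L; split => // x.
    by have := H x; rewrite !expr0 invr1 mulr1.
  have Lip x y : `|g x - g y| <= (\sum_j L j) * l1 (x - y).
    apply: (lipschitz_rV (fun j x => (Hg' j).2 x)) => j u.
    apply: (le_trans ((HL j).2 u)); rewrite (bigD1 j)//= lerDl.
    by apply: sumr_ge0 => i _; exact: (HL i).1.
  have [K K0 HK] := gauss_poly_W 1 pg.
  pose S : R := \sum_j L j.
  have S0 : 0 <= S by apply: sumr_ge0 => j _; exact: (HL j).1.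
  have p0 : 0 <= 2 * pi :> R by rewrite mulr_ge0// pi_ge0.
  exists (S + 2 * pi * (2 ^+ n * K)), 1%N; split.
    by apply: addr_ge0 => //; apply: mulr_ge0 => //; apply: mulr_ge0 => //; exact: exprn_ge0.
  move=> z z' x; rewrite expr1.
  set ph := 2 * pi * dotrv z.2 x + th; set ph' := 2 * pi * dotrv z'.2 x + th.
  have -> : g (x - z.1) * cos ph - g (x - z'.1) * cos ph' =
     (g (x - z.1) - g (x - z'.1)) * cos ph + g (x - z'.1) * (cos ph - cos ph') by ring.
  rewrite (_ : (S + _) * _ * _ = S * pdist z z' * (wt z * wt z') + 2 * pi * (2 ^+ n * K) * pdist z z' * (wt z * wt z')); last by rewrite [(S + _) * _]mulrDl [LHS]mulrDl.
  have d0 := pdist_ge0 z z'.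
  apply: (le_trans (ler_normD _ _)); rewrite !normrM; apply: lerD.
    apply: (le_trans (ler_piMr (normr_ge0 _) (cos_abs _))).
    apply: (le_trans (Lip _ _)); rewrite -[leLHS]mulr1; apply: ler_pM => //.
      by rewrite mulr_ge0// l1_ge0.
    apply: ler_wpM2l => //; rewrite /pdist.
    rewrite (_ : x - z.1 - (x - z'.1) = - (z.1 - z'.1)); last by apply/rowP => i; rewrite !mxE; ring.
    rewrite (_ : l1 (- _) = l1 (z.1 - z'.1)); last by apply: eq_bigr => i _; rewrite mxE normrN.
    by rewrite lerDl l1_ge0.
  have phd : `|ph - ph'| <= 2 * pi * (pdist z z' * W x).
    have -> : ph - ph' = 2 * pi * dotrv (z.2 - z'.2) x.
      by rewrite /ph /ph' !(dotrvC _ x) dotrvBr; ring.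
    rewrite normrM ger0_norm//; apply: ler_wpM2l => //; apply: (le_trans (l1_dot _ _)).
    by apply: ler_wpM2r; [exact: W_ge0|rewrite lerDr l1_ge0].
  (* Here the unbounded factor W(x) from the phase is absorbed: [W_add] splits it into W(x - z'_1),
     killed by the window, and W(z'_1), charged to the weight. *)
  have Wx : `|g (x - z'.1)| * W x <= 2 ^+ n * K * (wt z * wt z').
    have h1 : W x <= 2 ^+ n * (W (x - z'.1) * W z'.1) by have := W_add (x - z'.1) z'.1; rewrite subrK.
    apply: (le_trans (ler_wpM2l (normr_ge0 _) h1)).
    rewrite mulrCA -mulrA; apply: ler_wpM2l; first exact: exprn_ge0.
    rewrite mulrA; apply: ler_pM; rewrite ?mulr_ge0 ?W_ge0//.
      by have := HK (x - z'.1); rewrite expr1 ler_pdivlMr// W_gt0.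
    apply: (le_trans (wt_W1 z')); by rewrite ler_peMl ?wt_ge0 ?wt_ge1.
  apply: (le_trans (ler_wpM2l (normr_ge0 _) (le_trans (cos_lip _ _) phd))).
  have -> : `|g (x - z'.1)| * (2 * pi * (pdist z z' * W x)) = 2 * pi * pdist z z' * (`|g (x - z'.1)| * W x) by ring.
  have -> : 2 * pi * (2 ^+ n * K) * pdist z z' * (wt z * wt z') = 2 * pi * pdist z z' * (2 ^+ n * K * (wt z * wt z')) by ring.
  by apply: ler_wpM2l => //; exact: mulr_ge0.
- exists (C1 + C2), (maxn M1 M2); split; first exact: addr_ge0.
  move=> z z' x; have d0 := pdist_ge0 z z'.
  rewrite (_ : f1 z x + g1 z x - _ = (f1 z x - f1 z' x) + (g1 z x - g1 z' x)); last by ring.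
  apply: (le_trans (ler_normD _ _)); rewrite (_ : (C1 + C2) * _ * _ = C1 * pdist z z' * (wt z * wt z') ^+ maxn M1 M2 + C2 * pdist z z' * (wt z * wt z') ^+ maxn M1 M2); last by rewrite mulrDl mulrDl.
  apply: lerD.
    apply: (le_trans (H1 z z' x)); apply: ler_wpM2l; first exact: mulr_ge0.
    by apply: wwle; exact: leq_maxl.
  apply: (le_trans (H2 z z' x)); apply: ler_wpM2l; first exact: mulr_ge0.
  by apply: wwle; exact: leq_maxr.
- exists (`|c| * C), M; split; first exact: mulr_ge0.
  move=> z z' x; rewrite -mulrBr normrM.
  have -> : `|c| * C * pdist z z' * (wt z * wt z') ^+ M = `|c| * (C * pdist z z' * (wt z * wt z') ^+ M) by ring.
  by apply: ler_wpM2l.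
- apply: (step (fun z => z.1 ord0 j) f1 C M) => // [z|z z'].
    exact: le_trans (W_ge_coord _ _) (wt_W1 z).
  have := coordle (z.1 - z'.1) j; rewrite !mxE => h; apply: (le_trans h).
  by rewrite lerDl l1_ge0.
- apply: (step (fun z => z.2 ord0 j) f1 C M) => // [z|z z'].
    exact: le_trans (W_ge_coord _ _) (wt_W2 z).
  have := coordle (z.2 - z'.2) j; rewrite !mxE => h; apply: (le_trans h).
  by rewrite lerDr l1_ge0.
Qed.

Definition cohR z x : R := complex.Re (coherent z x).
Definition cohI z x : R := complex.Im (coherent z x).

Lemma cohR_E z x : cohR z x = g0 (x - z.1) * cos (2 * pi * dotrv z.2 x + 0).
Proof. by rewrite /cohR (_ : coherent z x = cis (2 * pi * dotrv z.2 x) * gaussian (x - z.1))// gaussianE /= mulr0 subr0 mulrC addr0. Qed.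

Lemma cohI_E z x : cohI z x = g0 (x - z.1) * cos (2 * pi * dotrv z.2 x + (- (pi / 2))).
Proof. by rewrite /cohI (_ : coherent z x = cis (2 * pi * dotrv z.2 x) * gaussian (x - z.1))// gaussianE /= mulr0 add0r mulrC cosBpihalf. Qed.

Lemma coh_cohR : coh_fun cohR.
Proof.
by apply: coh_funE (coh_base 0 (gauss_poly_g0 R n)) _ => z x; rewrite cohR_E.
Qed.

Lemma coh_cohI : coh_fun cohI.
Proof.
by apply: coh_funE (coh_base (- (pi / 2)) (gauss_poly_g0 R n)) _ => z x; rewrite cohI_E.
Qed.

Lemma coh_seminorm f N : coh_fun f -> exists C M, 0 <= C /\
  forall a b, (size a <= N)%N -> (size b <= N)%N -> forall z z' x,
   `|monomial a x * partials b (f z) x| <= C * wt z ^+ M /\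
   `|monomial a x * partials b (f z) x - monomial a x * partials b (f z') x| <=
      C * pdist z z' * (wt z * wt z') ^+ M.
Proof.
move=> cf.
pose Q b a (C : R) M := forall z z' x,
   `|monomial a x * partials b (f z) x| <= C * wt z ^+ M /\
   `|monomial a x * partials b (f z) x - monomial a x * partials b (f z') x| <=
      C * pdist z z' * (wt z * wt z') ^+ M.
have mono b a (C C' : R) M M' : C <= C' -> (M <= M')%N -> 0 <= C -> Q b a C M -> Q b a C' M'.
  move=> CC MM C0 H z z' x; have [H1 H2] := H z z' x.
  have d0 := pdist_ge0 z z'.
  have ww1 : 1 <= wt z * wt z' by rewrite mulr_ege1// wt_ge1.
  split.
    apply: (le_trans H1); apply: ler_pM => //; first by rewrite exprn_ge0// wt_ge0.
    exact: wt_exp_le.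
  apply: (le_trans H2); apply: ler_pM.
  - exact: mulr_ge0.
  - by apply: exprn_ge0; exact: le_trans ww1.
  - exact: ler_wpM2r.
  - by rewrite ler_weXn2l.
have base b a : exists C M, 0 <= C /\ Q b a C M.
  have cg := coh_monomial a (coh_partials b cf).
  have [C1 [M1 [C10 H1]]] := coh_growth cg.
  have [C2 [M2 [C20 H2]]] := coh_lipschitz cg.
  exists (C1 + C2), (maxn M1 M2); split; first exact: addr_ge0.
  move=> z z' x; have d0 := pdist_ge0 z z'.
  have ww1 : 1 <= wt z * wt z' by rewrite mulr_ege1// wt_ge1.
  split.
    apply: (le_trans (H1 z x)); apply: ler_pM; rewrite ?exprn_ge0 ?wt_ge0 ?lerDl//.
    by apply: wt_exp_le; exact: leq_maxl.
  apply: (le_trans (H2 z z' x)); apply: ler_pM.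
  - exact: mulr_ge0.
  - by apply: exprn_ge0; exact: le_trans ww1.
  - by apply: ler_wpM2r => //; rewrite lerDr.
  - by rewrite ler_weXn2l// leq_maxr.
(* Uniformity is obtained in [a] first, then in [b]. The condition [0 <= C] is carried inside the
   predicate because monotonicity in the exponent relies on it. *)
have W1 b : exists C M, 0 <= C /\ forall a, (size a <= N)%N -> 0 <= C /\ Q b a C M.
  apply: (@words_uniform R n (fun a C M => 0 <= C /\ Q b a C M)).
    by move=> a C C' M M' CC MM [C0 H]; split; [exact: le_trans CC|exact: mono H].
  by move=> a; have [C [M [C0 H]]] := base b a; exists C, M.
have [C [M [C0 H]]] : exists C M, 0 <= C /\ forall b, (size b <= N)%N ->
    0 <= C /\ forall a, (size a <= N)%N -> Q b a C M.
  apply: (@words_uniform R n (fun b C M => 0 <= C /\ forall a, (size a <= N)%N -> Q b a C M)).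
    by move=> b C C' M M' CC MM [C0 H]; split; [exact: le_trans CC|move=> a aN; exact: mono (H a aN)].
  by move=> b; have [C [M [C0 H]]] := W1 b; exists C, M; split => //; split => // a /H[].
exists C, M; split => // a b aN bN z z' x.
exact: (H b bN).2.
Qed.

End coherent_class.

(** * Reconstruction from coherent states *)

Section representation.
Context (R : realType) (n : nat).
Local Notation mu := (lebesgue_rV R n).
Local Notation lphase := (lphase R n).
Local Notation intg m f := (integrable m setT (EFin \o f)).
Local Notation I m f := (Rintegral m setT f).
Local Notation e_ j := (delta_mx ord0 j : 'rV[R]_n).
Local Notation phase := ('rV[R]_n * 'rV[R]_n)%type.
Local Notation g0 := (@g0 R n).
Local Notation kappa := (kappa R n).
Implicit Types (x y t xi : 'rV[R]_n) (z : phase) (f : 'rV[R]_n -> R).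

Lemma intg_invwt : intg lphase (fun z => (wt z)^-1).
Proof.
have W0 (y : 'rV[R]_n) : 0 <= (W y)^-1 by rewrite invr_ge0 W_ge0.
rewrite (_ : (fun z => _) = (fun z => (W z.1)^-1 * (W z.2)^-1)).
  exact: (intg_prod (intg_invW R n) (intg_invW R n) W0 W0).
by apply/funext => z; rewrite invfM.
Qed.

Lemma measurable_wt : measurable_fun setT (@wt R n).
Proof.
apply: measurable_funM; first exact: measurableT_comp (@measurable_W R n) measurable_fst.
exact: measurableT_comp (@measurable_W R n) measurable_snd.
Qed.

(** The integrand has no integrable majorant in [z], so Gaussians in z_1 and z_2 are inserted,
    Fubini gives measurability, and they are divided out again: [gs (-1)] is the reciprocal of
    [gs 1]. *)
Lemma measurable_FT f g th N e : smooth f -> gauss_poly g -> rs_le N e f -> (2 * n <= N)%N ->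
  measurable_fun setT (fun z : phase => FT f g z.1 z.2 th).
Proof.
move=> sf pg fN nN; have [Cg Cg0 gC] := gauss_poly_W 0 pg.
have nN1 : (2 * (1 * n) <= N)%N by rewrite mul1n.
pose G (zt : phase * 'rV[R]_n) := gs 1 zt.1.1 * gs 1 zt.1.2 *
  (f zt.2 * g (zt.2 - zt.1.1) * cos (2 * pi * dotrv zt.1.2 zt.2 + th)).
have m11 : measurable_fun setT (fun zt : phase * 'rV[R]_n => zt.1.1) by exact: measurableT_comp measurable_fst measurable_fst.
have m12 : measurable_fun setT (fun zt : phase * 'rV[R]_n => zt.1.2) by exact: measurableT_comp measurable_snd measurable_fst.
have mf : measurable_fun setT f by apply: continuous_measurable_rV; exact: (sf [::]).1.
have mG : measurable_fun setT G.
  apply: measurable_funM; first by apply: measurable_funM; exact: measurable_gsf.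
  apply: measurable_funM.
    apply: measurable_funM; first exact: measurableT_comp mf measurable_snd.
    by apply: (measurableT_comp (gauss_poly_measurable pg)); exact: measurable_subrV.
  by apply: measurable_cosf; apply: measurable_funD => //; apply: measurable_funM => //; exact: measurable_dotrv.
have ig := intg_gs n (@ltr01 R).
have iA := intg_prod ig ig (@gs_ge0 R n 1) (@gs_ge0 R n 1).
have e0 := rs_le_ge0 fN.
pose K : R := 2 ^+ (1 * n) * e * Cg.
have K0 : 0 <= K by apply: mulr_ge0 => //; apply: mulr_ge0 => //; exact: exprn_ge0.
have iB := intgZ K (intg_invW R n).
have c0 z : 0 <= gs 1 z.1 * gs 1 z.2 :> R by rewrite mulr_ge0// gs_ge0.
have tle z t : `|f t * g (t - z.1) * cos (2 * pi * dotrv z.2 t + th)| <= K * (W t)^-1.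
  by have := FT_arg_le z.1 z.2 th fN nN1 Cg0 gC t; rewrite !expr0 mul1r invr1 mulr1.
have [|||_ _ mE _ _] := @Rint_fubini _ _ _ _ R lphase mu G _ _ mG iA iB.
- exact: c0.
- by move=> t; rewrite mulr_ge0// invr_ge0 W_ge0.
- move=> z t; rewrite /G /= normrM (ger0_norm (c0 z)); apply: ler_wpM2l; [exact: c0|exact: tle].
have -> : (fun z : phase => FT f g z.1 z.2 th) =
    (fun z : phase => gs (-1) z.1 * gs (-1) z.2 * I mu (fun t => G (z, t))).
  apply/funext => z; rewrite /G /= RintegralZl//; last first.
    by apply: (intg_dom _ (tle z) iB); exact: measurable_FT_arg.
  rewrite -/(FT f g z.1 z.2 th) mulrA.
  have E v : gs (-1) v * gs 1 v = 1 :> R by rewrite /gs -expRD mulrN mulNr mulr1 mulNr addrC subrr expR0.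
  by rewrite mulrACA !E mulr1 mul1r.
by apply: measurable_funM => //; apply: measurable_funM; exact: measurable_gsf.
Qed.

Lemma coh_measurable p x : @coh_fun R n p -> measurable_fun setT (fun z => p z x).
Proof.
elim=> [g th pg|f1 g1 _ IH1 _ IH2|c f1 _ IH|j f1 _ IH|j f1 _ IH].
- apply: measurable_funM.
    apply: (measurableT_comp (gauss_poly_measurable pg)); exact: measurable_subrV.
  apply: measurable_cosf; apply: measurable_funD => //; apply: measurable_funM => //.
  exact: measurable_dotrv.
- exact: measurable_funD.
- exact: measurable_funM.
- by apply: measurable_funM => //; apply: measurable_coordf; exact: measurable_fst.
- by apply: measurable_funM => //; apply: measurable_coordf; exact: measurable_snd.
Qed.

Definition rapid (A : phase -> R) := measurable_fun setT A /\
  forall k, exists2 C, 0 <= C & forall z, `|A z| <= C * (wt z ^+ k)^-1.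

Lemma rapidD A B : rapid A -> rapid B -> rapid (fun z => A z + B z).
Proof.
move=> [mA HA] [mB HB]; split; first exact: measurable_funD.
move=> k; have [C1 C10 H1] := HA k; have [C2 C20 H2] := HB k.
exists (C1 + C2); first exact: addr_ge0.
by move=> z; apply: (le_trans (ler_normD _ _)); rewrite [leRHS]mulrDl; exact: lerD.
Qed.

Lemma rapidZ (c : R) A : rapid A -> rapid (fun z => c * A z).
Proof.
move=> [mA HA]; split; first exact: measurable_funM.
move=> k; have [C1 C10 H1] := HA k; exists (`|c| * C1); first exact: mulr_ge0.
by move=> z; rewrite normrM -mulrA; apply: ler_wpM2l.
Qed.

Lemma rapidN A : rapid A -> rapid (fun z => - A z).
Proof. by move=> /(rapidZ (-1)); congr rapid; apply/funext => z; rewrite mulN1r. Qed.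

Lemma rapid_growth A (B : phase -> R) C M : rapid A ->
  (forall z, `|B z| <= C * wt z ^+ M) ->
  exists2 K, 0 <= K & forall z, `|A z * B z| <= K * (wt z)^-1.
Proof.
move=> [mA HA] BC; have [D D0 H] := HA M.+1.
exists (D * `|C|); first exact: mulr_ge0.
move=> z; rewrite normrM.
apply: (@le_trans _ _ (D * (wt z ^+ M.+1)^-1 * (`|C| * wt z ^+ M))).
  apply: ler_pM => //; apply: (le_trans (BC z)); apply: ler_wpM2r; last exact: ler_norm.
  by rewrite exprn_ge0// wt_ge0.
rewrite exprS invfM.
have w0 : wt z ^+ M != 0 by rewrite expf_neq0// gt_eqF// wt_gt0.
have -> : D * ((wt z)^-1 * (wt z ^+ M)^-1) * (`|C| * wt z ^+ M) =
  D * `|C| * (wt z)^-1 * ((wt z ^+ M)^-1 * wt z ^+ M) by ring.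
by rewrite mulVf// mulr1.
Qed.

Lemma rapid_intg A (B : phase -> R) C M : rapid A -> measurable_fun setT B ->
  (forall z, `|B z| <= C * wt z ^+ M) -> intg lphase (fun z => A z * B z).
Proof.
move=> rA mB BC; have [K K0 H] := rapid_growth rA BC.
apply: (intg_dom _ H (intgZ K intg_invwt)); apply: measurable_funM => //; exact: rA.1.
Qed.

Lemma rapid_coh A p x : rapid A -> coh_fun p -> intg lphase (fun z => A z * p z x).
Proof.
move=> rA cp; have [C [M [C0 H]]] := coh_growth cp.
by apply: (rapid_intg rA (coh_measurable x cp)) => z; exact: H.
Qed.

(** Difference quotients of both sides are compared: those under the integral are dominated through
    the mean value theorem and [coh_growth], those of [H] converge by hypothesis. The two summands
    are the two products that make up the real or imaginary part of a complex product. *)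
Lemma derive_under A B p q (H H' : 'rV[R]_n -> R) j p' q' : rapid A -> rapid B ->
  coh_fun p -> coh_fun q -> coh_fun p' -> coh_fun q' ->
  (forall z x, is_derive x (e_ j) (p z) (p' z x)) ->
  (forall z x, is_derive x (e_ j) (q z) (q' z x)) ->
  (forall x, is_derive x (e_ j) H (H' x)) ->
  (forall x, I lphase (fun z => A z * p z x + B z * q z x) = kappa * H x) ->
  forall x, I lphase (fun z => A z * p' z x + B z * q' z x) = kappa * H' x.
Proof.
move=> rA rB cp cq cp' cq' dp dq dH E x.
pose D (F : 'rV[R]_n -> R) k := k.+1%:R * (F (k.+1%:R^-1 *: e_ j + x) - F x).
have DF (F F' : 'rV[R]_n -> R) : (forall x, is_derive x (e_ j) F (F' x)) -> D F k @[k --> \oo] --> F' x.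
  by move=> dF; exact: is_derive_seq.
have Dle (f f' : phase -> 'rV[R]_n -> R) : coh_fun f' -> (forall z x, is_derive x (e_ j) (f z) (f' z x)) ->
    exists C M, forall k z, `|D (f z) k| <= C * wt z ^+ M.
  move=> cf' df; have [C [M [C0 HC]]] := coh_growth cf'; exists C, M => k z.
  by rewrite /D; have [t [_ ->]] := mvt_coord x k.+1%:R^-1 (df z); rewrite mulVKf.
have [Cp [Mp Hp]] := Dle p p' cp' dp; have [Cq [Mq Hq]] := Dle q q' cq' dq.
have mD (f : phase -> 'rV[R]_n -> R) k : coh_fun f -> measurable_fun setT (fun z => D (f z) k).
  move=> cf; apply: measurable_funM => //.
  by apply: measurable_funB; exact: coh_measurable.
have bnd (A0 : phase -> R) (f : phase -> 'rV[R]_n -> R) C M : rapid A0 ->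
    (forall k z, `|D (f z) k| <= C * wt z ^+ M) ->
    exists2 K, 0 <= K & forall k z, `|A0 z * D (f z) k| <= K * (wt z)^-1.
  move=> [mA HA] HD; have [K K0 HK] := HA M.+1.
  exists (K * `|C|) => [|k z]; first exact: mulr_ge0.
  rewrite normrM; apply: (@le_trans _ _ (K * (wt z ^+ M.+1)^-1 * (`|C| * wt z ^+ M))).
    apply: ler_pM => //; apply: (le_trans (HD k z)); apply: ler_wpM2r; last exact: ler_norm.
    by rewrite exprn_ge0// wt_ge0.
  rewrite exprS invfM.
  have w0 : wt z ^+ M != 0 by rewrite expf_neq0// gt_eqF// wt_gt0.
  have -> : K * ((wt z)^-1 * (wt z ^+ M)^-1) * (`|C| * wt z ^+ M) =
    K * `|C| * (wt z)^-1 * ((wt z ^+ M)^-1 * wt z ^+ M) by ring.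
  by rewrite mulVf// mulr1.
have [K1 K10 HK1] := bnd A p Cp Mp rA Hp.
have [K2 K20 HK2] := bnd B q Cq Mq rB Hq.
have [|||_ lim1] := @Rint_dct _ _ R lphase (fun k z => A z * D (p z) k + B z * D (q z) k)
  (fun z => A z * p' z x + B z * q' z x) (fun z => (K1 + K2) * (wt z)^-1) _ _ (intgZ _ intg_invwt).
- move=> k; apply: measurable_funD; apply: measurable_funM; [exact: rA.1|exact: mD|exact: rB.1|exact: mD].
- by move=> z; apply: cvgD; apply: cvgM; [exact: cvg_cst|exact: DF|exact: cvg_cst|exact: DF].
- move=> k z; apply: (le_trans (ler_normD _ _)); rewrite [leRHS]mulrDl.
  by apply: lerD; [exact: HK1|exact: HK2].
have EI k : I lphase (fun z => A z * D (p z) k + B z * D (q z) k) = kappa * D H k.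
  have i1 y : intg lphase (fun z => A z * p z y + B z * q z y) by apply: intgD; exact: rapid_coh.
  rewrite /D [RHS]mulrCA mulrBr -!E -RintegralB// -RintegralZl//; last exact: intgB.
  by apply: eq_Rintegral => z _; ring.
move: lim1; rewrite (funext EI) => lim1.
have lim2 : kappa * D H k @[k --> \oo] --> kappa * H' x.
  by apply: cvgM; [exact: cvg_cst|exact: DF].
exact: (cvg_unique _ lim1 lim2).
Qed.

Section signal.
Context (h : schwartz R n).

Definition hR x : R := complex.Re (h x).
Definition hI x : R := complex.Im (h x).

Lemma hR_smooth : smooth hR. Proof. by have [] := schwartzP h. Qed.
Lemma hI_smooth : smooth hI. Proof. by have [] := schwartzP h. Qed.

Lemma hR_rs N e : schwartz_le N e h -> rs_le N e hR.
Proof.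
move=> H a b aN bN x; apply: le_trans (H a b aN bN x); apply: ler_wpM2l => //.
exact: (cabs_Re (cpartials b h x)).
Qed.

Lemma hI_rs N e : schwartz_le N e h -> rs_le N e hI.
Proof.
move=> H a b aN bN x; apply: le_trans (H a b aN bN x); apply: ler_wpM2l => //.
exact: (cabs_Im (cpartials b h x)).
Qed.

Lemma schwartz_seminorm N : exists e, 0 <= e /\ schwartz_le N e h.
Proof.
have [_ _ H] := schwartzP h.
have H1 b : exists C (M : nat), 0 <= C /\ forall a, (size a <= N)%N ->
    forall x, `|monomial a x| * cabs (cpartials b h x) <= C.
  apply: (@words_uniform R n (fun a C _ => forall x, `|monomial a x| * cabs (cpartials b h x) <= C)).
    by move=> a C C' M M' CC _ HC x; exact: le_trans (HC x) CC.
  move=> a; have [C HC] := H a b; exists C, 0%N; split => //.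
  by apply: le_trans (HC 0); rewrite mulr_ge0// cabs_ge0.
have [C [_ [C0 HC]]] : exists C (M : nat), 0 <= C /\ forall b, (size b <= N)%N ->
    forall a, (size a <= N)%N -> forall x, `|monomial a x| * cabs (cpartials b h x) <= C.
  apply: (@words_uniform R n (fun b C _ => forall a, (size a <= N)%N -> forall x, `|monomial a x| * cabs (cpartials b h x) <= C)).
    by move=> b C C' M M' CC _ HC a aN x; exact: le_trans (HC a aN x) CC.
  exact: H1.
by exists C; split => // a b aN bN x; exact: HC.
Qed.

(* V_{phi_0} h = VR + i VI *)
Definition VR z := FT hR g0 z.1 z.2 0 + FT hI g0 z.1 z.2 (- (pi / 2)).
Definition VI z := FT hI g0 z.1 z.2 0 - FT hR g0 z.1 z.2 (- (pi / 2)).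

Lemma FT_rapid f th : smooth f -> (forall N, exists e, rs_le N e f) ->
  rapid (fun z => FT f g0 z.1 z.2 th).
Proof.
move=> sf fN; have pg := gauss_poly_g0 R n; split.
  have [e fe] := fN (2 * n)%N; exact: (measurable_FT th sf pg fe (leqnn _)).
move=> k; have [C [N [C0 H]]] := FT_decay_W k k pg.
have [e fe] := fN N; exists (C * e); first by rewrite mulr_ge0// (rs_le_ge0 fe).
by move=> z; apply: (le_trans (H f e sf fe z.1 z.2 th)); rewrite -invfM -exprMn.
Qed.

Let hR_all N : exists e, rs_le N e hR.
Proof. by have [e [_ He]] := schwartz_seminorm N; exists e; exact: hR_rs. Qed.
Let hI_all N : exists e, rs_le N e hI.
Proof. by have [e [_ He]] := schwartz_seminorm N; exists e; exact: hI_rs. Qed.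

Lemma hR_rapid th : rapid (fun z => FT hR g0 z.1 z.2 th).
Proof. exact: FT_rapid hR_smooth hR_all. Qed.

Lemma hI_rapid th : rapid (fun z => FT hI g0 z.1 z.2 th).
Proof. exact: FT_rapid hI_smooth hI_all. Qed.

Lemma VR_rapid : rapid VR.
Proof. by apply: rapidD; [exact: hR_rapid|exact: hI_rapid]. Qed.

Lemma VI_rapid : rapid VI.
Proof. by apply: rapidD; [exact: hI_rapid|exact: rapidN (hR_rapid _)]. Qed.

(** The addition formula recentres the phase at [x], which is the form required by [inversion],
    while [FT] itself does not depend on [x]. *)
Lemma FT_addth f z x th : smooth f -> (exists e, rs_le (2 * n) e f) ->
  I mu (fun t => f t * g0 (t - z.1) * cos (2 * pi * dotrv z.2 (t - x) + th)) =
  cos (2 * pi * dotrv z.2 x) * FT f g0 z.1 z.2 th +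
  sin (2 * pi * dotrv z.2 x) * FT f g0 z.1 z.2 (th - pi / 2).
Proof.
move=> sf [e fe]; have pg := gauss_poly_g0 R n.
have [Cg Cg0 gC] := gauss_poly_W 0 pg.
have nN1 : (2 * (1 * n) <= 2 * n)%N by rewrite mul1n.
have iA s : intg mu (fun t => f t * g0 (t - z.1) * cos (2 * pi * dotrv z.2 t + s)).
  apply: (intg_dom _ (FT_arg_le z.1 z.2 s fe nN1 Cg0 gC)); first exact: measurable_FT_arg.
  exact/intgZ/intg_invW.
rewrite /FT -!RintegralZl// -RintegralD//; [|exact: intgZ..].
apply: eq_Rintegral => t _; rewrite (addrA _ th) cosBpihalf dotrvBr mulrBr addrAC.
by rewrite cosB; ring.
Qed.

Definition recon f th x z := g0 (x - z.1) * (cos (2 * pi * dotrv z.2 x) * FT f g0 z.1 z.2 th +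
  sin (2 * pi * dotrv z.2 x) * FT f g0 z.1 z.2 (th - pi / 2)).

Lemma recon_integral f th x : smooth f -> (forall N, exists e, rs_le N e f) ->
  intg lphase (recon f th x) /\ I lphase (recon f th x) = cos th * kappa * f x.
Proof.
move=> sf fN; have pg := gauss_poly_g0 R n.
have [C [N [C0 H]]] := FT_decay_W 1 1 pg.
have [e fe] := fN N; have [e2 fe2] := fN (2 * n)%N.
have cf : continuous f by exact: (sf [::]).1.
have e0 := rs_le_ge0 fe.
pose B : R := 2 * (C * e).
have FB z : `|cos (2 * pi * dotrv z.2 x) * FT f g0 z.1 z.2 th +
    sin (2 * pi * dotrv z.2 x) * FT f g0 z.1 z.2 (th - pi / 2)| <= B * ((W z.1)^-1 * (W z.2)^-1).
  have FTb th' : `|FT f g0 z.1 z.2 th'| <= C * e * ((W z.1)^-1 * (W z.2)^-1).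
    by have := H f e sf fe z.1 z.2 th'; rewrite !expr1.
  apply: (le_trans (ler_normD _ _)).
  have -> : B * ((W z.1)^-1 * (W z.2)^-1) = C * e * ((W z.1)^-1 * (W z.2)^-1) + C * e * ((W z.1)^-1 * (W z.2)^-1) by rewrite /B; ring.
  by apply: lerD; rewrite normrM; apply: le_trans (FTb _); apply: ler_piMl => //; [exact: cos_abs|exact: sin_abs].
have fC t : `|f t| <= 2 ^+ (1 * n) * e2 * (W t)^-1.
  have := rs_le_W (b := [::]) fe2 (_ : (2 * (1 * n) <= 2 * n)%N) isT t; rewrite expr1; apply.
  by rewrite mul1n.
have EF z := FT_addth z x th sf (ex_intro _ e2 fe2).
have FB' z : `|I mu (fun t => f t * g0 (t - z.1) * cos (2 * pi * dotrv z.2 (t - x) + th))| <= B * ((W z.1)^-1 * (W z.2)^-1).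
  by rewrite EF.
split; last first.
  rewrite -(inversion cf fC FB'); apply: eq_Rintegral => z _.
  by rewrite /recon EF.
have mFT th' : measurable_fun setT (fun z : phase => FT f g0 z.1 z.2 th').
  exact: (measurable_FT th' sf pg fe2 (leqnn _)).
have mph : measurable_fun setT (fun z : phase => 2 * pi * dotrv z.2 x).
  by apply: measurable_funM => //; exact: measurable_dotrv.
apply: (intg_dom (g := fun z => k0 R n * B * (wt z)^-1)).
- apply: measurable_funM.
    by apply: (measurableT_comp (@measurable_g0 R n)); exact: measurable_subrV.
  apply: measurable_funD; apply: measurable_funM => //; [exact: measurable_cosf|exact: measurable_sinf].
- move=> z; rewrite /recon normrM (ger0_norm (g0_ge0 _)) -[leRHS]mulrA invfM.
  by apply: ler_pM => //; [exact: g0_ge0|exact: g0_le].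
- exact/intgZ/intg_invwt.
Qed.

Lemma FT_pihalf f y xi : smooth f -> (exists e, rs_le (2 * n) e f) ->
  FT f g0 y xi (pi / 2) = - FT f g0 y xi (- (pi / 2)).
Proof.
move=> sf [e fe]; have pg := gauss_poly_g0 R n.
have [Cg Cg0 gC] := gauss_poly_W 0 pg.
have nN1 : (2 * (1 * n) <= 2 * n)%N by rewrite mul1n.
rewrite -mulN1r /FT -RintegralZl//; last first.
  apply: (intg_dom _ (FT_arg_le y xi _ fe nN1 Cg0 gC)); first exact: measurable_FT_arg.
  exact/intgZ/intg_invW.
by apply: eq_Rintegral => t _; rewrite cosDpihalf cosBpihalf; ring.
Qed.

(** The contribution of the real part of [h] is the inversion formula with phase 0. The cross term
    from its imaginary part is the formula with phase pi/2, which vanishes because cos(pi/2) = 0. *)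
Lemma hR_inversion x :
  I lphase (fun z => VR z * cohR z x + - VI z * cohI z x) = kappa * hR x.
Proof.
have [i1 E1] := recon_integral 0 x hR_smooth hR_all.
have [i2 E2] := recon_integral (pi / 2) x hI_smooth hI_all.
transitivity (I lphase (fun z => recon hR 0 x z - recon hI (pi / 2) x z)).
  apply: eq_Rintegral => z _; rewrite /recon cohR_E cohI_E cosBpihalf addr0 subrr sub0r.
  rewrite (FT_pihalf _ _ hI_smooth (hI_all _)) /VR /VI; ring.
by rewrite RintegralB// E1 E2 cos0 cos_pihalf mul1r !mul0r subr0.
Qed.

Lemma hI_inversion x :
  I lphase (fun z => VR z * cohI z x + VI z * cohR z x) = kappa * hI x.
Proof.
have [i1 E1] := recon_integral 0 x hI_smooth hI_all.
have [i2 E2] := recon_integral (pi / 2) x hR_smooth hR_all.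
transitivity (I lphase (fun z => recon hI 0 x z + recon hR (pi / 2) x z)).
  apply: eq_Rintegral => z _; rewrite /recon cohR_E cohI_E cosBpihalf addr0 subrr sub0r.
  rewrite (FT_pihalf _ _ hR_smooth (hR_all _)) /VR /VI; ring.
by rewrite RintegralD// E1 E2 cos0 cos_pihalf mul1r !mul0r addr0.
Qed.

Lemma partials_inversion A B p q (H : 'rV[R]_n -> R) b : rapid A -> rapid B ->
  coh_fun p -> coh_fun q -> smooth H ->
  (forall x, I lphase (fun z => A z * p z x + B z * q z x) = kappa * H x) ->
  forall x, I lphase (fun z => A z * partials b (p z) x + B z * partials b (q z) x) =
    kappa * partials b H x.
Proof.
move=> rA rB cp cq sH E; elim: b => [//|j b IH] /=.
have [p' cp' dp] := coh_derive j (coh_partials b cp).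
have [q' cq' dq] := coh_derive j (coh_partials b cq).
have dH x : is_derive x (e_ j) (partials b H) ('D_(e_ j) (partials b H) x).
  by apply: DeriveDef => //; exact: (sH b).2.
move=> x; rewrite -(derive_under rA rB (coh_partials b cp) (coh_partials b cq) cp' cq' dp dq dH IH).
apply: eq_Rintegral => z _.
by rewrite (@derive_val _ _ _ _ _ _ _ (dp z x)) (@derive_val _ _ _ _ _ _ _ (dq z x)).
Qed.

Lemma hR_partials b x : I lphase (fun z => VR z * partials b (cohR z) x + - VI z * partials b (cohI z) x) =
  kappa * partials b hR x.
Proof.
apply: partials_inversion; [exact: VR_rapid|exact: rapidN VI_rapid|exact: coh_cohR|exact: coh_cohI|
  exact: hR_smooth|exact: hR_inversion].
Qed.

Lemma hI_partials b x : I lphase (fun z => VR z * partials b (cohI z) x + VI z * partials b (cohR z) x) =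
  kappa * partials b hI x.
Proof.
apply: partials_inversion; [exact: VR_rapid|exact: VI_rapid|exact: coh_cohI|exact: coh_cohR|
  exact: hI_smooth|exact: hI_inversion].
Qed.

End signal.

Lemma V_bound : exists C N, 0 <= C /\ forall (h : schwartz R n) e, schwartz_le N e h ->
  forall z, `|VR h z| + `|VI h z| <= C * e * (wt z)^-1.
Proof.
have [C [N [C0 H]]] := FT_decay_W 1 1 (gauss_poly_g0 R n).
(* [VR] and [VI] are each made of two terms [FT]. *)
exists (4 * C), N; split; first exact: mulr_ge0.
move=> h e he z.
have Hr th : `|FT (hR h) g0 z.1 z.2 th| <= C * e * (wt z)^-1.
  have := H _ e (hR_smooth h) (hR_rs he) z.1 z.2 th; by rewrite !expr1 -invfM.
have Hi th : `|FT (hI h) g0 z.1 z.2 th| <= C * e * (wt z)^-1.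
  have := H _ e (hI_smooth h) (hI_rs he) z.1 z.2 th; by rewrite !expr1 -invfM.
have -> : 4 * C * e * (wt z)^-1 = (C * e * (wt z)^-1 + C * e * (wt z)^-1) + (C * e * (wt z)^-1 + C * e * (wt z)^-1) by ring.
apply: lerD.
  by apply: (le_trans (ler_normD _ _)); apply: lerD; [exact: Hr|exact: Hi].
by apply: (le_trans (ler_normB _ _)); apply: lerD; [exact: Hi|exact: Hr].
Qed.

End representation.

(** * Bounds on tempered distributions *)

Section cabs.
Context (R : realType).
Implicit Types (a b : Cplx R).

Lemma cabsM a b : cabs (a * b) = cabs a * cabs b. Proof. exact: Normc.normcM. Qed.
Lemma cabsD a b : cabs (a + b) <= cabs a + cabs b. Proof. exact: le_normcD. Qed.
Lemma cabs0 : cabs (0 : Cplx R) = 0. Proof. exact: Normc.normc0. Qed.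
Lemma cabs_conj a : cabs (cconj a) = cabs a.
Proof. by case: a => x y; rewrite /cabs /cconj /= sqrrN. Qed.
Lemma cabs_real (r : R) : cabs (Complex r 0) = `|r|.
Proof. by rewrite /cabs /= expr0n /= addr0 sqrtr_sqr. Qed.
Lemma cabsN a : cabs (- a) = cabs a.
Proof. by case: a => x y; rewrite /cabs /= !sqrrN. Qed.
Lemma cabsB a b : cabs (a - b) = cabs (b - a).
Proof. by rewrite -cabsN opprB. Qed.
Lemma cabs_sum I (s : seq I) (F : I -> Cplx R) :
  cabs (\sum_(i <- s) F i) <= \sum_(i <- s) cabs (F i).
Proof.
elim: s => [|i s IH]; first by rewrite !big_nil cabs0.
by rewrite !big_cons (le_trans (cabsD _ _))// lerD2l.
Qed.

Lemma cabs_lip a b : `|cabs a - cabs b| <= cabs (a - b).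
Proof.
have h (c d : Cplx R) : cabs c <= cabs (c - d) + cabs d by have := cabsD (c - d) d; rewrite subrK.
rewrite ler_distl; apply/andP; split; last by rewrite [leRHS]addrC; exact: h.
by rewrite lerBlDr [leRHS]addrC cabsB; exact: h.
Qed.

End cabs.

Section tempered_bounds.
Context (R : realType) (n : nat).
Local Notation phase := ('rV[R]_n * 'rV[R]_n)%type.
Implicit Types (u : tempered R n) (f g h : schwartz R n) (z : phase).

Lemma tempered_lin u (k : Cplx R) f g : u (k *: f + g) = cconj k * u f + u g.
Proof. by case: u => u /= /asboolP[H _]; exact: H. Qed.

Lemma tempered_cont u : continuous u.
Proof. by case: u => u /= /asboolP[_ H]; exact: H. Qed.

Lemma tempered0 u : u 0 = 0.
Proof. by have := tempered_lin u (-1) 0 0; rewrite scaleN1r addNr /cconj rmorphN rmorph1 mulN1r addNr. Qed.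

Lemma temperedZ u (k : Cplx R) f : u (k *: f) = cconj k * u f.
Proof. by have := tempered_lin u k f 0; rewrite tempered0 !addr0. Qed.

Lemma temperedD u f g : u (f + g) = u f + u g.
Proof. by have := tempered_lin u 1 f g; rewrite scale1r /cconj rmorph1 mul1r. Qed.

Lemma temperedB u f g : u (f - g) = u f - u g.
Proof. by rewrite temperedD -scaleN1r temperedZ /cconj rmorphN rmorph1 mulN1r. Qed.

Lemma tempered_sum u I (s : seq I) (c : I -> Cplx R) (F : I -> schwartz R n) :
  u (\sum_(i <- s) c i *: F i) = \sum_(i <- s) cconj (c i) * u (F i).
Proof.
elim: s => [|i s IH]; first by rewrite !big_nil tempered0.
by rewrite !big_cons tempered_lin IH.
Qed.

Lemma cpartials0 b : cpartials b (0 : schwartz R n) = 0.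
Proof.
have := cpartials_lin (-1) b (schwartzP (0 : schwartz R n)) (schwartzP 0).
by rewrite !scaleN1r !addNr.
Qed.

Lemma cpartialsZD (k : Cplx R) b f g : cpartials b (k *: f + g) = k *: cpartials b f + cpartials b g.
Proof. exact: cpartials_lin (schwartzP f) (schwartzP g). Qed.

Lemma cpartialsB b f g x : cpartials b (f - g) x = cpartials b f x - cpartials b g x.
Proof.
have := cpartialsZD (-1) b g f; rewrite scaleN1r addrC => ->.
by rewrite scaleN1r addrC.
Qed.

Lemma cpartialsZ (k : Cplx R) b f x : cpartials b (k *: f) x = k * cpartials b f x.
Proof.
have := cpartialsZD k b f 0; rewrite addr0 => ->.
by rewrite cpartials0 addr0.
Qed.

Lemma cpartials_sum b I (s : seq I) (c : I -> Cplx R) (F : I -> schwartz R n) x :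
  cpartials b (\sum_(i <- s) c i *: F i : schwartz R n) x = \sum_(i <- s) c i * cpartials b (F i) x.
Proof.
elim: s => [|i s IH]; first by rewrite !big_nil cpartials0.
by rewrite !big_cons cpartialsZD -IH.
Qed.

Lemma schwartz_leZ N e (k : Cplx R) f : schwartz_le N e f -> schwartz_le N (cabs k * e) (k *: f).
Proof.
move=> H a b aN bN x; rewrite cpartialsZ cabsM mulrCA; apply: ler_wpM2l; first exact: cabs_ge0.
exact: H.
Qed.

Lemma schwartz_le_mono N M e e' f : (N <= M)%N -> e <= e' -> schwartz_le M e f -> schwartz_le N e' f.
Proof. by move=> NM ee H a b aN bN x; apply: le_trans ee; apply: H; exact: leq_trans NM. Qed.

Lemma schwartz_le_parts N e f : (forall a b, (size a <= N)%N -> (size b <= N)%N -> forall x,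
    `|monomial a x * complex.Re (cpartials b f x)| <= e /\
    `|monomial a x * complex.Im (cpartials b f x)| <= e) -> schwartz_le N (2 * e) f.
Proof.
move=> H a b aN bN x; have [H1 H2] := H a b aN bN x.
apply: (le_trans (ler_wpM2l (normr_ge0 _) (cabs_le _))).
by rewrite mulrDr -!normrM mulr_natl mulr2n; exact: lerD.
Qed.

(** Continuity at 0 gives one seminorm ball mapped into the unit disc, and rescaling does the rest.
    The rescaling divides by [E], hence the strict positivity that later arguments have to
    arrange. *)
Lemma tempered_bound u : exists N K, 0 <= K /\ forall g E, 0 < E -> schwartz_le N E g -> cabs (u g) <= K * E.
Proof.
have c0 := @tempered_cont u 0.
have : nbhs (u 0) (ball (u 0) 1) by exact: nbhsx_ballx.
move=> /c0 [N [e [e0 H]]]; exists N, e^-1; split; first by rewrite invr_ge0 ltW.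
move=> g E E0 gE; pose k : Cplx R := Complex (e / E) 0.
have kE : cabs k = e / E by rewrite cabs_real ger0_norm// divr_ge0// ltW.
have := H (k *: g); rewrite subr0 => /(_ _).
have ge : schwartz_le N e (k *: g).
  by have := schwartz_leZ k gE; rewrite kE divfK// gt_eqF.
move=> /(_ ge); rewrite /ball /= tempered0 sub0r normrN temperedZ => h.
have {h} : cabs (cconj k * u g) < 1.
  by move: h; rewrite normc_def ltcR; case: (cconj k * u g).
rewrite cabsM cabs_conj kE => h.
rewrite mulrC ler_pdivlMr// -(ler_pM2r (_ : 0 < E^-1)) ?invr_gt0//.
by rewrite mulfV ?gt_eqF// -mulrA [cabs _ * _]mulrC ltW.
Qed.

End tempered_bounds.

Section stft_regularity.
Context (R : realType) (n : nat).
Local Notation phase := ('rV[R]_n * 'rV[R]_n)%type.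
Implicit Types (u : tempered R n) (h : schwartz R n) (z : phase).

Lemma coherent_seminorm N : exists C M, 0 <= C /\
  (forall z, schwartz_le N (C * wt z ^+ M) (coherent z)) /\
  (forall z z', schwartz_le N (C * pdist z z' * (wt z * wt z') ^+ M) (coherent z - coherent z')).
Proof.
have [C1 [M1 [C10 H1]]] := coh_seminorm N (coh_cohR R n).
have [C2 [M2 [C20 H2]]] := coh_seminorm N (coh_cohI R n).
pose M := maxn M1 M2; pose C := C1 + C2.
have C0 : 0 <= C by rewrite addr_ge0.
have le1 c c' (t : R) k : c <= C -> c' = c * t ^+ k -> 0 <= c -> 1 <= t -> (k <= M)%N ->
    c' <= C * t ^+ M.
  move=> cC -> c0 t1 kM; apply: ler_pM => //; first by rewrite exprn_ge0// (le_trans ler01).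
  exact: ler_weXn2l.
have C1C : C1 <= C by rewrite lerDl.
have C2C : C2 <= C by rewrite lerDr.
exists (2 * C), M; split; first by rewrite mulr_ge0.
split.
  move=> z; rewrite (_ : 2 * C * wt z ^+ M = 2 * (C * wt z ^+ M)); last by rewrite mulrA.
  apply: schwartz_le_parts => a b aN bN x.
  have [h1 _] := H1 a b aN bN z z x; have [h2 _] := H2 a b aN bN z z x.
  split; [apply: (le_trans h1)|apply: (le_trans h2)].
    by apply: (le1 C1 _ _ M1) => //; [exact: wt_ge1|exact: leq_maxl].
  by apply: (le1 C2 _ _ M2) => //; [exact: wt_ge1|exact: leq_maxr].
move=> z z'; rewrite (_ : 2 * C * pdist z z' * (wt z * wt z') ^+ M =
  2 * (C * (wt z * wt z') ^+ M * pdist z z')); last by ring.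
apply: schwartz_le_parts => a b aN bN x.
have [_ h1] := H1 a b aN bN z z' x; have [_ h2] := H2 a b aN bN z z' x.
have ww1 : 1 <= wt z * wt z' by apply: mulr_ege1; exact: wt_ge1.
have d0 := pdist_ge0 z z'.
rewrite cpartialsB; split.
  rewrite (_ : complex.Re _ = partials b (cohR z) x - partials b (cohR z') x)// mulrBr.
  apply: (le_trans h1); rewrite mulrAC; apply: ler_wpM2r => //.
  by apply: (le1 C1 _ _ M1) => //; exact: leq_maxl.
rewrite (_ : complex.Im _ = partials b (cohI z) x - partials b (cohI z') x)// mulrBr.
apply: (le_trans h2); rewrite mulrAC; apply: ler_wpM2r => //.
by apply: (le1 C2 _ _ M2) => //; exact: leq_maxr.
Qed.

Lemma stft_growth u : exists C M, 0 <= C /\ (forall z, cabs (stft u z) <= C * wt z ^+ M) /\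
  forall z z', cabs (stft u z - stft u z') <= C * (pdist z z' * (wt z * wt z') ^+ M).
Proof.
have [N [K [K0 HK]]] := tempered_bound u.
have [C [M [C0 [H1 H2]]]] := coherent_seminorm N.
(* The constant is enlarged so that the seminorm bound is strictly positive, as [tempered_bound]
   requires. *)
have C1 : 0 < C + 1 by rewrite ltr_wpDl.
have CC : C <= C + 1 by rewrite lerDl.
exists (K * (C + 1)), M; split; first by rewrite mulr_ge0// ltW.
split => [z|z z'].
  rewrite -mulrA; apply: HK; first by rewrite mulr_gt0// exprn_gt0// wt_gt0.
  by apply: schwartz_le_mono (H1 z) => //; apply: ler_wpM2r => //; rewrite exprn_ge0// wt_ge0.
rewrite /stft -temperedB -mulrA mulrA.
have ww0 : 0 < wt z * wt z' by rewrite mulr_gt0// wt_gt0.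
have w0 : 0 <= (wt z * wt z') ^+ M by rewrite exprn_ge0// ltW.
have le d : pdist z z' <= d -> 0 < d -> cabs (u (coherent z - coherent z')) <= K * ((C + 1) * d * (wt z * wt z') ^+ M).
  move=> dd d0; apply: HK; first by rewrite !mulr_gt0// exprn_gt0.
  apply: schwartz_le_mono (H2 z z') => //; apply: ler_wpM2r => //.
  by apply: ler_pM => //; exact: pdist_ge0.
have [d0|d0] := ltP 0 (pdist z z').
  by rewrite -[leRHS]mulrA [leRHS](_ : _ = K * ((C + 1) * pdist z z' * (wt z * wt z') ^+ M)) ?le//; rewrite !mulrA.
(* At zero distance the seminorm bound is no longer strictly positive, so an arbitrarily small
   positive distance is used and the limit is taken. *)
have E : pdist z z' = 0 by apply/eqP; rewrite eq_le d0 pdist_ge0.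
rewrite E mul0r mulr0.
apply/ler_addgt0Pr => e e0; rewrite add0r.
pose D := K * (C + 1) * (wt z * wt z') ^+ M + 1.
have D0 : 0 < D by rewrite ltr_wpDl// !mulr_ge0// ltW.
have eD : 0 < e / D by exact: divr_gt0.
have h := le (e / D); rewrite E in h; apply: (le_trans (h (ltW eD) eD)).
have -> : K * ((C + 1) * (e / D) * (wt z * wt z') ^+ M) = e * ((K * (C + 1) * (wt z * wt z') ^+ M) / D) by ring.
apply: ler_piMr; first exact: ltW.
by rewrite ler_pdivrMr// mul1r lerDl.
Qed.

Lemma l1_le (x y : 'rV[R]_n) : (forall i, `|x ord0 i| <= `|y ord0 i|) -> l1 (x - y) <= 2 * n%:R * W y.
Proof.
move=> xy; rewrite /l1 (_ : 2 * n%:R * W y = \sum_(i < n) (2 * W y)); last first.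
  by rewrite sumr_const card_ord -[RHS]mulr_natr mulrAC.
apply: ler_sum => i _; rewrite !mxE (le_trans (ler_normB _ _))// mulr_natl mulr2n.
by apply: lerD; [apply: (le_trans (xy i))|]; exact: W_ge_coord.
Qed.

Section approximation.
Context (s : nat -> phase -> phase).
Context (ss : forall k, simple_map (s k)).
Context (sle : forall k z i, `|(s k z).1 ord0 i| <= `|z.1 ord0 i| /\ `|(s k z).2 ord0 i| <= `|z.2 ord0 i|).
Context (scvg : forall z i, (s k z).1 ord0 i @[k --> \oo] --> z.1 ord0 i /\
                  (s k z).2 ord0 i @[k --> \oo] --> z.2 ord0 i).

Lemma wt_simple_le k z : wt (s k z) <= wt z.
Proof.
apply: ler_pM; [exact/ltW/W_gt0|exact/ltW/W_gt0| |];
  by apply: W_le => i; have [] := sle k z i.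
Qed.

Lemma pdist_simple_le k z : pdist (s k z) z <= 4 * n%:R * wt z.
Proof.
rewrite (_ : 4 * n%:R * wt z = 2 * n%:R * wt z + 2 * n%:R * wt z); last by ring.
have n0 : 0 <= 2 * n%:R :> R by exact: mulr_ge0.
apply: lerD.
  apply: (le_trans (l1_le _)) => [i|]; first by have [] := sle k z i.
  by apply: ler_wpM2l => //; exact: wt_W1.
apply: (le_trans (l1_le _)) => [i|]; first by have [] := sle k z i.
by apply: ler_wpM2l => //; exact: wt_W2.
Qed.

Lemma l1_cvg (a : nat -> 'rV[R]_n) (x : 'rV[R]_n) : (forall i, a k ord0 i @[k --> \oo] --> x ord0 i) ->
  l1 (a k - x) @[k --> \oo] --> 0.
Proof.
move=> H; rewrite /l1.
elim: (index_enum _) => [|i r IH].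
  by under eq_fun do rewrite big_nil; exact: cvg_cst.
under eq_fun do rewrite big_cons.
have h : `|(a k - x) ord0 i| @[k --> \oo] --> 0.
  apply/norm_cvg0P; under eq_fun do rewrite !mxE.
  by apply/subr_cvg0; exact: H.
by have := cvgD h IH; rewrite addr0; apply.
Qed.

Lemma pdist_cvg z : pdist (s k z) z @[k --> \oo] --> 0.
Proof.
have h1 : l1 ((s k z).1 - z.1) @[k --> \oo] --> 0 by apply: l1_cvg => i; have [] := scvg z i.
have h2 : l1 ((s k z).2 - z.2) @[k --> \oo] --> 0 by apply: l1_cvg => i; have [] := scvg z i.
by have := cvgD h1 h2; rewrite addr0; apply.
Qed.

Lemma measurable_pdist k : measurable_fun setT (fun z => pdist (s k z) z).
Proof.
apply: measurable_funD; apply: measurable_sum => i.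
  apply: (measurableT_comp (@normr_measurable R _)).
  under eq_fun do rewrite !mxE; apply: measurable_funB.
    exact: (measurable_simple_comp (fun z : phase => z.1 ord0 i) (ss k)).
  by apply: measurable_coordf; exact: measurable_fst.
apply: (measurableT_comp (@normr_measurable R _)).
under eq_fun do rewrite !mxE; apply: measurable_funB.
  exact: (measurable_simple_comp (fun z : phase => z.2 ord0 i) (ss k)).
by apply: measurable_coordf; exact: measurable_snd.
Qed.

(** Bounds, up to a constant, the error of replacing z by [s k z]. As [s k] does not increase the
    weight, the weight of both points can be charged to z, giving a majorant of order
    [wt z ^+ (M + M).+1] independent of [k]: 2 M powers from the Lipschitz constant and one from the
    distance. *)
Definition modulus M k z := pdist (s k z) z * (wt z * wt z) ^+ M.

Lemma modulus_ge0 M k z : 0 <= modulus M k z.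
Proof. by apply: mulr_ge0; [exact: pdist_ge0|apply: exprn_ge0; apply: mulr_ge0; exact: wt_ge0]. Qed.

Lemma le_modulus M k z : pdist (s k z) z * (wt (s k z) * wt z) ^+ M <= modulus M k z.
Proof.
apply: ler_wpM2l; first exact: pdist_ge0.
apply: lerXn2r; rewrite ?nnegrE; [apply: mulr_ge0; exact: wt_ge0|apply: mulr_ge0; exact: wt_ge0|].
by apply: ler_wpM2r; [exact: wt_ge0|exact: wt_simple_le].
Qed.

Lemma modulus_le M k z : modulus M k z <= 4 * n%:R * wt z ^+ (M + M).+1.
Proof.
rewrite /modulus exprMn -exprD exprS mulrA; apply: ler_wpM2r; last exact: pdist_simple_le.
by apply: exprn_ge0; exact: wt_ge0.
Qed.

Lemma modulus_cvg M z : modulus M k z @[k --> \oo] --> 0.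
Proof.
by have := cvgM (pdist_cvg z) (cvg_cst ((wt z * wt z) ^+ M)); rewrite mul0r; apply.
Qed.

Lemma measurable_modulus M k : measurable_fun setT (modulus M k).
Proof.
apply: measurable_funM; first exact: measurable_pdist.
by apply: measurable_funX; apply: measurable_funM; exact: measurable_wt.
Qed.

Lemma lipschitz_cvg (F : phase -> R) C M : 0 <= C ->
  (forall z z', `|F z - F z'| <= C * (pdist z z' * (wt z * wt z') ^+ M)) ->
  forall z, F (s k z) @[k --> \oo] --> F z.
Proof.
move=> C0 H z; apply/subr_cvg0; apply/norm_cvg0P.
apply: (@squeeze_cvgr _ _ _ _ (fun=> 0) (fun k => C * modulus M k z)).
- near=> k; rewrite normr_ge0/=; apply: (le_trans (H _ _)); apply: ler_wpM2l => //.
  exact: le_modulus.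
- exact: cvg_cst.
- by have := cvgM (cvg_cst C) (modulus_cvg M z); rewrite mulr0; apply.
Unshelve. all: by end_near. Qed.

Lemma lipschitz_measurable (F : phase -> R) C M : 0 <= C ->
  (forall z z', `|F z - F z'| <= C * (pdist z z' * (wt z * wt z') ^+ M)) ->
  measurable_fun setT F.
Proof. by move=> C0 H; apply: (measurable_fun_approx ss); exact: lipschitz_cvg C0 H. Qed.

End approximation.

End stft_regularity.

(** * Finite sums over the fibres of a simple map *)

Section simple_integrals.
Context d (T : measurableType d) (R : realType) (m : {measure set T -> \bar R}).
Local Notation intg f := (m.-integrable setT (EFin \o f)).
Local Notation I f := (Rintegral m setT f).

Context (T' : eqType).

Lemma simple_map_range (s : T -> T') : simple_map s ->
  exists2 L : seq T', uniq L & forall z, s z \in L.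
Proof.
move=> [/finite_seqP[L E] _]; exists (undup L); first exact: undup_uniq.
by move=> z; rewrite mem_undup; have : range s (s z) by []; rewrite E.
Qed.

Lemma measurable_simple_eq (s : T -> T') v : simple_map s ->
  measurable_fun setT (fun z => (s z == v)%:R : R).
Proof. by move=> ss; exact: (measurable_simple_comp (fun x => (x == v)%:R : R) ss). Qed.

Lemma intg_simple_eq (s : T -> T') (A : T -> R) v : simple_map s -> intg A ->
  intg (fun z => A z * (s z == v)%:R).
Proof.
move=> ss iA; apply: (intg_dom (g := fun z => `|A z|)) => [|z|].
- by apply: measurable_funM; [exact: intg_measurable iA|exact: measurable_simple_eq].
- by rewrite normrM ler_piMr//; case: (s z == v); rewrite /= ?normr1 ?normr0.
- exact: integrable_norm.
Qed.

Lemma Rint_simple (s : T -> T') (L : seq T') (A : T -> R) (phi : T' -> R) :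
  simple_map s -> uniq L -> (forall z, s z \in L) -> intg A ->
  intg (fun z => A z * phi (s z)) /\
  \sum_(v <- L) phi v * I (fun z => A z * (s z == v)%:R) = I (fun z => A z * phi (s z)).
Proof.
move=> ss uL sL iA.
have [] := sum_Rint L (fun v => intgZ (phi v) (intg_simple_eq v ss iA)).
have -> : (fun z => \sum_(v <- L) phi v * (A z * (s z == v)%:R)) = (fun z => A z * phi (s z)).
  apply/funext => z; rewrite (bigD1_seq (s z))//= eqxx mulr1 big1 ?addr0 1?mulrC//.
  by move=> v; rewrite eq_sym => /negPf ->; rewrite mulr0 mulr0.
move=> i1 ->; split => //; apply: eq_bigr => v _; rewrite RintegralZl//.
exact: intg_simple_eq.
Qed.

End simple_integrals.

Section simple_error.
Context d (T : measurableType d) (R : realType) (m : {measure set T -> \bar R}).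
Local Notation intg f := (m.-integrable setT (EFin \o f)).
Local Notation I f := (Rintegral m setT f).

(** The finite sum is itself an integral, of [p \o s] and [q \o s] against [A] and [B], so the error
    is the integral of pointwise differences. In the application [mu] is a monomial at a fixed x,
    and [p], [q] are partial derivatives of the two parts of a coherent state. *)
Lemma simple_error (s : T -> T) (L : seq T) (A B p q D : T -> R) (mu : R) :
  simple_map s -> uniq L -> (forall z, s z \in L) ->
  intg A -> intg B -> intg (fun z => A z * p z) -> intg (fun z => B z * q z) ->
  (forall z, `|mu * p (s z) - mu * p z| <= D z) -> (forall z, `|mu * q (s z) - mu * q z| <= D z) ->
  intg (fun z => (`|A z| + `|B z|) * D z) ->
  `|mu * (\sum_(v <- L) (p v * I (fun z => A z * (s z == v)%:R) + q v * I (fun z => B z * (s z == v)%:R)) -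
     I (fun z => A z * p z + B z * q z))| <= I (fun z => (`|A z| + `|B z|) * D z).
Proof.
move=> ss uL sL iA iB iAp iBq pD qD iD.
have [iAs EA] := Rint_simple p ss uL sL iA; have [iBs EB] := Rint_simple q ss uL sL iB.
have i1 := intgD iAs iBs; have i2 := intgD iAp iBq; have i3 := intgB i1 i2.
rewrite big_split/= EA EB -RintegralD// -RintegralB// -RintegralZl//.
apply: Rint_le_dom => //; first exact: intg_measurable (intgZ mu i3).
move=> z.
have -> : mu * (A z * p (s z) + B z * q (s z) - (A z * p z + B z * q z)) =
  A z * (mu * p (s z) - mu * p z) + B z * (mu * q (s z) - mu * q z) by ring.
rewrite (le_trans (ler_normD _ _))// !normrM mulrDl; apply: lerD; exact: ler_wpM2l.
Qed.

End simple_error.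

(** * Synthesis in the Schwartz topology *)

Section key_inequality.
Context (R : realType) (n : nat).
Local Notation phase := ('rV[R]_n * 'rV[R]_n)%type.
Implicit Types (u : tempered R n) (h : schwartz R n) (z : phase).
Local Notation lphase := (lphase R n).
Local Notation kappa := (kappa R n).
Local Notation intg f := (lphase.-integrable setT (EFin \o f)).
Local Notation I f := (Rintegral lphase setT f).

Lemma rapid_norm (A : phase -> R) : rapid A -> rapid (fun z => `|A z|).
Proof.
move=> [mA HA]; split; first exact: (measurableT_comp (@normr_measurable R _)).
by move=> k; have [C C0 H] := HA k; exists C => // z; rewrite normr_id.
Qed.

Definition Vabs h z := `|VR h z| + `|VI h z|.

Lemma Vabs_rapid h : rapid (Vabs h).
Proof. by apply: rapidD; apply: rapid_norm; [exact: VR_rapid|exact: VI_rapid]. Qed.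

Lemma Vabs_ge0 h z : 0 <= Vabs h z. Proof. exact: addr_ge0. Qed.

Lemma rapid_intg1 (A : phase -> R) : rapid A -> intg A.
Proof.
move=> rA; have -> : A = (fun z => A z * 1) by apply/funext => z; rewrite mulr1.
apply: (rapid_intg (C := 1) (M := 0) rA); first exact: measurable_cst.
by move=> z; rewrite normr1 expr0 mulr1.
Qed.

Lemma Re_sum J (L : seq J) (F : J -> Cplx R) :
  complex.Re (\sum_(i <- L) F i) = \sum_(i <- L) complex.Re (F i).
Proof. by elim: L => [|i L IH]; rewrite ?big_nil// !big_cons -IH; case: (F i) (\sum_(_ <- _) _) => ? ? []. Qed.

Lemma Im_sum J (L : seq J) (F : J -> Cplx R) :
  complex.Im (\sum_(i <- L) F i) = \sum_(i <- L) complex.Im (F i).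
Proof. by elim: L => [|i L IH]; rewrite ?big_nil// !big_cons -IH; case: (F i) (\sum_(_ <- _) _) => ? ? []. Qed.

Context (s : nat -> phase -> phase).
Context (ss : forall k, simple_map (s k)).
Context (sle : forall k z i, `|(s k z).1 ord0 i| <= `|z.1 ord0 i| /\ `|(s k z).2 ord0 i| <= `|z.2 ord0 i|).
Context (scvg : forall z i, (s k z).1 ord0 i @[k --> \oo] --> z.1 ord0 i /\
                  (s k z).2 ord0 i @[k --> \oo] --> z.2 ord0 i).

Lemma intg_modulus h M k : intg (fun z => Vabs h z * modulus s M k z).
Proof.
apply: (rapid_intg (C := 4 * n%:R) (M := (M + M).+1) (Vabs_rapid h)).
  exact: measurable_modulus.
by move=> z; rewrite ger0_norm ?modulus_ge0//; exact: modulus_le.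
Qed.

Lemma modulus_Rint_cvg h M : I (fun z => Vabs h z * modulus s M k z) @[k --> \oo] --> 0.
Proof.
have [K K0 HK] : exists2 K, 0 <= K & forall z, `|Vabs h z * (4 * n%:R * wt z ^+ (M + M).+1)| <= K * (wt z)^-1.
  apply: (rapid_growth (C := 4 * n%:R) (M := (M + M).+1) (Vabs_rapid h)) => z.
  by rewrite ger0_norm//; apply: mulr_ge0; [exact: mulr_ge0|apply: exprn_ge0; exact: wt_ge0].
have c0 z : Vabs h z * modulus s M k z @[k --> \oo] --> 0.
  by have := cvgM (cvg_cst (Vabs h z)) (modulus_cvg scvg M z); rewrite mulr0; apply.
have dom k z : `|Vabs h z * modulus s M k z| <= K * (wt z)^-1.
  have t0 : 0 <= 4 * n%:R * wt z ^+ (M + M).+1.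
    by apply: mulr_ge0; [exact: mulr_ge0|apply: exprn_ge0; exact: wt_ge0].
  apply: le_trans (HK z); rewrite !ger0_norm; last first.
  - by apply: mulr_ge0; [exact: Vabs_ge0|exact: modulus_ge0].
  - by apply: mulr_ge0; [exact: Vabs_ge0|].
  by apply: ler_wpM2l; [exact: Vabs_ge0|exact: modulus_le].
have [_] := @Rint_dct _ _ _ lphase (fun k z => Vabs h z * modulus s M k z) (fun=> 0) (fun z => K * (wt z)^-1)
  (fun k => intg_measurable (intg_modulus h M k)) c0 (intgZ K (intg_invwt R n)) dom.
by rewrite [X in _ --> X](_ : _ = 0)// /Rintegral integral0.
Qed.

(** The function [g] is the finite sum of coherent states at the values v of [s k], each weighted by
    the integral of V_{phi_0}h over the fibre of v. One [g] serves all seminorms and all [u]: the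
    seminorm estimate follows from the differentiated inversion formulas, the other from linearity
    and the triangle inequality. *)
Lemma simple_synthesis h k : exists g : schwartz R n,
  (forall N C M, 0 <= C -> (forall z z', schwartz_le N (C * pdist z z' * (wt z * wt z') ^+ M) (coherent z - coherent z')) ->
     schwartz_le N (2 * (C * I (fun z => Vabs h z * modulus s M k z))) (g - Complex kappa 0 *: h)) /\
  forall u, cabs (u g) <= I (fun z => Vabs h z * cabs (stft u (s k z))).
Proof.
have [L uL sL] := simple_map_range (ss k).
pose cR v := I (fun z => VR h z * (s k z == v)%:R).
pose cI v := I (fun z => VI h z * (s k z == v)%:R).
exists (\sum_(v <- L) Complex (cR v) (cI v) *: coherent v).
have iR := rapid_intg1 (VR_rapid h); have iI := rapid_intg1 (VI_rapid h).
have iV := rapid_intg1 (Vabs_rapid h).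
split; last first.
  move=> u; rewrite tempered_sum (le_trans (cabs_sum _ _))//.
  have [iU <-] := Rint_simple (fun v => cabs (stft u v)) (ss k) uL sL iV.
  apply: ler_sum => v _; rewrite cabsM cabs_conj mulrC; apply: ler_wpM2l; first exact: cabs_ge0.
  apply: (le_trans (cabs_le _)) => /=.
  have nA (A : phase -> R) : intg A -> intg (fun z => `|A z| * (s k z == v)%:R).
    by move=> iA; apply: intg_simple_eq => //; exact: integrable_norm.
  have lA (A : phase -> R) : intg A -> `|I (fun z => A z * (s k z == v)%:R)| <= I (fun z => `|A z| * (s k z == v)%:R).
    move=> iA; apply: Rint_le_dom (nA A iA); first exact: (intg_measurable (intg_simple_eq v (ss k) iA)).
    by move=> z; rewrite normrM [`|_%:R|]ger0_norm.
  apply: (le_trans (lerD (lA _ iR) (lA _ iI))).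
  rewrite -RintegralD//; [|exact: nA|exact: nA].
  by under [leRHS]eq_Rintegral do rewrite mulrDl.
move=> N C M C0 H; apply: schwartz_le_parts => a b aN bN x.
set g := \sum_(v <- L) _.
have E : cpartials b (g - Complex kappa 0 *: h) x = 
  \sum_(v <- L) Complex (cR v) (cI v) * cpartials b (coherent v) x - Complex kappa 0 * cpartials b h x.
  by rewrite cpartialsB cpartials_sum cpartialsZ.
pose p v := partials b (cohR v) x; pose q v := partials b (cohI v) x.
have Hz z : `|monomial a x * p (s k z) - monomial a x * p z| <= C * modulus s M k z /\
  `|monomial a x * q (s k z) - monomial a x * q z| <= C * modulus s M k z.
  have := H (s k z) z a b aN bN x; rewrite cpartialsB.
  move=> /le_trans h1; have {}h1 := h1 (C * modulus s M k z).
  have mm : C * pdist (s k z) z * (wt (s k z) * wt z) ^+ M <= C * modulus s M k z.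
    by rewrite -(mulrA C); apply: ler_wpM2l => //; exact: le_modulus.
  have {}h1 := h1 mm.
  split; rewrite -mulrBr normrM; apply: le_trans h1; apply: ler_wpM2l => //.
    exact: (cabs_Re (cpartials b (coherent (s k z)) x - cpartials b (coherent z) x)).
  exact: (cabs_Im (cpartials b (coherent (s k z)) x - cpartials b (coherent z) x)).
have ip A : rapid A -> intg (fun z => A z * p z).
  by move=> rA; exact: (rapid_coh x rA (coh_partials b (coh_cohR R n))).
have iq A : rapid A -> intg (fun z => A z * q z).
  by move=> rA; exact: (rapid_coh x rA (coh_partials b (coh_cohI R n))).
have iD : intg (fun z => (`|VR h z| + `|VI h z|) * (C * modulus s M k z)).
  have := intgZ C (intg_modulus h M k).
  by apply: eq_integrable => // z _ /=; congr EFin; rewrite mulrCA.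
have EC : C * I (fun z => Vabs h z * modulus s M k z) = I (fun z => (`|VR h z| + `|VI h z|) * (C * modulus s M k z)).
  rewrite -RintegralZl//; last exact: intg_modulus.
  by apply: eq_Rintegral => z _; rewrite mulrCA.
rewrite E EC; split.
  have -> : complex.Re (\sum_(v <- L) Complex (cR v) (cI v) * cpartials b (coherent v) x - Complex kappa 0 * cpartials b h x)
    = \sum_(v <- L) (p v * I (fun z => VR h z * (s k z == v)%:R) + q v * I (fun z => - VI h z * (s k z == v)%:R)) -
      I (fun z => VR h z * p z + - VI h z * q z).
    rewrite hR_partials [LHS](_ : _ = complex.Re (\sum_(v <- L) Complex (cR v) (cI v) * cpartials b (coherent v) x) -
       complex.Re (Complex kappa 0 * cpartials b h x)); last by case: (\sum_(_ <- _) _) (_ * _) => ? ? [].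
    rewrite Re_sum; congr (_ - _); last by rewrite /= mul0r subr0.
    apply: eq_bigr => v _ /=; rewrite [cR v * _]mulrC; congr (_ + _).
    rewrite mulrC -mulrN; congr (_ * _).
    rewrite /cI -mulN1r -RintegralZl//; last exact: intg_simple_eq.
    by apply: eq_Rintegral => z _; rewrite mulN1r mulNr.
  have := @simple_error _ _ _ lphase (s k) L (VR h) (fun z => - VI h z) p q (fun z => C * modulus s M k z) (monomial a x)
    (ss k) uL sL iR (rapid_intg1 (rapidN (VI_rapid h))) (ip _ (VR_rapid h)) (iq _ (rapidN (VI_rapid h)))
    (fun z => (Hz z).1) (fun z => (Hz z).2).
  rewrite (_ : (fun z => (`|VR h z| + `|- VI h z|) * (C * modulus s M k z)) =
    (fun z => (`|VR h z| + `|VI h z|) * (C * modulus s M k z))); first by apply.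
  by apply/funext => z; rewrite normrN.
have -> : complex.Im (\sum_(v <- L) Complex (cR v) (cI v) * cpartials b (coherent v) x - Complex kappa 0 * cpartials b h x)
    = \sum_(v <- L) (q v * I (fun z => VR h z * (s k z == v)%:R) + p v * I (fun z => VI h z * (s k z == v)%:R)) -
      I (fun z => VR h z * q z + VI h z * p z).
  rewrite hI_partials [LHS](_ : _ = complex.Im (\sum_(v <- L) Complex (cR v) (cI v) * cpartials b (coherent v) x) -
     complex.Im (Complex kappa 0 * cpartials b h x)); last by case: (\sum_(_ <- _) _) (_ * _) => ? ? [].
  rewrite Im_sum; congr (_ - _); last by rewrite /= mul0r addr0.
  by apply: eq_bigr => v _ /=; rewrite [cR v * _]mulrC [cI v * _]mulrC.
exact: (@simple_error _ _ _ lphase (s k) L (VR h) (VI h) q p (fun z => C * modulus s M k z) (monomial a x)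
    (ss k) uL sL iR iI (iq _ (VR_rapid h)) (ip _ (VI_rapid h))
    (fun z => (Hz z).2) (fun z => (Hz z).1) iD).
Qed.

Lemma stft_cabs_lipschitz u : exists C M, 0 <= C /\ (forall z, `|cabs (stft u z)| <= C * wt z ^+ M) /\
  forall z z', `|cabs (stft u z) - cabs (stft u z')| <= C * (pdist z z' * (wt z * wt z') ^+ M).
Proof.
have [C [M [C0 [H1 H2]]]] := stft_growth u.
exists C, M; split => //; split => [z|z z']; first by rewrite ger0_norm ?cabs_ge0.
by apply: le_trans (H2 z z'); exact: cabs_lip.
Qed.

Lemma measurable_stft u : measurable_fun setT (fun z => cabs (stft u z)).
Proof.
have [C [M [C0 [_ H]]]] := stft_cabs_lipschitz u.
exact: (lipschitz_measurable ss sle scvg C0 H).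
Qed.

Lemma intg_Vabs_stft h u : intg (fun z => Vabs h z * cabs (stft u z)).
Proof.
have [C [M [C0 [H _]]]] := stft_cabs_lipschitz u.
exact: (rapid_intg (Vabs_rapid h) (measurable_stft u) H).
Qed.

Lemma stft_simple_cvg h u : I (fun z => Vabs h z * cabs (stft u (s k z))) @[k --> \oo] -->
  I (fun z => Vabs h z * cabs (stft u z)).
Proof.
have [C [M [C0 [H1 H2]]]] := stft_cabs_lipschitz u.
have [K K0 HK] : exists2 K, 0 <= K & forall z, `|Vabs h z * (C * wt z ^+ M)| <= K * (wt z)^-1.
  apply: (rapid_growth (C := C) (M := M) (Vabs_rapid h)) => z.
  by rewrite ger0_norm//; apply: mulr_ge0 => //; apply: exprn_ge0; exact: wt_ge0.
have mk k : measurable_fun setT (fun z => Vabs h z * cabs (stft u (s k z))).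
  apply: measurable_funM; first exact: (Vabs_rapid h).1.
  exact: (measurable_simple_comp (fun z => cabs (stft u z)) (ss k)).
have c0 z : Vabs h z * cabs (stft u (s k z)) @[k --> \oo] --> Vabs h z * cabs (stft u z).
  by apply: cvgM; [exact: cvg_cst|exact: (lipschitz_cvg sle scvg C0 H2)].
have dom k z : `|Vabs h z * cabs (stft u (s k z))| <= K * (wt z)^-1.
  apply: le_trans (HK z); rewrite !normrM; apply: ler_wpM2l => //.
  apply: (le_trans (H1 _)); rewrite -normrM ger0_norm; last first.
    by apply: mulr_ge0 => //; apply: exprn_ge0; exact: wt_ge0.
  apply: ler_wpM2l => //; apply: lerXn2r; rewrite ?nnegrE ?wt_ge0//.
  exact: wt_simple_le.
by have [_] := Rint_dct mk c0 (intgZ K (intg_invwt R n)) dom.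
Qed.

Lemma kappa_cabs_le h u : kappa * cabs (u h) <= I (fun z => Vabs h z * cabs (stft u z)).
Proof.
have [N [K [K0 HK]]] := tempered_bound u.
have [C [M [C0 [_ HL]]]] := coherent_seminorm R n N.
pose dl k := I (fun z => Vabs h z * modulus s M k z).
have dl0 k : 0 <= dl k.
  apply: Rintegral_ge0 => // z _; apply: mulr_ge0; [exact: Vabs_ge0|exact: modulus_ge0].
(* The term 1/(k+1) keeps the seminorm bound strictly positive for [tempered_bound] and disappears
   in the limit. *)
pose r k := I (fun z => Vabs h z * cabs (stft u (s k z))) + K * (2 * (C * dl k) + k.+1%:R^-1).
have rle k : kappa * cabs (u h) <= r k.
  have [g [g1 g2]] := simple_synthesis h k.
  have -> : kappa * cabs (u h) = cabs (u (Complex kappa 0 *: h)).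
    by rewrite temperedZ cabsM cabs_conj cabs_real gtr0_norm// kappa_gt0.
  have -> : u (Complex kappa 0 *: h) = u g - u (g - Complex kappa 0 *: h).
    by rewrite temperedB opprB addrC subrK.
  apply: (le_trans (cabsD _ _)); apply: lerD; first exact: g2.
  have p0 : 0 < k.+1%:R^-1 :> R by rewrite invr_gt0 ltr0n.
  have q0 : 0 <= 2 * (C * dl k) by apply: mulr_ge0 => //; exact: mulr_ge0.
  rewrite cabsN; apply: HK; first by rewrite ltr_wpDl.
  by apply: schwartz_le_mono (g1 N C M C0 HL) => //; rewrite lerDl ltW.
have rc : r k @[k --> \oo] --> I (fun z => Vabs h z * cabs (stft u z)) + K * (2 * (C * 0) + 0).
  apply: cvgD; first exact: stft_simple_cvg.
  apply: cvgM; first exact: cvg_cst.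
  apply: cvgD; last exact: cvg_harmonic.
  apply: cvgM; first exact: cvg_cst.
  apply: cvgM; first exact: cvg_cst.
  exact: modulus_Rint_cvg.
rewrite mulr0 mulr0 addr0 mulr0 addr0 in rc.
rewrite -(cvg_lim _ rc)//; apply: limr_ge; first by apply/cvg_ex; eexists; exact: rc.
by near=> k; exact: rle.
Unshelve. all: by end_near. Qed.

End key_inequality.

Section evaluation.
Context (R : realType) (n : nat).
Local Notation phase := ('rV[R]_n * 'rV[R]_n)%type.
Implicit Types (u : tempered R n) (h : schwartz R n) (z : phase).

Lemma measurable_cabs_stft u : measurable_fun setT (fun z => cabs (stft u z)).
Proof. by have [s [ss sle scvg]] := @simple_approx_phase R n; exact: (measurable_stft ss sle scvg). Qed.

Lemma schwartz_le_ge0 N e h : schwartz_le N e h -> 0 <= e.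
Proof.
move=> /(_ [::] [::] isT isT 0); apply: le_trans; apply: mulr_ge0 => //; exact: cabs_ge0.
Qed.

Definition weighted u : \bar R := (\int[lphase R n]_z ((wt z)^-1 * cabs (stft u z))%:E)%E.

(** The constant and the order of the seminorm are chosen before [u], so the estimate can be applied
    simultaneously to all T pi(w)phi_0. The right side may be infinite, hence no integrability is
    asked of [u]. *)
Lemma weighted_bound : exists C N, 0 <= C /\ forall h e, schwartz_le N e h ->
  forall u, ((cabs (u h))%:E <= (C * e)%:E * weighted u)%E.
Proof.
have [C [N [C0 H]]] := V_bound R n.
have k0 := kappa_gt0 R n.
exists ((kappa R n)^-1 * C), N; split; first by apply: mulr_ge0 => //; rewrite invr_ge0 ltW.
move=> h e he u; have e0 := schwartz_le_ge0 he.
have [s [ss sle scvg]] := @simple_approx_phase R n.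
have := kappa_cabs_le ss sle scvg h u.
rewrite -ler_pdivlMl// => /le_trans h1.
have mU : measurable_fun setT (fun z => ((wt z)^-1 * cabs (stft u z))%:E).
  apply/measurable_EFinP; apply: measurable_funM; last exact: measurable_cabs_stft.
  exact: (intg_measurable (intg_invwt R n)).
have w0 z : 0 <= (wt z)^-1 * cabs (stft u z).
  by apply: mulr_ge0; [rewrite invr_ge0 wt_ge0|exact: cabs_ge0].
have := h1 _ (lexx _); rewrite -lee_fin => /le_trans; apply.
rewrite EFinM RintE; last exact: intg_Vabs_stft.
rewrite -mulrA EFinM -muleA; apply: lee_wpmul2l; first by rewrite lee_fin invr_ge0 ltW.
rewrite /weighted -ge0_integralZl//; last 2 first.
- by move=> z _; rewrite lee_fin.
- by rewrite lee_fin mulr_ge0.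
apply: ge0_le_integral => //.
- by move=> z _; rewrite lee_fin; apply: mulr_ge0; [exact: Vabs_ge0|exact: cabs_ge0].
- by apply/measurable_EFinP; exact: intg_measurable (intg_Vabs_stft ss sle scvg h u).
- by apply/measurable_EFinP; apply: measurable_funM; [exact: measurable_cst|exact/measurable_EFinP].
move=> z _; rewrite -EFinM lee_fin mulrA; apply: ler_wpM2r; first exact: cabs_ge0.
exact: H.
Qed.

End evaluation.

(** * Operators and summability *)

Section mixed_norms.
Context d (T : measurableType d) (R : realType) (m : {sigma_finite_measure set T -> \bar R}).
Local Notation intg f := (m.-integrable setT (EFin \o f)).

(** Only k > x matters: there k = k^(1-p) k^p, and the exponent 1 - p is nonpositive, so k^(1-p) <=
    x^(1-p). *)
Lemma powR_young (x k p : R) : 0 < x -> 0 <= k -> 1 <= p -> k <= x + x `^ (1 - p) * k `^ p.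
Proof.
move=> x0 k0 p1; have [kx|xk] := leP k x.
  by rewrite (le_trans kx)// lerDl mulr_ge0// powR_ge0.
have k1 : 0 < k by exact: lt_trans xk.
rewrite (@le_trans _ _ (x `^ (1 - p) * k `^ p))//; last by rewrite lerDr ltW.
have -> : k `^ p = k `^ (p - 1) * k.
  by rewrite -{3}(powRr1 k0) -powRD ?subrK//; apply/implyP => _; rewrite gt_eqF.
rewrite mulrA ler_peMl// (@le_trans _ _ (x `^ (1 - p) * x `^ (p - 1)))//.
  rewrite -powRD; first by rewrite addrC subrKA subrr powRr0.
  by apply/implyP => _; rewrite gt_eqF.
apply: ler_wpM2l; first exact: powR_ge0.
by apply: ge0_ler_powR; rewrite ?nnegrE ?subr_ge0// ltW.
Qed.

Lemma measurable_powR_comp d' (T' : measurableType d') (f : T' -> R) p : measurable_fun setT f ->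
  measurable_fun setT (fun x => f x `^ p).
Proof. exact: (@measurableT_comp _ _ _ _ _ _ (@powR R ^~ p)). Qed.

Lemma hoelder_conjugate_le (f g : T -> R) p : 1 <= p ->
  measurable_fun setT f -> measurable_fun setT g -> (forall x, 0 <= f x) -> (forall x, 0 <= g x) ->
  (\int[m]_x (f x * g x)%:E <= Lnorm m (hoelder_conjugate p%:E) (EFin \o f) * Lnorm m p%:E (EFin \o g))%E.
Proof.
move=> p1 mf mg f0 g0.
have fg0 x : 0 <= f x * g x by exact: mulr_ge0.
have p0 : 0 < p by exact: lt_le_trans p1.
have [->|pn1] := eqVneq p 1.
  rewrite hoelder_conjugate1 Lnorm1; set N := Lnorm _ _ _.
  have N0 : (0 <= N)%E by exact: Lnorm_ge0.
  under [X in (_ <= N * X)%E]eq_integral do rewrite /= ger0_norm//.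
  rewrite -ge0_integralZl//; [|exact/measurable_EFinP|by move=> x _; rewrite lee_fin].
  apply: ae_ge0_le_integral => //.
  - by move=> x _; rewrite lee_fin.
  - by apply/measurable_EFinP; exact: measurable_funM.
  - by move=> x _; apply: mule_ge0; rewrite // lee_fin.
  - by apply: measurable_funeM; exact/measurable_EFinP.
  have : {ae m, forall x, ((f x)%:E <= N)%E}.
    rewrite /N unlock; case: ifPn => m0.
      have := @ess_sup_ge _ _ _ m (abse \o (EFin \o f)).
      by apply: filterS => x /=; rewrite ger0_norm.
    (* The sup norm is defined by a separate branch when the whole space does not have positive
       measure; the whole space is then a null set. *)
    exists setT; split => //; apply/eqP; rewrite eq_le measure_ge0 andbT leNgt.
    exact: m0.
  apply: filterS => x fN _; rewrite EFinM; apply: lee_wpmul2r => //.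
  by rewrite lee_fin.
have p1' : 1 < p by rewrite lt_neqAle eq_sym pn1.
have pm : p - 1 != 0 by rewrite subr_eq0.
pose q := p / (p - 1).
have q0 : 0 < q by rewrite divr_gt0// subr_gt0.
have pq : q^-1 + p^-1 = 1 by rewrite /q; field; rewrite pm gt_eqF.
have <- : q%:E = hoelder_conjugate p%:E.
  apply/hoelder_conjugateP; [exact: ltNyr|by rewrite eqe gt_eqF|].
  rewrite !inver !gt_eqF//= -EFinD addrC pq//.
have := hoelder m mf mg q0 p0 pq; rewrite Lnorm1.
by under eq_integral do rewrite /= ger0_norm//.
Qed.

Lemma le_Lnorm_scale (F : T -> R) (G : T -> \bar R) (c p : R) : 0 < p -> 0 <= c ->
  measurable_fun setT F -> measurable_fun setT G -> (forall x, 0 <= F x) -> (forall x, 0 <= G x)%E ->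
  (forall x, ((F x)%:E <= c%:E * G x)%E) ->
  ((\int[m]_x (F x `^ p)%:E) `^ p^-1 <= c%:E * (\int[m]_x (G x `^ p)) `^ p^-1)%E.
Proof.
move=> p0 c0 mF mG F0 G0 FG.
have I0 : (0 <= \int[m]_x (G x `^ p))%E by apply: integral_ge0 => w _; exact: poweR_ge0.
have -> : (c%:E * (\int[m]_x (G x `^ p)) `^ p^-1 = ((c%:E `^ p) * \int[m]_x (G x `^ p)) `^ p^-1)%E.
  rewrite poweRM; [|exact: poweR_ge0|exact: I0].
  by rewrite -poweRrM mulfV ?gt_eqF// poweRe1// lee_fin.
apply: gt0_ler_poweR; first by rewrite invr_ge0 ltW.
- by rewrite in_itv/= leey andbT; apply: integral_ge0 => w _; rewrite lee_fin powR_ge0.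
- by rewrite in_itv/= leey andbT; apply: mule_ge0 I0; rewrite lee_fin powR_ge0.
rewrite -ge0_integralZl//; last 3 first.
- exact: measurableT_comp (measurable_poweR p) mG.
- by move=> w _; exact: poweR_ge0.
- exact: poweR_ge0.
apply: ge0_le_integral => //.
- by move=> w _; rewrite lee_fin powR_ge0.
- by apply/measurable_EFinP; exact: measurable_powR_comp.
- by apply: measurable_funeM; exact: measurableT_comp (measurable_poweR p) mG.
move=> w _; rewrite -poweRM// -poweR_EFin; apply: gt0_ler_poweR; first exact: ltW.
- by rewrite in_itv/= leey andbT lee_fin.
- by rewrite in_itv/= leey andbT mule_ge0.
exact: FG.
Qed.

(* Minkowski-type bound by Young's inequality k <= la G + (la G)^(1-p) k^p, with
   G = 1 + |k(., z)|_p and la chosen for each w; no duality is needed. *)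
Lemma weighted_mixed_norm (om : T -> R) (k : T * T -> R) p q :
  (forall z, 0 < om z <= 1) -> intg om -> measurable_fun setT k -> (forall wz, 0 <= k wz) ->
  1 <= p -> 1 <= q ->
  (\int[m]_z (\int[m]_w (k (w, z) `^ p)%:E) `^ (q / p) < +oo)%E ->
  (\int[m]_w (\int[m]_z (om z * k (w, z))%:E) `^ p < +oo)%E.
Proof.
move=> om01 iom mk k0 p1 q1 fin.
have p0 : 0 < p by exact: lt_le_trans p1.
have q0 : 0 < q by exact: lt_le_trans q1.
have om0 z : 0 < om z by have /andP[] := om01 z.
have mom := intg_measurable iom.
have mkp : measurable_fun setT (fun wz => (k wz `^ p)%:E).
  by apply/measurable_EFinP; exact: measurable_powR_comp.
pose G0 z := (\int[m]_w (k (w, z) `^ p)%:E)%E.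
have G00 z : (0 <= G0 z)%E by apply: integral_ge0 => w _; rewrite lee_fin powR_ge0.
have mG0 : measurable_fun setT G0.
  apply: (@measurable_fun_fubini_tonelli_G _ _ _ _ _ m (fun wz => (k wz `^ p)%:E)) => //.
  by move=> x; rewrite lee_fin powR_ge0.
(* [fine] sends an infinite slice norm to 0. The finite mixed norm confines this to a null set,
   which is why the comparison in [Hfin] is made almost everywhere. *)
pose g z := fine (G0 z `^ p^-1)%E.
have g0 z : 0 <= g z by rewrite fine_ge0// poweR_ge0.
have mg : measurable_fun setT g.
  exact: (measurableT_comp (fine_measurable measurableT) (measurableT_comp (measurable_poweR p^-1) mG0)).
pose G z := 1 + g z.
have G1 z : 1 <= G z by rewrite lerDl.
have Gp z : 0 < G z by exact: lt_le_trans (G1 z).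
have mG : measurable_fun setT G by exact: measurable_funD.
have gq z : ((g z `^ q)%:E <= G0 z `^ (q / p))%E.
  rewrite [q / p]mulrC poweRrM /g; case: (G0 z `^ p^-1)%E (poweR_ge0 (G0 z) p^-1) => //= _.
  by rewrite powR0 ?gt_eqF// leey.
have mGq : measurable_fun setT (fun z => G0 z `^ (q / p))%E.
  exact: (measurableT_comp (measurable_poweR _) mG0).
have iomG : intg (fun z => om z * G z).
  apply: ge0_intg; [exact: measurable_funM|by move=> z; rewrite mulr_ge0// ltW|].
  apply: (@le_lt_trans _ _ (\int[m]_z ((2 * om z)%:E + G0 z `^ (q / p)))%E).
    apply: ge0_le_integral => //.
    - by move=> z _; rewrite lee_fin mulr_ge0// ltW.
    - by apply/measurable_EFinP; exact: measurable_funM.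
    - by apply: emeasurable_funD => //; apply/measurable_EFinP; exact: measurable_funM.
    move=> z _; apply: (@le_trans _ _ ((2 * om z)%:E + (g z `^ q)%:E)%E); last exact: leeD2l.
    rewrite -EFinD lee_fin; case/andP: (om01 z) => o0 o1.
    (* This uses 1 <= q; together with om <= 1 it bounds om G by 2 om plus the q-th power of the
       slice norm, both of finite integral. *)
    have gg : g z <= 1 + g z `^ q.
      have [g1|g1] := leP (g z) 1; first by rewrite (le_trans g1)// lerDl powR_ge0.
      rewrite (@le_trans _ _ (g z `^ q))//; last by rewrite lerDr.
      by rewrite -{1}(powRr1 (g0 z)) ler_powR// ltW.
    rewrite /G mulrDr mulr1 mulr_natl mulr2n -addrA lerD2l.
    apply: (@le_trans _ _ (om z * (1 + g z `^ q))); first by rewrite ler_pM2l.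
    by rewrite mulrDr mulr1 lerD2l ler_piMl// powR_ge0.
  rewrite ge0_integralD//.
  - have := intgZ 2 iom; move=> /integrableP[_].
    under eq_integral do rewrite /= ger0_norm ?mulr_ge0 ?(ltW (om0 _))//.
    by move=> h; rewrite lte_add_pinfty.
  - by move=> z _; rewrite lee_fin mulr_ge0// ltW.
  - by apply/measurable_EFinP; exact: measurable_funM.
  - by move=> z _; exact: poweR_ge0.
have [a aE a0] : exists2 a : R, (\int[m]_z (om z * G z)%:E = a%:E)%E & 0 <= a.
  exists (Rintegral m setT (fun z => om z * G z)); first by rewrite RintE.
  by apply: Rintegral_ge0 => // z _; rewrite mulr_ge0// ltW.
(* The second Young term with its power of [la] removed. Integrated in w it gives om G^(1-p) g^p <=
   om G, so [H] is integrable by Tonelli. *)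
pose h (wz : T * T) := om wz.2 * (G wz.2 `^ (1 - p) * k wz `^ p).
have h0 wz : 0 <= h wz by rewrite mulr_ge0 ?(ltW (om0 _))// mulr_ge0// powR_ge0.
have mh : measurable_fun setT h.
  apply: measurable_funM; first exact: measurableT_comp mom measurable_snd.
  apply: measurable_funM; last exact: measurable_powR_comp.
  by apply: measurable_powR_comp; exact: measurableT_comp mG measurable_snd.
pose H w := (\int[m]_z (h (w, z))%:E)%E.
have H0 w : (0 <= H w)%E by apply: integral_ge0 => z _; rewrite lee_fin.
have mH : measurable_fun setT H.
  apply: (@measurable_fun_fubini_tonelli_F _ _ _ _ _ m (EFin \o h)); first exact/measurable_EFinP.
  by move=> x; rewrite lee_fin.
have Hfin : (\int[m]_w H w <= \int[m]_z (om z * G z)%:E)%E.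
  rewrite /H (@fubini_tonelli _ _ _ _ _ m m (EFin \o h)); [|exact/measurable_EFinP|by move=> x; rewrite lee_fin].
  apply: ae_ge0_le_integral; first exact: measurableT.
  - by move=> z _; apply: integral_ge0 => w _; rewrite lee_fin.
  - apply: (@measurable_fun_fubini_tonelli_G _ _ _ _ _ m (EFin \o h)); first exact/measurable_EFinP.
    by move=> x; rewrite lee_fin.
  - by move=> z _; rewrite lee_fin mulr_ge0// ltW.
  - by apply/measurable_EFinP; exact: measurable_funM.
  have iGq : m.-integrable setT (fun z => G0 z `^ (q / p))%E.
    apply/integrableP; split => //.
    by under eq_integral do rewrite gee0_abs ?poweR_ge0//.
  have := integrable_ae measurableT iGq; apply: filterS => z /(_ I) Gf _ /=.
  have {Gf} Gf : G0 z \is a fin_num.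
    rewrite ge0_fin_numE//; apply: (@lty_poweRy _ _ (q / p)); first by rewrite gt_eqF// divr_gt0.
    by rewrite ltey_eq Gf.
  have -> : (\int[m]_w (h (w, z))%:E = (om z * G z `^ (1 - p))%:E * G0 z)%E.
    rewrite -ge0_integralZl//.
    - by apply: eq_integral => w _; rewrite /h/= -EFinM mulrA.
    - exact: measurableT_comp mkp (pair2_measurable z).
    - by move=> w _; rewrite lee_fin powR_ge0.
    - by rewrite lee_fin mulr_ge0 ?powR_ge0// ltW.
  have -> : G0 z = (g z `^ p)%:E.
    by rewrite /g fine_poweR -powRrM mulVf ?gt_eqF// powRr1 ?fine_ge0// fineK.
  rewrite -EFinM lee_fin -mulrA ler_pM2l//.
  apply: (@le_trans _ _ (G z `^ (1 - p) * G z `^ p)).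
    apply: ler_wpM2l; first exact: powR_ge0.
    by apply: ge0_ler_powR; rewrite ?nnegrE ?(ltW p0) ?(ltW (Gp z))// lerDr.
  rewrite -powRD; last by apply/implyP => _; rewrite gt_eqF.
  by rewrite subrK powRr1// ltW.
have F0p w : ((\int[m]_z (om z * k (w, z))%:E) `^ p <= ((a + 1) `^ p)%:E * (H w + (om w)%:E))%E.
  have a1 : 0 < a + 1 by rewrite ltr_wpDl.
  have [Hy|Hy] := eqVneq (H w) +oo%E.
    by rewrite Hy addye// gt0_muley ?leey// lte_fin powR_gt0.
  have Hf : H w \is a fin_num by rewrite ge0_fin_numE// lt_neqAle Hy leey.
  pose hw := fine (H w); have HwE : H w = hw%:E by rewrite fineK.
  have hw0 : 0 <= hw by rewrite fine_ge0.
  have s0 : 0 < hw + om w by rewrite ltr_wpDl.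
  (* With this choice la^(1-p) H(w) <= la^(1-p) la^p = la, so both Young terms are multiples of
     [la], whose p-th power is integrable in w. The summand [om w] keeps [la] positive without
     spoiling integrability. *)
  pose la := (hw + om w) `^ p^-1.
  have la0 : 0 < la by rewrite powR_gt0.
  have lap : la `^ p = hw + om w by rewrite -powRrM mulVf ?gt_eqF// powRr1// ltW.
  have mhw : measurable_fun setT (fun z => h (w, z)) by exact: measurableT_comp mh (pair1_measurable w).
  have mkw : measurable_fun setT (fun z => k (w, z)) by exact: measurableT_comp mk (pair1_measurable w).
  have F0 : (\int[m]_z (om z * k (w, z))%:E <= (la * (a + 1))%:E)%E.
    apply: (@le_trans _ _ (\int[m]_z (la%:E * (om z * G z)%:E + (la `^ (1 - p))%:E * (h (w, z))%:E))%E).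
      apply: ge0_le_integral => //.
      - by move=> z _; rewrite lee_fin mulr_ge0// ltW.
      - by apply/measurable_EFinP; exact: measurable_funM.
      - apply: emeasurable_funD; apply/measurable_EFinP; apply: measurable_funM => //.
        exact: measurable_funM.
      move=> z _; rewrite -!EFinM -EFinD lee_fin /h/=.
      have := powR_young (mulr_gt0 la0 (Gp z)) (k0 (w, z)) p1.
      rewrite (powRM _ (ltW la0) (ltW (Gp z))) => Y.
      have -> : la * (om z * G z) + la `^ (1 - p) * (om z * (G z `^ (1 - p) * k (w, z) `^ p)) =
        om z * (la * G z + la `^ (1 - p) * G z `^ (1 - p) * k (w, z) `^ p) by ring.
      by rewrite ler_pM2l.
    rewrite ge0_integralD//; last 4 first.
    - by move=> z _; rewrite lee_fin mulr_ge0 ?(ltW la0)// mulr_ge0 ?(ltW (om0 _)) ?(ltW (Gp _)).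
    - by apply/measurable_EFinP; apply: measurable_funM => //; exact: measurable_funM.
    - by move=> z _; rewrite lee_fin mulr_ge0 ?powR_ge0.
    - by apply/measurable_EFinP; exact: measurable_funM.
    rewrite ge0_integralZl//; last 3 first.
    - by apply/measurable_EFinP; exact: measurable_funM.
    - by move=> z _; rewrite lee_fin mulr_ge0// ltW.
    - by rewrite lee_fin ltW.
    rewrite ge0_integralZl//; last 3 first.
    - exact/measurable_EFinP.
    - by move=> z _; rewrite lee_fin.
    - by rewrite lee_fin powR_ge0.
    rewrite aE -/(H w) HwE -!EFinM -EFinD lee_fin mulrDr mulr1 lerD2l.
    apply: (@le_trans _ _ (la `^ (1 - p) * la `^ p)).
      by apply: ler_wpM2l; [exact: powR_ge0|rewrite lap lerDl ltW].
    rewrite -powRD; last by apply/implyP => _; rewrite gt_eqF.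
    by rewrite subrK powRr1// ltW.
  have := gt0_ler_poweR (ltW p0) _ _ F0.
  rewrite !in_itv/= !leey !andbT lee_fin mulr_ge0 ?(ltW la0) ?(ltW a1)//.
  rewrite integral_ge0; last by move=> z _; rewrite lee_fin mulr_ge0// ltW.
  move=> /(_ isT isT) /le_trans; apply.
  by rewrite (powRM _ (ltW la0) (ltW a1)) lap HwE -EFinD -EFinM mulrC.
apply: (@le_lt_trans _ _ (\int[m]_w (((a + 1) `^ p)%:E * (H w + (om w)%:E)))%E).
  apply: ge0_le_integral => //.
  - by move=> w _; exact: poweR_ge0.
  - apply: (measurableT_comp (measurable_poweR _)).
    apply: (@measurable_fun_fubini_tonelli_F _ _ _ _ _ m (fun wz => (om wz.2 * k wz)%:E)).
      apply/measurable_EFinP; apply: measurable_funM => //.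
      exact: measurableT_comp mom measurable_snd.
    by move=> wz; rewrite lee_fin mulr_ge0// ltW.
  - by apply: measurable_funeM; apply: emeasurable_funD => //; exact/measurable_EFinP.
rewrite ge0_integralZl//; last 3 first.
- by apply: emeasurable_funD => //; exact/measurable_EFinP.
- by move=> w _; rewrite adde_ge0 ?lee_fin// ltW.
- by rewrite lee_fin powR_ge0.
rewrite lte_mul_pinfty ?lee_fin ?powR_ge0// ge0_integralD//; last 2 first.
- by move=> z _; rewrite lee_fin ltW.
- exact/measurable_EFinP.
apply: lte_add_pinfty; first by apply: (le_lt_trans Hfin); rewrite aE ltry.
by rewrite -RintE// ltry.
Qed.

End mixed_norms.

(** * Measurability and adjoints of operators *)

Section operators.
Context (R : realType) (n : nat).
Local Notation phase := ('rV[R]_n * 'rV[R]_n)%type.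
Implicit Types (u v : tempered R n) (h : schwartz R n) (z w : phase) (T : operator R n).
Local Notation lphase := (lphase R n).
Local Notation intg f := (lphase.-integrable setT (EFin \o f)).
Local Notation I f := (Rintegral lphase setT f).

Lemma measurable_stft_parts u : measurable_fun setT (fun z => complex.Re (stft u z)) /\
  measurable_fun setT (fun z => complex.Im (stft u z)).
Proof.
have [s [ss sle scvg]] := @simple_approx_phase R n.
have [C [M [C0 [_ H]]]] := stft_growth u.
split; apply: (lipschitz_measurable ss sle scvg C0) => z z'; apply: le_trans (H z z').
  by apply: le_trans (cabs_Re _); case: (stft u z) (stft u z') => ? ? [].
by apply: le_trans (cabs_Im _); case: (stft u z) (stft u z') => ? ? [].
Qed.

Definition cintegrable (F : phase -> Cplx R) :=
  intg (fun z => complex.Re (F z)) /\ intg (fun z => complex.Im (F z)).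

Lemma cintegral_lin (k : Cplx R) (F G : phase -> Cplx R) : cintegrable F -> cintegrable G ->
  cintegral (fun z => k * F z + G z) = k * cintegral F + cintegral G.
Proof.
move=> [rF iF] [rG iG]; case: k => a b.
have E (c d : R) (f g h : phase -> R) : intg f -> intg g -> intg h ->
    I (fun z => c * f z + d * g z + h z) = c * I f + d * I g + I h.
  move=> If Ig Ih; have j1 := intgZ c If; have j2 := intgZ d Ig.
  by rewrite (RintegralD measurableT (intgD j1 j2) Ih) (RintegralD measurableT j1 j2) !RintegralZl.
have ReE z : complex.Re (Complex a b * F z + G z) = a * complex.Re (F z) + - b * complex.Im (F z) + complex.Re (G z).
  by case: (F z) (G z) => ? ? [? ?]; rewrite /= mulNr.
have ImE z : complex.Im (Complex a b * F z + G z) = a * complex.Im (F z) + b * complex.Re (F z) + complex.Im (G z).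
  by case: (F z) (G z) => ? ? [? ?].
rewrite /cintegral -[lebesgue_phase R n]/(lphase : {measure set phase -> \bar R}).
rewrite (funext ReE) (funext ImE) !E//.
by rewrite -[RHS]/(Complex _ _); congr Complex; rewrite /= mulNr.
Qed.

(** The factor 2 comes from bounding the real and imaginary integrals separately; the summing
    constant is free, so the sharp constant is not sought. *)
Lemma cabs_cintegral (F : phase -> Cplx R) (D : phase -> R) : cintegrable F ->
  (forall z, cabs (F z) <= D z) -> intg D -> cabs (cintegral F) <= 2 * I D.
Proof.
move=> [rF iF] FD iD; apply: (le_trans (cabs_le _)); rewrite mulr_natl mulr2n /cintegral.
rewrite -[lebesgue_phase R n]/(lphase : {measure set phase -> \bar R}) /=.
apply: lerD; apply: Rint_le_dom iD => [|z].
- exact: intg_measurable rF.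
- exact: le_trans (cabs_Re _) (FD z).
- exact: intg_measurable iF.
- exact: le_trans (cabs_Im _) (FD z).
Qed.

Lemma cintegrable_pairing u v : (\int[lphase]_z (cabs (stft u z) * cabs (stft v z))%:E < +oo)%E ->
  cintegrable (fun z => stft u z * cconj (stft v z)).
Proof.
move=> fin.
have [mu1 mu2] := measurable_stft_parts u; have [mv1 mv2] := measurable_stft_parts v.
have ib : intg (fun z => cabs (stft u z) * cabs (stft v z)).
  apply: ge0_intg fin; last by move=> z; apply: mulr_ge0; exact: cabs_ge0.
  by apply: measurable_funM; exact: measurable_cabs_stft.
have le z : cabs (stft u z * cconj (stft v z)) = cabs (stft u z) * cabs (stft v z).
  by rewrite cabsM cabs_conj.
have ReE : (fun z => complex.Re (stft u z * cconj (stft v z))) = (fun z =>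
   complex.Re (stft u z) * complex.Re (stft v z) + complex.Im (stft u z) * complex.Im (stft v z)).
  by apply/funext => z; case: (stft u z) (stft v z) => ? ? [? ?] /=; rewrite mulrN opprK.
have ImE : (fun z => complex.Im (stft u z * cconj (stft v z))) = (fun z =>
   complex.Im (stft u z) * complex.Re (stft v z) - complex.Re (stft u z) * complex.Im (stft v z)).
  by apply/funext => z; case: (stft u z) (stft v z) => ? ? [? ?] /=; rewrite mulrN addrC.
split; apply: (intg_dom _ _ ib).
- by rewrite ReE; apply: measurable_funD; apply: measurable_funM.
- by move=> z; rewrite -le; exact: cabs_Re.
- by rewrite ImE; apply: measurable_funB; apply: measurable_funM.
- by move=> z; rewrite -le; exact: cabs_Im.
Qed.

Lemma stft_adjoint T h w : cabs (stft (adjoint T h) w) = cabs (T (coherent w) h).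
Proof. by rewrite /stft /= cabs_conj. Qed.

(** A Caratheodory argument: for fixed z the kernel is, up to conjugation, a short-time Fourier
    transform in w and hence of measurable modulus; for fixed w it is Lipschitz in z with a constant
    of polynomial growth, so z may be replaced by simple approximations. *)
Lemma measurable_gabor_kernel T :
  measurable_fun setT (fun wz : phase * phase => cabs (gabor_kernel T wz.1 wz.2)).
Proof.
have [s [ss sle scvg]] := @simple_approx_phase R n.
apply: (@measurable_fun_cvg _ _ _ _ (fun k (wz : phase * phase) => cabs (gabor_kernel T wz.1 (s k wz.2)))).
  move=> k; apply: (measurable_simple_arg (F := fun w z => cabs (gabor_kernel T w z)) (ss k)) => v.
  apply: eq_measurable_fun (measurable_cabs_stft (adjoint T (coherent v))) => w _.
  exact: stft_adjoint.
move=> [w z] _ /=; have [C [M [C0 [_ H]]]] := stft_cabs_lipschitz (T (coherent w)).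
exact: (lipschitz_cvg sle scvg C0 H).
Qed.

Lemma modulation_normE (p : R) u : modulation_norm p%:E u =
  ((\int[lphase]_z (cabs (stft u z) `^ p)%:E) `^ p^-1)%E.
Proof.
rewrite /modulation_norm unlock -[lebesgue_phase R n]/(lphase : {measure set phase -> \bar R}).
by congr poweR; apply: eq_integral => z _; rewrite /= ger0_norm// cabs_ge0.
Qed.

Lemma modulation_norm_adjoint (p : R) T z : modulation_norm p%:E (adjoint T (coherent z)) =
  ((\int[lphase]_w (cabs (gabor_kernel T w z) `^ p)%:E) `^ p^-1)%E.
Proof. by rewrite modulation_normE; congr poweR; apply: eq_integral => w _; rewrite stft_adjoint. Qed.

Lemma opmodulation_normE (p q : R) T : opmodulation_norm p q T =
  ((\int[lphase]_z (modulation_norm p%:E (adjoint T (coherent z)) `^ q)) `^ q^-1)%E.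
Proof.
rewrite /opmodulation_norm -[lebesgue_phase R n]/(lphase : {measure set phase -> \bar R}).
by congr poweR; apply: eq_integral => z _; rewrite modulation_norm_adjoint -poweRrM mulrC.
Qed.

Lemma opmodulation_integral (p q : R) T : 0 < q -> opmodulation p q T ->
  (\int[lphase]_z (modulation_norm p%:E (adjoint T (coherent z)) `^ q) < +oo)%E.
Proof.
by rewrite /opmodulation /= opmodulation_normE => q0; apply: lty_poweRy; rewrite invr_eq0 gt_eqF.
Qed.

(** In [weighted_bound] the dependence on [h] is the scalar factor C e, which comes out of the L^p
    norm in w. What remains is a number depending on T alone, of which only finiteness is needed;
    this is why [weighted_mixed_norm] may be purely qualitative. *)
Lemma adjoint_bound (p q : R) T : 1 <= p -> 1 <= q -> opmodulation p q T ->
  exists B N, 0 <= B /\ forall h e, schwartz_le N e h ->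
    (modulation_norm p%:E (adjoint T h) <= (B * e)%:E)%E.
Proof.
move=> p1 q1 HT; have p0 : 0 < p by exact: lt_le_trans p1.
have q0 : 0 < q by exact: lt_le_trans q1.
have [C [N [C0 HC]]] := weighted_bound R n.
pose F0 w := weighted (T (coherent w)).
have F00 w : (0 <= F0 w)%E.
  apply: integral_ge0 => z _; rewrite lee_fin; apply: mulr_ge0; last exact: cabs_ge0.
  by rewrite invr_ge0 wt_ge0.
have mF0 : measurable_fun setT F0.
  apply: (@measurable_fun_fubini_tonelli_F _ _ _ _ _ lphase
    (fun wz : phase * phase => ((wt wz.2)^-1 * cabs (gabor_kernel T wz.1 wz.2))%:E)).
    apply/measurable_EFinP; apply: measurable_funM; last exact: measurable_gabor_kernel.
    exact: measurableT_comp (intg_measurable (intg_invwt R n)) measurable_snd.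
  move=> wz; rewrite lee_fin; apply: mulr_ge0; last exact: cabs_ge0.
  by rewrite invr_ge0 wt_ge0.
have F0p : (\int[lphase]_w (F0 w `^ p) < +oo)%E.
  apply: (@weighted_mixed_norm _ _ _ lphase (fun z => (wt z)^-1)
    (fun wz : phase * phase => cabs (gabor_kernel T wz.1 wz.2)) p q) => //.
  - by move=> z; rewrite invr_gt0 wt_gt0 invf_le1 ?wt_gt0// wt_ge1.
  - exact: intg_invwt.
  - exact: measurable_gabor_kernel.
  - by move=> wz; exact: cabs_ge0.
  have := opmodulation_integral q0 HT; congr (_ < _)%E; apply: eq_integral => z _.
  by rewrite modulation_norm_adjoint -poweRrM mulrC.
pose b := ((\int[lphase]_w (F0 w `^ p)) `^ p^-1)%E.
have bf : b \is a fin_num by rewrite ge0_fin_numE ?poweR_ge0// poweR_lty.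
exists (C * fine b), N; split; first by apply: mulr_ge0 => //; exact: fine_ge0 (poweR_ge0 _ _).
move=> h e he; have e0 := schwartz_le_ge0 he.
have Ce0 : 0 <= C * e by exact: mulr_ge0.
rewrite mulrAC EFinM fineK// modulation_normE.
apply: le_Lnorm_scale => //; first exact: measurable_cabs_stft.
  by move=> w; exact: cabs_ge0.
by move=> w; rewrite stft_adjoint; exact: HC.
Qed.

End operators.

(** * The canonical extension *)

Section extension.
Context (R : realType) (n : nat).
Local Notation phase := ('rV[R]_n * 'rV[R]_n)%type.
Implicit Types (f u v : tempered R n) (h g : schwartz R n) (z w : phase) (T : operator R n).
Local Notation lphase := (lphase R n).
Local Notation intg f := (lphase.-integrable setT (EFin \o f)).
Local Notation I f := (Rintegral lphase setT f).

(** The converse of [tempered_bound]: by linearity a single seminorm estimate gives continuity at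
    every point. *)
Lemma bounded_tempered (phi : schwartz R n -> Cplx R) :
  (forall k h g, phi (k *: h + g) = cconj k * phi h + phi g) ->
  (exists K N, 0 <= K /\ forall h e, schwartz_le N e h -> cabs (phi h) <= K * e) ->
  phi \in tempered_pred (R := R) (d := n).
Proof.
move=> lphi [K [N [K0 HK]]]; apply/asboolP; split=> // f A /nbhs_ballP[[r i] /= r0 HA].
(* The radius of a ball is a complex number here; its positivity forces the imaginary part to
   vanish. *)
have {r0} [i0 r0] : i = 0 /\ 0 < r by move: r0; rewrite ltcE/= => /andP[/eqP-> ->].
have K1 : 0 < K + 1 by rewrite ltr_wpDl.
exists N, (r / (K + 1)); split; first exact: divr_gt0.
move=> g Hg; apply: HA; rewrite /ball /= i0.
have -> : phi f - phi g = - phi (g - f).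
  by have := lphi 1 (g - f) f; rewrite scale1r subrK /cconj rmorph1 mul1r => ->; rewrite opprD addrCA subrr addr0.
rewrite normrN normc_def.
have h : cabs (phi (g - f)) < r.
  apply: (le_lt_trans (HK _ _ Hg)); rewrite mulrA mulrAC -[ltRHS]mul1r ltr_pM2r//.
  by rewrite ltr_pdivrMr// mul1r ltrDl.
by move: h; rewrite -ltcR; case: (phi _).
Qed.

(* Unlike M^p', this larger domain is visibly a linear subspace. *)
Definition pairable T (p : R) f := exists2 c, 0 <= c & forall h,
  (\int[lphase]_z (cabs (stft f z) * cabs (stft (adjoint T h) z))%:E <=
   c%:E * modulation_norm p%:E (adjoint T h))%E.

Lemma measurable_stft_mul u v : measurable_fun setT (fun z => cabs (stft u z) * cabs (stft v z)).
Proof. by apply: measurable_funM; exact: measurable_cabs_stft. Qed.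

Lemma stft_linear (k : Cplx R) u v z : stft (k *: u + v) z = k * stft u z + stft v z.
Proof. by []. Qed.

Lemma stft_adjoint_linear T (k : Cplx R) h g z :
  stft (adjoint T (k *: h + g)) z = k * stft (adjoint T h) z + stft (adjoint T g) z.
Proof. by rewrite /stft /= tempered_lin /cconj rmorphD rmorphM /= conjcK. Qed.

Lemma pairable_lin T p (k : Cplx R) u v : pairable T p u -> pairable T p v -> pairable T p (k *: u + v).
Proof.
move=> [a a0 Ha] [b b0 Hb].
have ka : 0 <= cabs k * a by apply: mulr_ge0 => //; exact: cabs_ge0.
exists (cabs k * a + b); first exact: addr_ge0.
have pos (u' v' : tempered R n) z : 0 <= cabs (stft u' z) * cabs (stft v' z).
  by apply: mulr_ge0; exact: cabs_ge0.
move=> h; set m := modulation_norm _ _.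
have m0 : (0 <= m)%E by exact: Lnorm_ge0.
apply: (@le_trans _ _ (\int[lphase]_z ((cabs k)%:E * (cabs (stft u z) * cabs (stft (adjoint T h) z))%:E +
   (cabs (stft v z) * cabs (stft (adjoint T h) z))%:E))%E).
  apply: ge0_le_integral => //.
  - by move=> z _; rewrite lee_fin.
  - by apply/measurable_EFinP; exact: measurable_stft_mul.
  - by apply: emeasurable_funD; [apply: measurable_funeM|]; apply/measurable_EFinP; exact: measurable_stft_mul.
  move=> z _; rewrite -EFinM -EFinD lee_fin mulrA -mulrDl.
  apply: ler_wpM2r; first exact: cabs_ge0.
  by rewrite stft_linear -cabsM; exact: cabsD.
rewrite ge0_integralD//; last 4 first.
- by move=> z _; rewrite mule_ge0// lee_fin ?cabs_ge0.
- by apply: measurable_funeM; apply/measurable_EFinP; exact: measurable_stft_mul.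
- by move=> z _; rewrite lee_fin.
- by apply/measurable_EFinP; exact: measurable_stft_mul.
rewrite ge0_integralZl//; last 3 first.
- by apply/measurable_EFinP; exact: measurable_stft_mul.
- by move=> z _; rewrite lee_fin.
- by rewrite lee_fin cabs_ge0.
rewrite EFinD ge0_muleDl// EFinM -muleA; apply: leeD; last exact: Hb.
by apply: lee_wpmul2l; [rewrite lee_fin cabs_ge0|exact: Ha].
Qed.

Context (p q : R) (p1 : 1 <= p) (q1 : 1 <= q) (T : operator R n) (HT : opmodulation p q T).

Lemma adjoint_modulation h : modulation p%:E (adjoint T h).
Proof.
have [B [N [B0 H]]] := adjoint_bound p1 q1 HT.
have [e [e0 he]] := schwartz_seminorm h N.
by apply: (le_lt_trans (H h e he)); rewrite ltry.
Qed.

Lemma modulation_hoelder f h :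
  (\int[lphase]_z (cabs (stft f z) * cabs (stft (adjoint T h) z))%:E <=
    modulation_norm (hoelder_conjugate p%:E) f * modulation_norm p%:E (adjoint T h))%E.
Proof.
apply: (@hoelder_conjugate_le _ _ _ lphase _ _ _ p1); try exact: measurable_cabs_stft.
  by move=> z; exact: cabs_ge0.
by move=> z; exact: cabs_ge0.
Qed.

Lemma pairableW f : modulation (hoelder_conjugate p%:E) f -> pairable T p f.
Proof.
move=> Hf; have f0 : (0 <= modulation_norm (hoelder_conjugate p%:E) f)%E by exact: Lnorm_ge0.
exists (fine (modulation_norm (hoelder_conjugate p%:E) f)); first exact: fine_ge0.
by move=> h; rewrite fineK ?ge0_fin_numE//; exact: modulation_hoelder.
Qed.

Lemma pairable_lty f h : pairable T p f ->
  (\int[lphase]_z (cabs (stft f z) * cabs (stft (adjoint T h) z))%:E < +oo)%E.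
Proof.
move=> [c c0 H]; apply: (le_lt_trans (H h)).
have := adjoint_modulation h; rewrite /modulation/= => m.
by rewrite lte_mul_pinfty// lee_fin.
Qed.

Lemma pairing_bound f h : pairable T p f ->
  ((cabs (modulation_pairing f (adjoint T h)))%:E <=
    2%:E * \int[lphase]_z (cabs (stft f z) * cabs (stft (adjoint T h) z))%:E)%E.
Proof.
move=> pf; have fin := pairable_lty h pf.
have ib : intg (fun z => cabs (stft f z) * cabs (stft (adjoint T h) z)).
  apply: ge0_intg fin; last by move=> z; apply: mulr_ge0; exact: cabs_ge0.
  exact: measurable_stft_mul.
rewrite -RintE// -EFinM lee_fin; apply: cabs_cintegral ib; first exact: cintegrable_pairing.
by move=> z; rewrite cabsM cabs_conj.
Qed.

Lemma pairing_tempered f : pairable T p f ->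
  (fun h => modulation_pairing f (adjoint T h)) \in tempered_pred (R := R) (d := n).
Proof.
move=> pf; apply: bounded_tempered.
  move=> k h g; rewrite /modulation_pairing.
  rewrite -(cintegral_lin (cconj k) (cintegrable_pairing (pairable_lty h pf)) (cintegrable_pairing (pairable_lty g pf))).
  congr cintegral; apply/funext => z; rewrite stft_adjoint_linear /cconj rmorphD rmorphM /=; ring.
have [B [N [B0 H]]] := adjoint_bound p1 q1 HT.
have [c c0 Hc] := pf.
exists (2 * (c * B)), N; split; first by apply: mulr_ge0 => //; exact: mulr_ge0.
move=> h e he; rewrite -lee_fin; apply: (le_trans (pairing_bound h pf)).
rewrite -!mulrA 2!EFinM; apply: lee_wpmul2l => //; apply: (le_trans (Hc h)).
by apply: lee_wpmul2l; [rewrite lee_fin|exact: H].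
Qed.

Lemma extension : exists A : tempered R n -> tempered R n,
  forall f, pairable T p f -> forall h, A f h = modulation_pairing f (adjoint T h).
Proof.
have /choice[A HA] : forall f, exists a : tempered R n, pairable T p f ->
    forall h, a h = modulation_pairing f (adjoint T h).
  (* The extension is prescribed only on [pairable] distributions; 0 is a default value
     elsewhere. *)
  move=> f; have [pf|npf] := pselect (pairable T p f); last by exists 0.
  by exists (Tempered (pairing_tempered pf)).
by exists A.
Qed.

End extension.

(** * The summing estimate *)

Section summability.
Context (R : realType) (n : nat).
Local Notation phase := ('rV[R]_n * 'rV[R]_n)%type.
Implicit Types (f u v : tempered R n) (h : schwartz R n) (z w : phase).
Local Notation lphase := (lphase R n).
Context (p q : R) (p1 : 1 <= p) (q1 : 1 <= q) (T : operator R n) (HT : opmodulation p q T).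
Context (A : tempered R n -> tempered R n).
Context (HA : forall f, pairable T p f -> forall h, A f h = modulation_pairing f (adjoint T h)).
Local Notation D := (modulation (d := n) (hoelder_conjugate p%:E)).
Local Notation N := (modulation_norm (d := n) (hoelder_conjugate p%:E)).
Local Notation g z := (modulation_norm p%:E (adjoint T (coherent z))).

Lemma measurable_slice_norm : measurable_fun setT (fun z : phase => g z).
Proof.
under eq_fun do rewrite modulation_norm_adjoint.
apply: (measurableT_comp (measurable_poweR _)).
apply: (@measurable_fun_fubini_tonelli_G _ _ _ _ _ lphase
  (fun wz : phase * phase => (cabs (gabor_kernel T wz.1 wz.2) `^ p)%:E)).
  by apply/measurable_EFinP; apply: measurable_powR_comp; exact: measurable_gabor_kernel.
by move=> wz; rewrite lee_fin powR_ge0.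
Qed.

Lemma modulation_norm_ge0 r u : (0 <= modulation_norm r u)%E.
Proof. exact: Lnorm_ge0. Qed.

Lemma extension_bound f h : D f ->
  ((cabs (A f h))%:E <= 2%:E * (N f * modulation_norm p%:E (adjoint T h)))%E.
Proof.
move=> Df; have pf := pairableW p1 T Df; rewrite HA//.
apply: (le_trans (pairing_bound p1 q1 HT h pf)).
by apply: lee_wpmul2l; [rewrite lee_fin|exact: modulation_hoelder].
Qed.

(** The vector k x + y need not be shown to lie in [D]: it is [pairable], which is where [HA]
    prescribes the value of [A], and linearity reduces to that of the integral. *)
Lemma extension_linear : linear_on D A.
Proof.
move=> k x y Dx Dy; apply: val_inj; apply/funext => h.
have px := pairableW p1 T Dx; have py := pairableW p1 T Dy.
rewrite -[RHS]/(k * A x h + A y h) [LHS](HA (pairable_lin k px py) h) (HA px) (HA py).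
have c u (pu : pairable T p u) := cintegrable_pairing (pairable_lty p1 q1 HT h pu).
rewrite /modulation_pairing -(cintegral_lin k (c x px) (c y py)).
by congr cintegral; apply/funext => z; rewrite stft_linear; ring.
Qed.

(** [extension_bound] at h = pi(z)phi_0 is a pointwise bound in z; its L^q norm in z is the operator
    norm times 2 |f|, by [opmodulation_normE]. *)
Lemma extension_norm f : D f ->
  (modulation_norm q%:E (A f) <= (2 * fine (opmodulation_norm p q T))%:E * N f)%E.
Proof.
move=> Df; have q0 : 0 < q by exact: lt_le_trans q1.
have Lf : opmodulation_norm p q T \is a fin_num.
  by rewrite ge0_fin_numE// opmodulation_normE poweR_ge0.
have Nf : N f \is a fin_num by rewrite ge0_fin_numE// modulation_norm_ge0.
rewrite modulation_normE EFinM fineK// opmodulation_normE.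
have -> : (2%:E * (\int[lphase]_z (g z `^ q)) `^ q^-1 * N f =
   (2 * fine (N f))%:E * (\int[lphase]_z (g z `^ q)) `^ q^-1)%E.
  by rewrite EFinM fineK// muleAC.
apply: le_Lnorm_scale => //.
- by rewrite mulr_ge0// fine_ge0// modulation_norm_ge0.
- exact: measurable_cabs_stft.
- exact: measurable_slice_norm.
- by move=> z; exact: cabs_ge0.
- by move=> z; exact: modulation_norm_ge0.
by move=> z; rewrite EFinM fineK// -muleA; exact: extension_bound.
Qed.

Lemma extension_bounded : bounded_operator D N (modulation q%:E) (modulation_norm q%:E) A.
Proof.
split; [|exact: extension_linear|exists (2 * fine (opmodulation_norm p q T)); exact: extension_norm].
move=> f Df; apply: (le_lt_trans (extension_norm Df)).
by rewrite lte_mul_pinfty// lee_fin mulr_ge0// fine_ge0// opmodulation_normE poweR_ge0.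
Qed.

Lemma slice_norm_fin z : g z \is a fin_num.
Proof.
have := adjoint_modulation p1 q1 HT (coherent z).
by rewrite /modulation/= => h; rewrite ge0_fin_numE ?modulation_norm_ge0.
Qed.

Lemma dual_ball_extension z : 0 < fine (g z) ->
  dual_ball D N (fun x => Complex (2 * fine (g z))^-1 0 * A x (coherent z)).
Proof.
move=> g0; split=> [k x y Dx Dy|x Dx].
  rewrite (extension_linear k Dx Dy) -[(k *: A x + A y) _]/(k * A x (coherent z) + A y (coherent z)).
  by rewrite mulrDr mulrCA.
have gz0 : 0 < 2 * fine (g z) by exact: mulr_gt0.
have gf := slice_norm_fin z.
have Nf : N x \is a fin_num by rewrite ge0_fin_numE ?modulation_norm_ge0.
have := extension_bound (coherent z) Dx.
rewrite -(fineK gf) -(fineK Nf) -!EFinM !lee_fin cabsM cabs_real gtr0_norm ?invr_gt0// ler_pdivrMl//.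
by move=> /le_trans; apply; rewrite mulrCA mulrC -mulrA mulrC lexx.
Qed.

Lemma extension_summing : summing q D N (modulation q%:E) (modulation_norm q%:E) A.
Proof.
split; first exact: extension_bounded.
have q0 : 0 < q by exact: lt_le_trans q1.
have Lf : opmodulation_norm p q T \is a fin_num.
  by rewrite ge0_fin_numE// opmodulation_normE poweR_ge0.
pose l := fine (opmodulation_norm p q T).
have l0 : 0 <= l by rewrite fine_ge0// opmodulation_normE poweR_ge0.
(* The bound obtained is 2 l; one is added because the definition asks for a strictly positive
   constant and [l] may be 0. *)
exists (2 * l + 1); first by rewrite ltr_wpDl// mulr_ge0.
move=> m x Dx; set S := ereal_sup _.
have S0 : (0 <= S)%E.
  (* The zero functional belongs to the dual ball, so the supremum is nonnegative. *)
  apply: (@le_trans _ _ (\sum_(i < m) cabs (0 : Cplx R) `^ q)%:E).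
    by rewrite lee_fin sumr_ge0// => i _; exact: powR_ge0.
  apply: ereal_sup_ubound; exists (fun=> 0) => //; split=> [k a b _ _|a _]; first by rewrite scaler0 addr0.
  by rewrite cabs0 modulation_norm_ge0.
have E i : (modulation_norm q%:E (A (x i)) `^ q = \int[lphase]_z (cabs (stft (A (x i)) z) `^ q)%:E)%E.
  rewrite modulation_normE -poweRrM mulVf ?gt_eqF// poweRe1//.
  by apply: integral_ge0 => z _; rewrite lee_fin powR_ge0.
under eq_bigr do rewrite E.
have mA i : measurable_fun setT (fun z : phase => (cabs (stft (A (x i)) z) `^ q)%:E).
  by apply/measurable_EFinP; apply: measurable_powR_comp; exact: measurable_cabs_stft.
rewrite -ge0_integral_sum//; last by move=> i z _; rewrite lee_fin powR_ge0.
have mg : measurable_fun setT (fun z : phase => (g z `^ q)%E).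
  exact: measurableT_comp (measurable_poweR q) measurable_slice_norm.
have pt z : (\sum_(i < m) (cabs (stft (A (x i)) z) `^ q)%:E <= ((2 `^ q)%:E * S) * (g z `^ q))%E.
  have gf := slice_norm_fin z.
  have [g0|g0] := ltP 0 (fine (g z)); last first.
    have gz : g z = 0%E by apply/eqP; rewrite eq_le modulation_norm_ge0 -(fineK gf) lee_fin g0.
    rewrite big1; first by rewrite mule_ge0 ?poweR_ge0// mule_ge0// lee_fin powR_ge0.
    move=> i _; have := extension_bound (coherent z) (Dx i).
    rewrite gz !mule0 lee_fin => c0.
    have -> : cabs (stft (A (x i)) z) = 0 by apply/eqP; rewrite eq_le c0 cabs_ge0.
    by rewrite powR0// gt_eqF.
  have gz0 : 0 < 2 * fine (g z) by exact: mulr_gt0.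
  have hS : ((\sum_(i < m) cabs (Complex (2 * fine (g z))^-1 0 * A (x i) (coherent z)) `^ q)%:E <= S)%E.
    by apply: ereal_sup_ubound; eexists; first exact: dual_ball_extension g0.
  apply: (@le_trans _ _ (((2 * fine (g z)) `^ q)%:E *
     (\sum_(i < m) cabs (Complex (2 * fine (g z))^-1 0 * A (x i) (coherent z)) `^ q)%:E)%E).
    rewrite sumEFin -EFinM lee_fin mulr_sumr; apply: ler_sum => i _.
    rewrite -powRM ?cabs_ge0 ?(ltW gz0)// cabsM cabs_real gtr0_norm ?invr_gt0// mulrA mulfV ?gt_eqF//.
    by rewrite mul1r.
  rewrite powRM ?fine_ge0 ?modulation_norm_ge0// EFinM -fine_poweR fineK ?fin_num_poweR//.
  rewrite muleAC; apply: lee_wpmul2r; first exact: poweR_ge0.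
  by apply: lee_wpmul2l; rewrite // lee_fin powR_ge0.
apply: (@le_trans _ _ (\int[lphase]_z (((2 `^ q)%:E * S) * (g z `^ q)))%E).
  apply: ge0_le_integral => //.
  - by move=> z _; apply: sume_ge0 => i _; rewrite lee_fin powR_ge0.
  - exact: emeasurable_sum.
  - exact: measurable_funeM.
have S20 : (0 <= (2 `^ q)%:E * S)%E by rewrite mule_ge0// lee_fin powR_ge0.
rewrite ge0_integralZl//; last by move=> z _; exact: poweR_ge0.
have -> : (\int[lphase]_z (g z `^ q) = (l `^ q)%:E)%E.
  rewrite /l -fine_poweR opmodulation_normE -poweRrM mulVf ?gt_eqF// poweRe1; last first.
    by apply: integral_ge0 => z _; exact: poweR_ge0.
  rewrite fineK// ge0_fin_numE; first exact: opmodulation_integral q0 HT.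
  by apply: integral_ge0 => z _; exact: poweR_ge0.
rewrite muleAC -EFinM; apply: lee_wpmul2r => //; rewrite lee_fin -powRM//.
by apply: ge0_ler_powR; rewrite ?nnegrE ?addr_ge0 ?mulr_ge0 ?lerDl ?(ltW q0).
Qed.

End summability.

Theorem proposition1p6 (R : realType) (d : nat) (p q : R)
    (hp : 1 <= p) (hq : 1 <= q) (T : operator R d) :
  opmodulation p q T ->
  exists A : tempered R d -> tempered R d,
    canonical_extension p T A /\
    summing q (modulation (hoelder_conjugate p%:E))
              (modulation_norm (hoelder_conjugate p%:E))
              (modulation q%:E) (modulation_norm q%:E) A.
Proof.
move=> HT; have [A HA] := extension hp hq HT; exists A; split.
  split; first exact: (adjoint_modulation hp hq HT).
  by move=> f Df; apply: HA; exact: (pairableW hp T Df).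
exact: (extension_summing hp hq HT HA).
Qed.
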